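(* Let $n\in\{2,3\}$, and let $d_i=\|a_i-x^o\|+r_i$, $i=1,2,\ldots$, be range measurements of an object at $x^o\in\mathbb R^n$ by sensors at $a_i\in\mathbb R^n$. Suppose that assumptions (A1), (A2), (A3) of the context hold and, in addition, that either both (A4) and (A5) hold, or (A6) holds. For each $m$ let $\hat x^{\rm LS}_m$ be a random vector that is an optimal solution of the least squares problem $$\mathop{\rm minimize}_{x\in\mathbb R^n}\ \sum_{i=1}^m\left(\|a_i-x\|-d_i\right)^2 .$$ Then $\hat x^{\rm LS}_m\to x^o$ with probability one as $m\to\infty$. Moreover, $$\sqrt m\,(\hat x^{\rm LS}_m-x^o)\to\mathcal N\left(0,\sigma^2M^{-1}(x^o)\right)\quad\text{in distribution as } m\to\infty,$$ where $M(x^o)\in\mathbb R^{n\times n}$ is the matrix with entries $M_{jk}(x^o)=\langle f_j'(x^o),f_k'(x^o)\rangle_t$.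
   Context: Notation. For real sequences $p=(p_i)_{i\in\mathbb N}$, $q=(q_i)_{i\in\mathbb N}$, the tail product is $\langle p,q\rangle_t=\lim_{m\to\infty}\frac1m\sum_{i=1}^m p_iq_i$ when the limit exists, and the tail norm is $\|p\|_t=\sqrt{\langle p,p\rangle_t}$. Set $f_i(x)=\|a_i-x\|$ (Euclidean norm), $f(x)=(f_i(x))_{i}$, and let $f_j'(x)$ be the sequence in $i$ with terms $f'_{ji}(x)=\partial f_i(x)/\partial[x]_j$, where $[x]_j$ is the $j$-th coordinate of $x$. The sample distribution function of a sequence $(z_1,z_2,\ldots)$ in $\mathbb R^n$ is $F_m(z)=\#\{i\le m: z_i\preceq z\}/m$, where $\preceq$ is the coordinatewise inequality. Assumptions. (A1) The $r_i$ are i.i.d. Gaussian with mean $0$ and finite variance $\sigma^2$. (A2) $x^o$ is an interior point of a compact set $\mathcal X\subset\mathbb R^n$; all the (deterministic) sensor positions $a_i$ lie in a bounded set $\mathcal A\subset\mathbb R^n$, and $a_i\notin\mathcal X$ for each $i$. (A3) The sample distribution function $F_m$ of $(a_1,a_2,\ldots)$ converges to a distribution function $F_\mu$, i.e. $F_m(a)\to F_\mu(a)$ at every continuity point $a\in\mathbb R^n$ of $F_\mu$; $\mu$ denotes the probability measure generated by $F_\mu$. (A4) The function $x\mapsto\|f(x)-f(x^o)\|_t^2$ on $\mathbb R^n$ has a unique minimum at $x=x^o$ (asymptotically unique localizability). (A5) There is no line $\mathcal S$ (if $n=2$), respectively plane $\mathcal S$ (if $n=3$), such that $x^o\in\mathcal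 S$ and $\mu(\mathcal S)=1$. (Lines and planes are affine.) (A6) There is no line $\mathcal S$ (if $n=2$), respectively plane $\mathcal S$ (if $n=3$), such that $\mu(\mathcal S)=1$. *)

(* Defs.v *)
From HB Require Import structures.
From mathcomp Require Import all_boot all_order all_algebra finmap.
From mathcomp Require Import all_classical all_reals all_analysis.
Import Order.TTheory GRing.Theory Num.Theory.
Import numFieldNormedType.Exports.
Set Implicit Arguments.
Unset Strict Implicit.
Unset Printing Implicit Defensive.
Local Open Scope classical_set_scope.
Local Open Scope ring_scope.

(* Sequences are indexed from 0: the first m terms are those of index i < m. *)

Section euclidean_space.
Context {R : realType} {n : nat}.
Implicit Types x y u : 'rV[R]_n.

Definition dotrv u x : R := \sum_(j < n) u 0 j * x 0 j.

(* The norm `|x| of the library on 'rV[R]_n is the sup norm. It induces the same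
   topology and bounded sets, but the ranges are Euclidean distances. *)
Definition enorm x : R := Num.sqrt (\sum_(j < n) x 0 j ^+ 2).

(* coordinatewise order *)
Definition lerv x y : bool := [forall j, x 0 j <= y 0 j].

(* affine subspace p + V of dimension d: a line for d = 1, a plane for d = 2 *)
Definition affine_subspace (d : nat) (S : set 'rV[R]_n) : Prop :=
  exists (p : 'rV[R]_n) (V : 'M[R]_n),
    \rank V = d /\ S = [set x | (x - p <= V)%MS].

End euclidean_space.

Definition borel_rV (R : realType) (n : nat) :=
  g_sigma_algebraType (@open 'rV[R]_n).

Section tail.
Context {R : realType}.
Implicit Types p q : nat -> R.

Definition tail_mean p q (m : nat) : R := m%:R^-1 * \sum_(i < m) p i * q i.

(* limn is a total operator: the tail product is meaningful when
   tail_product_exists holds *)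
Definition tail_product_exists p q : Prop := cvgn (tail_mean p q).

Definition tail_product p q : R := limn (tail_mean p q).

Definition tail_norm p : R := Num.sqrt (tail_product p p).

End tail.

Section distribution_functions.
Context {R : realType} {n : nat}.

Definition sample_cdf (z : nat -> 'rV[R]_n) (m : nat) (x : 'rV[R]_n) : R :=
  #|[pred i : 'I_m | lerv (z i) x]|%:R / m%:R.

Definition cdf_rV (Q : set 'rV[R]_n -> \bar R) (x : 'rV[R]_n) : R :=
  fine (Q [set y | lerv y x]).

Definition cvg_cdf (F : nat -> 'rV[R]_n -> R) (G : 'rV[R]_n -> R) : Prop :=
  forall x, {for x, continuous G} -> F ^~ x @ \oo --> G x.

End distribution_functions.

Section probability.
Context {R : realType}.

(* normal law on R with mean m and variance v >= 0, the Dirac mass at m when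
   v = 0 (normal_prob m 0 is not: its density is set to be the indicator of
   [0, 1]) *)
Definition normal_law (m v : R) (B : set R) : \bar R :=
  if v == 0 then dirac m B else normal_prob m (Num.sqrt v) B.

(* Q = N(m, C), for a symmetric positive semidefinite C: every linear functional
   x |-> <u, x> has law N(<u, m>, u C u^T) under Q. This determines a Borel
   probability measure Q (Cramer-Wold) and covers singular C. *)
Definition is_normal_rV (n : nat) (Q : set 'rV[R]_n -> \bar R)
    (m : 'rV[R]_n) (C : 'M[R]_n) : Prop :=
  forall (u : 'rV[R]_n) (B : set R), measurable B ->
    Q (dotrv u @^-1` B) = normal_law (dotrv u m) ((u *m C *m u^T) 0 0) B.

Definition mutually_independent (d : measure_display) (T : measurableType d)
    (P : probability T R) (X : nat -> {RV P >-> R}) : Prop :=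
  forall (J : {fset nat}) (B : nat -> set R), (forall i, measurable (B i)) ->
    P (\bigcap_(i in [set` J]) (X i @^-1` B i)) =
    (\prod_(i <- J) P (X i @^-1` B i))%E.

Definition cvg_in_distribution (d : measure_display) (T : measurableType d)
    (P : probability T R) (n : nat) (Y : nat -> T -> 'rV[R]_n)
    (Q : set 'rV[R]_n -> \bar R) : Prop :=
  cvg_cdf (fun m => cdf_rV (fun A => P (Y m @^-1` A))) (cdf_rV Q).

End probability.

Section localization.
Context {R : realType} {n : nat}.
Implicit Types (a : nat -> 'rV[R]_n) (x : 'rV[R]_n).

Definition range_fun a (i : nat) x : R := enorm (a i - x).

(* j-th partial derivative at x of the i-th range, as a sequence in i *)
Definition range_partial a (j : 'I_n) x (i : nat) : R :=
  'D_(delta_mx 0 j) (range_fun a i) x.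

Definition range_mx a x : 'M[R]_n :=
  \matrix_(j, k) tail_product (range_partial a j x) (range_partial a k x).

Definition ls_cost a (d : nat -> R) (m : nat) x : R :=
  \sum_(i < m) (enorm (a i - x) - d i) ^+ 2.

End localization.

(* Main.v *)
Require Import Defs.
From HB Require Import structures.
From mathcomp Require Import all_boot all_order all_algebra finmap.
From mathcomp Require Import all_classical all_reals all_analysis.
From mathcomp Require Import measurable_realfun ring lra.
Import Order.TTheory GRing.Theory Num.Theory.
Import numFieldNormedType.Exports.
Set Implicit Arguments.
Unset Strict Implicit.
Unset Printing Implicit Defensive.
Local Open Scope classical_set_scope.
Local Open Scope ring_scope.

(* Write D_i(x) = f_i(x) - f_i(xo) and u_i for the direction from a_i to xo. Up to
   a constant, the least squares cost divided by m is
     avg_(i < m) D_i(x)^2 - 2 avg_(i < m) D_i(x) r_i.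
   The sensor averages of Lipschitz functions of a_i converge: the a_i are bounded
   and the frequencies of the cells of a fine grid converge by (A3), for a grid
   that avoids the atoms of the marginals of mu. The averages of c_i r_i with
   bounded deterministic c_i vanish almost surely, by Gaussian tails and
   Borel-Cantelli; countably many choices of c suffice because D_i(x) is Lipschitz
   in x, uniformly in i. The limit of avg D_i(x)^2 is positive for x <> xo, either
   by (A4) or because its vanishing would put mu on the bisector of x and xo. Hence
   the estimates converge to xo.

   At x = xo + h the cost is h M h^T - 2 w_m h^T + o(|h|^2), with
   w_m = avg r_i u_i, and M is positive definite because mu is not carried by a
   hyperplane through xo. Completing the square shows that the estimation error is
   w_m M^-1 up to a relative error that tends to 0. Since the law of i.i.d.
   centred normal variables is invariant under rotations, sqrt m w_m has the law of
   (r_0, ..., r_(n-1)) U_m, where U_m is the triangular Cholesky factor of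
   avg u_i^T u_i. These factors converge, and the limit law is that of a fixed
   linear image of n normal variables: no central limit theorem is needed. *)

(** * Gaussian laws and rotations *)

(** Analysis and probability are kept apart. Consistency and linearization are statements about one
    fixed noise sequence with the properties collected in [averaged_out]; chance enters only in
    showing that almost every sample has them, and in the law of [noise_row]. The obstacle at [xo]
    is the cross term D_i(x) r_i: the noise is controlled there only through the bounded averages of
    |r_i|, so D_i has to be expanded to second order, and the quadratic terms weighted by the noise
    must be averaged out separately. The distance between the estimation error and [newton_step] is
    bounded relative to the step, because such a bound survives multiplication by sqrt m. For the
    limit law, equality in law replaces the scaled noise average by a linear image of the same n
    noise variables for every m; on the given probability space these images converge pointwise, and
    the distribution functions are compared by small shifts of their argument. *)

Section lebesgue_affine.
Context {R : realType}.
Notation leb := lebesgue_measure.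
Notation push mf := (measure_function_pushforward__canonical__measure_function_Measure leb mf).

Lemma lebesgue_measure_shift (t : R) (A : set R) : measurable A ->
  leb ((fun x => x + t) @^-1` A) = leb A.
Proof.
move=> mA; pose f := fun x : R => x + t.
have mf : measurable_fun [set: measurableTypeR R] (f : measurableTypeR R -> measurableTypeR R).
  exact: measurable_funD.
apply/esym.
apply: (lebesgue_measure_unique (mu := push mf)) => //.
move=> X [[a b]] _ <-; 
rewrite -[RHS]/(leb (f @^-1` `]a, b])).
rewrite [in RHS](_ : _ @^-1` _ = `]a - t, b - t]%classic); last first.
  by apply/seteqP; split=> x /=; rewrite /f !in_itv/= ltrBlDr lerBrDr.
rewrite !lebesgue_measure_itv/= !lte_fin ltrD2r.
by case: ifP => // _; rewrite -!EFinB opprB addrA subrK.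
Qed.

Lemma lebesgue_measure_scale (s : R) (A : set R) : 0 < s -> measurable A ->
  (s%:E * leb ( *%R s @^-1` A))%E = leb A.
Proof.
move=> s0 mA.
have mf : measurable_fun [set: measurableTypeR R] ( *%R s : measurableTypeR R -> measurableTypeR R).
  exact: mulrl_measurable.
apply/esym.
refine (lebesgue_measure_unique (mu := [the measure _ _ of mscale (NngNum (ltW s0)) (push mf)]) _ mA) => //.
move=> X [[a b]] _ <-; 
rewrite -[RHS]/(s%:E * leb ( *%R s @^-1` `]a, b]))%E.
rewrite [in RHS](_ : _ @^-1` _ = `](a / s), (b / s)]%classic); last first.
  by apply/seteqP; split=> x /=; rewrite !in_itv/= ltr_pdivrMr// ler_pdivlMr// mulrC.
rewrite !lebesgue_measure_itv/= !lte_fin ltr_pM2r ?invr_gt0//.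
case: ifP => [ab|_]; last by rewrite mule0.
by rewrite -!EFinB -EFinM; congr EFin; field; rewrite gt_eqF.
Qed.

Lemma ge0_integral_shift (t : R) (f : R -> \bar R) :
  measurable_fun [set: R] f -> (forall x, 0 <= f x)%E ->
  (\int[leb]_y f (y + t)%R = \int[leb]_y f y)%E.
Proof.
move=> mf f0.
have mF : measurable_fun [set: measurableTypeR R] ((fun x => x + t) : measurableTypeR R -> measurableTypeR R).
  exact: measurable_funD.
have := @ge0_integral_pushforward _ _ _ _ R _ mF leb setT f measurableT mf (fun x _ => f0 x).
rewrite preimage_setT => <-.
by apply: eq_measure_integral => A mA _; exact: lebesgue_measure_shift.
Qed.

(** The plane integral in iterated form: a shear along the inner variable is a translation for each
    fixed value of the outer one, and Tonelli serves to swap the variables. *)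
Definition iterated_integral (f : R * R -> \bar R) : \bar R :=
  (\int[leb]_x \int[leb]_y f (x, y))%E.

Lemma iterated_integral_shearr (t : R) (f : R * R -> \bar R) :
  measurable_fun [set: R * R] f -> (forall z, 0 <= f z)%E ->
  iterated_integral (fun z => f (z.1, z.2 + t * z.1)) = iterated_integral f.
Proof.
move=> mf f0; apply: eq_integral => x _ /=.
rewrite (ge0_integral_shift (t * x) (f := fun y => f (x, y)))//.
exact: measurable_fun_pair2.
Qed.

Lemma iterated_integralC (f : R * R -> \bar R) :
  measurable_fun [set: R * R] f -> (forall z, 0 <= f z)%E ->
  iterated_integral (fun z => f (z.2, z.1)) = iterated_integral f.
Proof.
move=> mf f0; rewrite /iterated_integral [RHS]fubini_tonelli//.
Qed.

Lemma measurable_linear_pair (a b c e : R) :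
  measurable_fun [set: R * R] (fun z : R * R => (a * z.1 + b * z.2, c * z.1 + e * z.2)).
Proof.
apply: measurable_fun_pair; apply: measurable_funD.
- exact: (measurable_funM (measurable_cst _) measurable_fst).
- exact: (measurable_funM (measurable_cst _) measurable_snd).
- exact: (measurable_funM (measurable_cst _) measurable_fst).
- exact: (measurable_funM (measurable_cst _) measurable_snd).
Qed.

Definition rotation (c s : R) (z : R * R) : R * R :=
  (c * z.1 + s * z.2, - s * z.1 + c * z.2).

Lemma measurable_rotation (c s : R) : measurable_fun [set: R * R] (rotation c s).
Proof. exact: measurable_linear_pair. Qed.

Lemma measurable_comp_linear (a b c e : R) (f : R * R -> \bar R) :
  measurable_fun [set: R * R] f ->
  measurable_fun [set: R * R]
    (fun z : R * R => f (a * z.1 + b * z.2, c * z.1 + e * z.2)).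
Proof. by move=> mf; exact: (measurableT_comp mf (measurable_linear_pair a b c e)). Qed.

Lemma iterated_integral_shearl (t : R) (f : R * R -> \bar R) :
  measurable_fun [set: R * R] f -> (forall z, 0 <= f z)%E ->
  iterated_integral (fun z => f (z.1 + t * z.2, z.2)) = iterated_integral f.
Proof.
move=> mf f0.
have mf' : measurable_fun [set: R * R] (fun z : R * R => f (z.1 + t * z.2, z.2)).
  have := measurable_comp_linear 1 t 0 1 mf; congr measurable_fun.
  by apply/funext => z /=; rewrite !mul1r mul0r add0r.
have mfC : measurable_fun [set: R * R] (fun z : R * R => f (z.2, z.1)).
  have := measurable_comp_linear 0 1 1 0 mf; congr measurable_fun.
  by apply/funext => z /=; rewrite !mul1r !mul0r addr0 add0r.
rewrite -(iterated_integralC mf' (fun z => f0 _)) -(iterated_integralC mf f0).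
exact: (iterated_integral_shearr t mfC (fun z => f0 _)).
Qed.

(* A rotation of angle different from pi is a product of three shears. *)
Lemma iterated_integral_rotation (c s : R) (f : R * R -> \bar R) :
  c ^+ 2 + s ^+ 2 = 1 ->
  measurable_fun [set: R * R] f -> (forall z, 0 <= f z)%E ->
  iterated_integral (f \o rotation c s) = iterated_integral f.
Proof.
have main c' s' (g : R * R -> \bar R) : c' != - 1 -> c' ^+ 2 + s' ^+ 2 = 1 ->
    measurable_fun [set: R * R] g -> (forall z, 0 <= g z)%E ->
    iterated_integral (g \o rotation c' s') = iterated_integral g.
  move=> cN1 cs1 mg g0.
  have c1 : 1 + c' != 0 by rewrite addrC addr_eq0.
  (* [t] is the tangent of half the angle. The rotation is the shear by [t] along the first axis,
     then by [- s'] along the second, then by [t] along the first again. *)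
  pose t := s' / (1 + c').
  have st : s' * t = 1 - c'.
    by rewrite /t mulrA -expr2 (_ : s' ^+ 2 = 1 - c' ^+ 2); [field|rewrite -cs1; ring].
  have tc : t * (1 + c') = s' by rewrite /t divfK.
  have m1 : measurable_fun [set: R * R] (fun z : R * R => g (z.1 + t * z.2, z.2)).
    have := measurable_comp_linear 1 t 0 1 mg; congr measurable_fun.
    by apply/funext => z /=; rewrite !mul1r mul0r add0r.
  have m2 : measurable_fun [set: R * R]
      (fun z : R * R => g (z.1 + t * (z.2 + - s' * z.1), z.2 + - s' * z.1)).
    have := measurable_comp_linear (1 - t * s') t (- s') 1 mg; congr measurable_fun.
    by apply/funext => z /=; congr (g (_, _)); ring.
  rewrite -(iterated_integral_shearl t mg g0).
  rewrite -(iterated_integral_shearr (- s') m1 (fun z => g0 _)).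
  rewrite -(iterated_integral_shearl t m2 (fun z => g0 _)).
  congr iterated_integral; apply/funext => z; rewrite /rotation/=.
  congr (g (_, _)).
    transitivity ((1 - s' * t) * z.1 + t * (1 + (1 - s' * t)) * z.2); last by ring.
    by rewrite st subKr tc.
  transitivity (- s' * z.1 + (1 - s' * t) * z.2); last by ring.
  by rewrite st subKr.
move=> cs1 mf f0; have [cN1|] := eqVneq c (- 1); last by move=> ?; exact: main.
(* The half turn, whose half-angle has no tangent, is the square of the quarter turn
   [rotation 0 1]. *)
have s0 : s = 0.
  by apply/eqP; rewrite -sqrf_eq0 -(addKr (c ^+ 2) (s ^+ 2)) cs1 cN1 sqrrN expr1n addNr.
have q : (0 : R) ^+ 2 + 1 ^+ 2 = 1 by rewrite expr0n expr1n add0r.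
have q1 : (0 : R) != - 1 by rewrite eq_sym oppr_eq0 oner_eq0.
have m1 : measurable_fun [set: R * R] (f \o rotation 0 1).
  exact: (measurable_comp_linear 0 1 (- 1) 0 mf).
rewrite -(main 0 1 f q1 q mf f0) -(main 0 1 _ q1 q m1 (fun z => f0 _)).
congr iterated_integral; apply/funext => z; rewrite /rotation/= cN1 s0.
by congr (f (_, _)); ring.
Qed.

End lebesgue_affine.

Section gauss_law.
Context {R : realType}.
Notation leb := lebesgue_measure.
Notation push mf := (measure_function_pushforward__canonical__measure_function_Measure leb mf).
Notation phi := (@normal_pdf R 0 1).
Notation stdn := (@normal_prob R 0 1).

(** The Radon-Nikodym derivative of the normal law agrees with the density almost everywhere,
    because both have the same integral over every measurable set. *)
Lemma integral_normal_prob (f : R -> \bar R) : measurable_fun setT f ->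
  (\int[stdn]_x `|f x| < +oo)%E ->
  (\int[stdn]_x f x = \int[leb]_x (f x * (phi x)%:E))%E.
Proof.
move=> mf finf; have dom := normal_prob_dominates (0 : R) 1.
rewrite -(Radon_Nikodym_change_of_variables dom)//=; last first.
  by apply/integrableP; split.
have iphi := integrable_normal_pdf (0 : R) 1.
apply: ae_eq_integral => //.
- by apply: emeasurable_funM.
- by apply: emeasurable_funM => //; exact: measurable_int iphi.
- apply: ae_eqe_mul2l; rewrite Radon_NikodymE.
  case: cid => /= h [h1 h2 h3].
  apply: integral_ae_eq => //; first exact: measurable_int iphi.
  by move=> E _ mE; rewrite -h3.
Qed.

Lemma measurable_mulr (s : R) :
  measurable_fun [set: measurableTypeR R] ( *%R s : measurableTypeR R -> R).
Proof. exact: mulrl_measurable. Qed.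

Definition mulr_mfun (s : R) : {mfun measurableTypeR R >-> R} :=
  HB.pack ( *%R s : measurableTypeR R -> R)
    (isMeasurableFun.Build _ _ _ _ _ (measurable_mulr s)).

(** An image of the standard law rather than a density, so that [s = 0] gives the point mass at 0
    and degenerate noise obeys the same lemmas. *)
Definition gauss_law (s : R) : probability R R := distribution stdn (mulr_mfun s).

Lemma gauss_lawE s B : gauss_law s B = stdn ( *%R s @^-1` B).
Proof. by []. Qed.

Lemma gauss_law_scale (c s : R) (B : set R) : gauss_law s ( *%R c @^-1` B) = gauss_law (c * s) B.
Proof. by rewrite !gauss_lawE; congr stdn; apply/seteqP; split=> x /=; rewrite mulrA. Qed.

Lemma normal_pdf_scale (s x : R) : 0 < s -> s * normal_pdf 0 s (s * x) = phi x.
Proof.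
move=> s0; rewrite /normal_pdf oner_eq0 gt_eqF//= mulrA; congr (_ * _).
  rewrite /normal_peak expr1n mul1r -mulrnAr sqrtrM ?sqr_ge0// sqrtr_sqr gtr0_norm//.
  by rewrite invfM mulrA divff ?mul1r// gt_eqF.
rewrite /normal_fun !subr0 expr1n exprMn; congr expR.
by field; rewrite gt_eqF.
Qed.

Lemma normal_law_gauss (s : R) (B : set R) : 0 <= s -> measurable B ->
  normal_law 0 (s ^+ 2) B = gauss_law s B.
Proof.
move=> s0 mB; rewrite /normal_law gauss_lawE sqrf_eq0 sqrtr_sqr ger0_norm//.
have [->|sn0] := eqVneq s 0.
  rewrite diracE; have [B0|B0] := pselect (B 0).
    rewrite mem_set// (_ : _ @^-1` _ = setT) ?probability_setT//.
    by apply/seteqP; split=> x //= _; rewrite mul0r.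
  rewrite memNset// (_ : _ @^-1` _ = set0) ?measure0//.
  by apply/seteqP; split=> x //=; rewrite mul0r.
have sgt0 : 0 < s by rewrite lt_def sn0.
have mf : measurable_fun [set: measurableTypeR R] ( *%R s : measurableTypeR R -> measurableTypeR R).
  exact: mulrl_measurable.
have mp : measurable_fun [set: R] (fun x : R => (normal_pdf 0 s x)%:E).
  by apply: measurableT_comp => //; exact: measurable_normal_pdf.
have p0 x : (0 <= (normal_pdf 0 s x)%:E)%E by rewrite lee_fin normal_pdf_ge0.
(* Substitution x = s y: Lebesgue measure is [s] times its image under the scaling, and the density
   absorbs the factor [s]. *)
transitivity (s%:E * \int[push mf]_(x in B) (normal_pdf 0 s x)%:E)%E.
  rewrite -(ge0_integral_mscale (push mf) mB (NngNum s0)) //=; last first.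
    exact: measurable_funTS.
  apply: eq_measure_integral => A mA _.
  by rewrite -[RHS]/(s%:E * leb ( *%R s @^-1` A))%E lebesgue_measure_scale.
have -> := @ge0_integral_pushforward _ _ _ _ R _ mf leb B (fun x => (normal_pdf 0 s x)%:E) mB
  (measurable_funTS mp) (fun x _ => p0 x).
have mB' : measurable ( *%R s @^-1` B : set (measurableTypeR R)).
  by rewrite -[X in measurable X]setTI; exact: mf.
rewrite -ge0_integralZl//=; last first.
  apply: measurable_funTS; exact: (measurableT_comp mp (@mulrl_measurable R setT s)).
by apply: eq_integral => x _; rewrite -EFinM normal_pdf_scale.
Qed.

(** The scaling goes into the indicator and the density remains that of the standard pair. Rotations
    commute with scaling, so their effect can be computed on the standard density whatever [s]
    is. *)
Lemma gauss_law_product (s : R) (B : set (R * R)) : measurable B ->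
  (gauss_law s \x gauss_law s)%E B =
  iterated_integral (fun z => (\1_B (s * z.1, s * z.2) * (phi z.1 * phi z.2))%:E).
Proof.
move=> mB; rewrite /product_measure1/=.
have mQ := measurable_fun_xsection (gauss_law s) mB.
rewrite (@ge0_integral_pushforward _ _ (measurableTypeR R) R R _ (measurable_mulr s) stdn setT _ measurableT)//.
rewrite preimage_setT integral_normal_prob.
- apply: eq_integral => x _ /=.
  have mx : measurable ( *%R s @^-1` xsection B (s * x) : set (measurableTypeR R)).
    rewrite -[X in measurable X]setTI.
    exact: measurable_mulr (measurable_xsection _ mB).
  rewrite /normal_prob integral_mkcond/= muleC -ge0_integralZl//=; last 3 first.
  - apply/measurable_restrict => //; rewrite ?setIT//.
    apply: measurable_funTS; apply: measurableT_comp => //; exact: measurable_normal_pdf.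
  - by move=> y _; rewrite patchE; case: ifP => // _; rewrite lee_fin normal_pdf_ge0.
  - by rewrite lee_fin normal_pdf_ge0.
  apply: eq_integral => y _; rewrite patchE indicE.
  rewrite (_ : (y \in _) = ((s * x, s * y) \in B)); last first.
    by apply/idP/idP; rewrite !inE /xsection/= inE.
  by case: ifP => _; rewrite ?mul1r ?mul0r ?mule0// EFinM.
- exact: (measurableT_comp mQ (@mulrl_measurable R setT s)).
- apply: (@le_lt_trans _ _ (\int[stdn]_x (cst 1 x))%E); last first.
    rewrite integral_cst// mul1e.
    by rewrite (le_lt_trans (probability_le1 _ _)) ?ltry.
  apply: ge0_le_integral => //.
  + by apply: measurableT_comp => //; exact: (measurableT_comp mQ (@mulrl_measurable R setT s)).
  + move=> x _ /=; rewrite gee0_abs// probability_le1//.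
    rewrite -[X in measurable X]setTI.
    exact: measurable_mulr (measurable_xsection _ mB).
Qed.

Lemma normal_pdf_rotation (c s : R) (z : R * R) : c ^+ 2 + s ^+ 2 = 1 ->
  phi (rotation c s z).1 * phi (rotation c s z).2 = phi z.1 * phi z.2.
Proof.
move=> cs1; rewrite /normal_pdf oner_eq0 /normal_fun !subr0/=.
rewrite ![_ * expR _ * _]mulrACA -!expRD; congr (_ * expR _).
rewrite -!mulrDl; congr (_ / _); rewrite -!opprD; congr (- _).
by rewrite -[RHS]mul1r -cs1; ring.
Qed.

Lemma gauss_law_rotation (t c s : R) (B : set (R * R)) : c ^+ 2 + s ^+ 2 = 1 ->
  measurable B ->
  (gauss_law t \x gauss_law t)%E (rotation c s @^-1` B) =
  (gauss_law t \x gauss_law t)%E B.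
Proof.
move=> cs1 mB.
have mrB : measurable (rotation c s @^-1` B).
  by rewrite -[X in measurable X]setTI; exact: measurable_rotation.
rewrite (gauss_law_product t mrB) (gauss_law_product t mB).
pose f z := (\1_B (t * z.1, t * z.2) * (phi z.1 * phi z.2))%:E.
have mf : measurable_fun [set: R * R] f.
  apply: measurableT_comp => //; apply: measurable_funM.
    have := measurableT_comp (measurable_indic mB : measurable_fun setT (\1_B : R * R -> R))
      (measurable_linear_pair t 0 0 t).
    congr measurable_fun; apply/funext => z /=.
    by rewrite !mul0r addr0 add0r.
  apply: measurable_funM.
    exact: (measurableT_comp (measurable_normal_pdf 0 1) measurable_fst).
  exact: (measurableT_comp (measurable_normal_pdf 0 1) measurable_snd).
have f0 z : (0 <= f z)%E by rewrite lee_fin !mulr_ge0 ?normal_pdf_ge0.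
rewrite -[RHS](iterated_integral_rotation cs1 mf f0).
congr iterated_integral; apply/funext => z; rewrite /f /=.
rewrite -(normal_pdf_rotation z cs1); congr (_ * _)%:E.
rewrite !indicE /rotation/=.
rewrite (_ : (_ \in _) = ((c * (t * z.1) + s * (t * z.2), - s * (t * z.1) + c * (t * z.2)) \in B)).
  by congr ((_ \in B)%:R); congr (_, _); ring.
by apply/idP/idP; rewrite !inE.
Qed.

End gauss_law.

Section gauss_tail.
Context {R : realType}.
Notation leb := lebesgue_measure.
Notation phi := (@normal_pdf R 0 1).

Lemma measurable_norm_gt (t : R) : measurable [set x : R | t < `|x|]%R.
Proof.
rewrite (_ : mkset _ = (@Num.norm R R) @^-1` `]t, +oo[%classic); last first.
  by apply/seteqP; split=> x /=; rewrite in_itv/= andbT.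
by rewrite -[X in measurable X]setTI; exact: normr_measurable.
Qed.

(* Since x^2/2 >= t^2/4 + x^2/4 where |x| > t, the standard density is there
   dominated by a multiple of the density of variance 2. *)
Lemma normal_prob_tail (t : R) : 0 <= t ->
  (normal_prob 0 1 [set x : R | t < `|x|]%R <=
    (Num.sqrt 2 * expR (- (t ^+ 2 / 4)))%:E)%E.
Proof.
move=> t0; pose s : R := Num.sqrt 2.
have s0 : 0 < s by rewrite sqrtr_gt0 ltr0n.
have s2 : s ^+ 2 = 2 by rewrite sqr_sqrtr ?ler0n.
pose c := s * expR (- (t ^+ 2 / 4)).
have c0 : 0 <= c by rewrite mulr_ge0 ?expR_ge0// ltW.
have mA := measurable_norm_gt t.
have mpdf (u : R) : measurable_fun [set: measurableTypeR R] (fun x : measurableTypeR R => (normal_pdf 0 u x)%:E).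
  by apply: measurableT_comp => //; exact: measurable_normal_pdf.
have p0 (u : R) x : (0 <= (normal_pdf 0 u x)%:E)%E by rewrite lee_fin normal_pdf_ge0.
apply: (@le_trans _ _ (\int[leb]_(x in [set x : R | (t < `|x|)%R]) (c * normal_pdf 0 s x)%:E)%E).
  apply: ge0_le_integral => //.
  - exact: measurable_funTS (mpdf 1).
  - by apply: measurable_funTS; apply: measurableT_comp => //; apply: measurable_funM => //; exact: measurable_normal_pdf.
  - move=> x /= tx; rewrite lee_fin /normal_pdf oner_eq0 gt_eqF//.
    have -> : normal_peak 1 = s * normal_peak s :> R.
      rewrite /normal_peak expr1n mul1r -mulrnAr sqrtrM ?sqr_ge0// sqrtr_sqr gtr0_norm//.
      by rewrite invfM mulrA divff ?mul1r// gt_eqF.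
    have -> : c * (normal_peak s * normal_fun 0 s x) =
        s * normal_peak s * (expR (- (t ^+ 2 / 4)) * normal_fun 0 s x) by rewrite /c; ring.
    rewrite ler_wpM2l//.
      by rewrite mulr_ge0 ?normal_peak_ge0// ltW.
    rewrite /normal_fun subr0 s2 expr1n -expRD ler_expR.
    have : t ^+ 2 <= x ^+ 2.
      by rewrite -[x ^+ 2]real_normK ?num_real// ler_sqr ?nnegrE// ltW.
    lra.
apply: (@le_trans _ _ (\int[leb]_x (c * normal_pdf 0 s x)%:E)%E).
  apply: ge0_subset_integral => //.
  - by apply: measurableT_comp => //; apply: measurable_funM => //; exact: measurable_normal_pdf.
  - by move=> x _; rewrite lee_fin mulr_ge0 ?normal_pdf_ge0.
under eq_integral do rewrite EFinM.
by rewrite ge0_integralZl_EFin// integral_normal_pdf mule1.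
Qed.

Lemma gauss_law_tail (t s : R) : 0 <= t -> 0 <= s ->
  (gauss_law s [set x : R | t * s < `|x|]%R <=
    (Num.sqrt 2 * expR (- (t ^+ 2 / 4)))%:E)%E.
Proof.
move=> t0 s0; apply: le_trans (normal_prob_tail t0).
rewrite gauss_lawE; apply: le_measure; rewrite ?inE//.
- by rewrite -[X in measurable X]setTI; exact: measurable_mulr (measurable_norm_gt _).
- exact: measurable_norm_gt.
move=> x /=; rewrite normrM (ger0_norm s0) mulrC.
have [->|sn0] := eqVneq s 0; first by rewrite !mul0r ltxx.
by rewrite ltr_pM2l// lt_def sn0.
Qed.

End gauss_tail.

(** Rectangles are stable under intersection and generate the product sigma-algebra. The use is for
    the law of two coordinates restricted to an event on the others, a finite measure that is in
    general not a probability. *)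
Lemma finite_measure_unique_rectangles (R : realType) d1 d2 (T1 : measurableType d1)
    (T2 : measurableType d2) (m1 m2 : {measure set (T1 * T2) -> \bar R}) :
  (m1 setT < +oo)%E ->
  (forall A B, measurable A -> measurable B -> m1 (A `*` B) = m2 (A `*` B)) ->
  forall C, measurable C -> m1 C = m2 C.
Proof.
move=> m1oo m12 C mC.
pose G : set (set (T1 * T2)) :=
  [set C | exists A, measurable A /\ exists B, measurable B /\ C = A `*` B].
apply: (measure_unique G (fun=> setT)) => //.
- rewrite measurable_prod_measurableType //; congr (<<s _ >>).
  rewrite predeqE; split => [[A mA [B mB <-]]|[A [mA [B [mB ->]]]]].
    by exists A; split => //; exists B.
  by exists A => //; exists B.
- move=> /= _ _ [X1 [mX1 [X2 [mX2 ->]]]] [Y1 [mY1 [Y2 [mY2 ->]]]].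
  rewrite -setXI; exists (X1 `&` Y1); split; first exact: measurableI.
  by exists (X2 `&` Y2); split => //; exact: measurableI.
- by move=> _; exists setT; split => //; exists setT; split => //; rewrite setXTT.
- by apply/seteqP; split=> // x _; exists 0%N.
- by move=> A [A1 [mA1 [A2 [mA2 ->]]]]; exact: m12.
Qed.

(** * Rotations of i.i.d. vectors and reduction to triangular form *)

Section iid.
Context {R : realType} d (T : measurableType d) (P : probability T R).
Variable Q : probability R R.

Definition iid m (z : T -> 'cV[R]_m) : Prop :=
  (forall l, measurable_fun setT (fun w => z w l 0)) /\
  forall B : 'I_m -> set R, (forall l, measurable (B l)) ->
    P [set w | forall l, B l (z w l 0)] = (\prod_(l < m) Q (B l))%E.

Lemma measurable_forall_ord m (z : T -> 'cV[R]_m) (C : pred 'I_m) (B : 'I_m -> set R) :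
  (forall l, measurable_fun setT (fun w => z w l 0)) -> (forall l, measurable (B l)) ->
  measurable [set w | forall l, C l -> B l (z w l 0)].
Proof.
move=> mz mB.
rewrite (_ : mkset _ = \bigcap_(l in [set l | C l]) ((fun w => z w l 0) @^-1` B l)); last first.
  by apply/seteqP; split=> w /= h l; exact: h.
apply: fin_bigcap_measurable => // l _.
by rewrite -[X in measurable X]setTI; exact: mz.
Qed.

(** The coordinates outside the image of [f] are left free by the choice [setT], which contributes a
    factor 1. *)
Lemma iid_sub m k (f : 'I_k -> 'I_m) (z : T -> 'cV[R]_m) : injective f ->
  iid z -> iid (fun w => \col_l z w (f l) 0).
Proof.
move=> finj [mz zE]; split=> [l|B mB].
  by under eq_fun do rewrite mxE; exact: mz.
pose B' l := if [pick i | f i == l] is Some i then B i else setT.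
have B'f i : B' (f i) = B i.
  rewrite /B'; case: pickP => [j /eqP/finj -> //|/(_ i)]; by rewrite eqxx.
have mB' l : measurable (B' l) by rewrite /B'; case: pickP.
rewrite (_ : mkset _ = [set w | forall l, B' l (z w l 0)]); last first.
  apply/seteqP; split=> w /= h l; last by rewrite mxE -B'f.
  rewrite /B'; case: pickP => [i /eqP <-|//].
  by have := h i; rewrite mxE.
rewrite zE// (bigID (fun l => [exists i, f i == l]))/= [X in (_ * X)%E]big1 ?mule1; last first.
  move=> l /existsPn h; rewrite /B'; case: pickP => [i|_]; first by rewrite (negbTE (h i)).
  exact: probability_setT.
rewrite (eq_bigl (mem [set f i | i in [set: 'I_k]]%SET)); last first.
  move=> l; apply/existsP/imsetP => [[i /eqP <-]|[i _ ->]]; last by exists i.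
  by exists i => //; rewrite finset.inE.
rewrite big_imset/=; last by move=> i j _ _; exact: finj.
by apply: eq_big => [i|i _]; rewrite ?finset.inE ?B'f.
Qed.

Lemma iid_distribution m (z : T -> 'cV[R]_m) (l : 'I_m) (B : set R) :
  iid z -> measurable B -> P [set w | B (z w l 0)] = Q B.
Proof.
move=> [mz zE] mB; pose B' i := if i == l then B else setT.
rewrite (_ : mkset _ = [set w | forall i, B' i (z w i 0)]); last first.
  apply/seteqP; split=> w /= h; last by have := h l; rewrite /B' eqxx.
  by move=> i; rewrite /B'; case: eqP => [->|].
rewrite zE; last by move=> i; rewrite /B'; case: ifP.
rewrite (bigD1 l)//= big1 ?mule1 /B' ?eqxx// => i /negbTE ->.
exact: probability_setT.
Qed.

(** Givens rotation in the rows [p] and [q], for any number of columns: the same operation acts on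
    the noise vector and on the coefficient matrix, and one Gram identity gives the invariance both
    of [z^T *m V] and of [V^T *m V]. *)
Definition row_rotation m k (p q : 'I_m) (c s : R) (V : 'M[R]_(m, k)) : 'M[R]_(m, k) :=
  \matrix_(l, j) if l == p then c * V p j + s * V q j
                  else if l == q then - s * V p j + c * V q j else V l j.

Lemma row_rotation_Gram m k k' (p q : 'I_m) (c s : R) (U : 'M[R]_(m, k))
    (V : 'M[R]_(m, k')) : p != q -> c ^+ 2 + s ^+ 2 = 1 ->
  (row_rotation p q c s U)^T *m row_rotation p q c s V = U^T *m V.
Proof.
move=> pq cs1; have qp : q != p by rewrite eq_sym.
apply/matrixP => i j; rewrite !mxE.
rewrite (bigD1 p)// (bigD1 q)//= [RHS](bigD1 p)// [in RHS](bigD1 q)//= !mxE.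
rewrite !eqxx (negbTE qp) !addrA; congr (_ + _).
  by rewrite -[RHS]mul1r -cs1; ring.
by apply: eq_bigr => l /andP[/negbTE lp /negbTE lq]; rewrite !mxE lp lq.
Qed.

Hypothesis rotQ : forall c s (B : set (R * R)), c ^+ 2 + s ^+ 2 = 1 ->
  measurable B -> (Q \x Q)%E (rotation c s @^-1` B) = (Q \x Q)%E B.

(** On the event [E] that the other coordinates lie in their sets, the pair of coordinates [p] and
    [q] has the law [kap] times [Q \x Q], with [kap] the probability of [E]. This measure is
    identified on rectangles and is invariant under rotation. *)
Lemma iid_row_rotation m (z : T -> 'cV[R]_m) (p q : 'I_m) (c s : R) : p != q ->
  c ^+ 2 + s ^+ 2 = 1 -> iid z -> iid (fun w => row_rotation p q c s (z w)).
Proof.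
move=> pq cs1 [mz zE]; have qp : q != p by rewrite eq_sym.
split=> [l|B mB].
  under eq_fun do rewrite mxE.
  case: (l == p); last case: (l == q); last exact: mz.
    exact: (measurable_funD (measurable_funM (measurable_cst _) (mz p))
                            (measurable_funM (measurable_cst _) (mz q))).
  exact: (measurable_funD (measurable_funM (measurable_cst _) (mz p))
                            (measurable_funM (measurable_cst _) (mz q))).
pose E := [set w | forall l, (l != p) && (l != q) -> B l (z w l 0)].
have mE : measurable E by exact: measurable_forall_ord.
pose xy w := (z w p 0, z w q 0).
have mxy : measurable_fun [set: T] xy by exact: measurable_fun_pair.
pose kap := (\prod_(l < m | (l != p) && (l != q)) Q (B l))%E.
have kap0 : (0 <= kap)%E by apply: prode_ge0 => l _; exact: measure_ge0.
have kapfin : kap \is a fin_num.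
  by apply: prode_fin_num => l _; rewrite fin_num_measure.
have kapE : kap = (fine kap)%:E by rewrite fineK.
have kapr0 : 0 <= fine kap by rewrite fine_ge0.
pose m1 := measure_function_pushforward__canonical__measure_function_Measure
  [the measure _ _ of mrestr P mE] mxy.
pose m2 := [the measure _ _ of mscale (NngNum kapr0) (Q \x Q)%E].
have prodE (C D : set R) (F := fun l => if l == p then C else if l == q then D else B l) :
    (\prod_(l < m) Q (F l) = kap * (Q C * Q D))%E.
  rewrite (bigD1 p)// (bigD1 q)//= /F eqxx (negbTE qp) eqxx muleA muleC.
  by congr (_ * _)%E; apply: eq_bigr => l /andP[/negbTE -> /negbTE ->].
have m12 C D : measurable C -> measurable D -> m1 (C `*` D) = m2 (C `*` D).
  move=> mC mD.
  rewrite -[LHS]/(P (xy @^-1` (C `*` D) `&` E)).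
  rewrite -[RHS]/((fine kap)%:E * (Q \x Q) (C `*` D))%E product_measure1E// -kapE -prodE.
  rewrite -zE; last by move=> l; case: ifP => // _; case: ifP.
  congr (P _); apply/seteqP; split=> w /=.
    move=> [[Cw Dw] Ew] l; case: eqP => [->//|/eqP lp]; case: eqP => [->//|/eqP lq].
    by apply: Ew; rewrite lp.
  move=> h; split.
    by split; [have := h p; rewrite eqxx|have := h q; rewrite eqxx (negbTE qp)].
  by move=> l /andP[/negbTE lp /negbTE lq]; have := h l; rewrite lp lq.
have m1oo : (m1 setT < +oo)%E.
  rewrite -[m1 _]/(P (xy @^-1` setT `&` E)) preimage_setT setTI.
  by rewrite (le_lt_trans (probability_le1 P mE)) ?ltry.
have mrB : measurable (rotation c s @^-1` (B p `*` B q)).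
  by rewrite -[X in measurable X]setTI; apply: measurable_rotation => //; exact: measurableX.
have := finite_measure_unique_rectangles m1oo m12 mrB.
rewrite -[m1 _]/(P (xy @^-1` (rotation c s @^-1` (B p `*` B q)) `&` E)).
rewrite -[m2 _]/((fine kap)%:E * (Q \x Q) (rotation c s @^-1` (B p `*` B q)))%E.
rewrite rotQ//; last exact: measurableX.
rewrite product_measure1E// -kapE -prodE => PE.
transitivity (\prod_(l < m) Q (if l == p then B p else if l == q then B q else B l))%E.
  rewrite -PE; congr (P _); apply/seteqP; split=> w /=.
    move=> h; split; first by split; [have := h p|have := h q]; rewrite mxE ?eqxx ?(negbTE qp).
    by move=> l /andP[/negbTE lp /negbTE lq]; have := h l; rewrite mxE lp lq.
  move=> [[h1 h2] h3] l; rewrite mxE.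
  case: eqP => [->//|/eqP lp]; case: eqP => [->//|/eqP lq].
  by apply: h3; rewrite lp lq.
by apply: eq_bigr => l _; case: eqP => [->//|_]; case: eqP => [->|].
Qed.

(** The angle is that of the vector (V p j, V q j), whose length becomes the new pivot, hence
    nonnegative; a zero vector takes the identity. The last clause protects the columns already
    cleared in both rows. *)
Lemma iid_eliminate m n (p q : 'I_m) (j : 'I_n) (z : T -> 'cV[R]_m) (V : 'M[R]_(m, n)) :
  p != q -> iid z -> exists (z' : T -> 'cV[R]_m) (V' : 'M[R]_(m, n)),
    [/\ iid z', forall w, (z' w)^T *m V' = (z w)^T *m V, V'^T *m V' = V^T *m V &
      [/\ V' q j = 0, 0 <= V' p j, forall l i, l != p -> l != q -> V' l i = V l i &
        forall i, V p i = 0 -> V q i = 0 -> V' p i = 0 /\ V' q i = 0]].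
Proof.
move=> pq iz; have qp : q != p by rewrite eq_sym.
pose t := Num.sqrt (V p j ^+ 2 + V q j ^+ 2).
have t2 : t ^+ 2 = V p j ^+ 2 + V q j ^+ 2 by rewrite sqr_sqrtr// addr_ge0 ?sqr_ge0.
have [c [s [cs1 e1 e2]]] : exists c s : R, [/\ c ^+ 2 + s ^+ 2 = 1,
    - s * V p j + c * V q j = 0 & c * V p j + s * V q j = t].
  have [t0|t0] := eqVneq t 0.
    exists 1, 0; rewrite t0; move/eqP: t2; rewrite t0 expr0n/= eq_sym paddr_eq0 ?sqr_ge0//.
    by rewrite !sqrf_eq0 => /andP[/eqP-> /eqP->]; rewrite !mulr0 !addr0 expr1n.
  exists (V p j / t), (V q j / t); split.
  - by rewrite !exprMn -mulrDl -t2 -exprMn divff ?expr1n.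
  - by field.
  - have -> : V p j / t * V p j + V q j / t * V q j = t ^+ 2 / t by rewrite t2; field.
    by field.
exists (fun w => row_rotation p q c s (z w)), (row_rotation p q c s V); split.
- exact: iid_row_rotation.
- by move=> w; exact: row_rotation_Gram.
- exact: row_rotation_Gram.
split.
- by rewrite mxE (negbTE qp) eqxx.
- by rewrite mxE eqxx e2 sqrtr_ge0.
- by move=> l i /negbTE lp /negbTE lq; rewrite mxE lp lq.
- by move=> i Vp Vq; rewrite !mxE eqxx (negbTE qp) eqxx Vp Vq !mulr0 addr0.
Qed.

(* Givens rotations: they preserve both the i.i.d. law and the Gram matrix of V. *)
Lemma iid_triangularize m n (z : T -> 'cV[R]_m) (V : 'M[R]_(m, n)) : (n < m)%N ->
  iid z -> exists (z' : T -> 'cV[R]_m) (V' : 'M[R]_(m, n)),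
    [/\ iid z', forall w, (z' w)^T *m V' = (z w)^T *m V, V'^T *m V' = V^T *m V &
      forall (l : 'I_m) (j : 'I_n), ((j < l)%N -> V' l j = 0) /\ (j = l :> nat -> 0 <= V' l j)].
Proof.
move=> nm iz.
suff H k : (k <= n)%N -> exists (z' : T -> 'cV[R]_m) (V' : 'M[R]_(m, n)),
    [/\ iid z', forall w, (z' w)^T *m V' = (z w)^T *m V, V'^T *m V' = V^T *m V &
      forall (l : 'I_m) (j : 'I_n), (j < k)%N -> ((j < l)%N -> V' l j = 0) /\ (j = l :> nat -> 0 <= V' l j)].
  have [z' [V' [? ? ? h]]] := H n (leqnn n).
  by exists z', V'; split=> // l j; exact: h.
elim: k => [|k IHk] kn; first by exists z, V; split.
have [z0 [V0 [iz0 e0 G0 h0]]] := IHk (ltnW kn).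
pose j0 := Ordinal kn; pose p0 := Ordinal (ltn_trans kn nm).
(* Column [k] is cleared below its pivot one row at a time. Since k < n < m, row k + 1 exists, so at
   least one rotation is performed, and it makes the pivot nonnegative. *)
suff H q : (q < m)%N -> (k < q)%N -> exists (z' : T -> 'cV[R]_m) (V' : 'M[R]_(m, n)),
    [/\ iid z', forall w, (z' w)^T *m V' = (z w)^T *m V, V'^T *m V' = V^T *m V &
      [/\ forall (l : 'I_m) (j : 'I_n), (j < k)%N -> ((j < l)%N -> V' l j = 0) /\ (j = l :> nat -> 0 <= V' l j),
          0 <= V' p0 j0 & forall l : 'I_m, (k < l <= q)%N -> V' l j0 = 0]].
  have mm : (m.-1 < m)%N by rewrite prednK// (leq_ltn_trans _ nm).
  have [|z' [V' [? ? ? [h1 h2 h3]]]] := H m.-1 mm.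
    by rewrite -ltnS prednK ?(leq_ltn_trans _ nm)// (leq_ltn_trans kn).
  exists z', V'; split=> // l j; rewrite ltnS leq_eqVlt => /orP[/eqP jk|]; last exact: h1.
  have -> : j = j0 by exact: val_inj.
  split=> [/= kl|/= kl]; first by apply: h3; rewrite kl/= -ltnS prednK// (leq_ltn_trans _ nm).
  by have -> : l = p0 by apply: val_inj; rewrite /= kl.
have step u (z1 : T -> 'cV[R]_m) (V1 : 'M[R]_(m, n)) : forall qm : (u < m)%N, (k < u)%N ->
    [/\ iid z1, forall w, (z1 w)^T *m V1 = (z w)^T *m V, V1^T *m V1 = V^T *m V &
      (forall (l : 'I_m) (j : 'I_n), (j < k)%N -> ((j < l)%N -> V1 l j = 0) /\ (j = l :> nat -> 0 <= V1 l j)) /\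
      forall l : 'I_m, (k < l < u)%N -> V1 l j0 = 0] ->
    exists (z' : T -> 'cV[R]_m) (V' : 'M[R]_(m, n)),
    [/\ iid z', forall w, (z' w)^T *m V' = (z w)^T *m V, V'^T *m V' = V^T *m V &
      [/\ forall (l : 'I_m) (j : 'I_n), (j < k)%N -> ((j < l)%N -> V' l j = 0) /\ (j = l :> nat -> 0 <= V' l j),
          0 <= V' p0 j0 & forall l : 'I_m, (k < l <= u)%N -> V' l j0 = 0]].
  move=> qm kq [iz1 e1 G1 [h1 h2]]; pose q0 := Ordinal qm.
  have pq : p0 != q0 by apply/eqP => /(congr1 val)/= kqE; rewrite kqE ltnn in kq.
  have [z' [V' [iz' e' G' [V'u V'p V'o V'z]]]] := iid_eliminate j0 V1 pq iz1.
  exists z', V'; split=> //; [by move=> w; rewrite e' e1|by rewrite G' G1|split=> //].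
    move=> l j jk; have [|lp] := eqVneq l p0.
      move=> ->; split=> [_|/= jE]; last by rewrite jE ltnn in jk.
      by have [] := V'z j (proj1 (h1 p0 j jk) jk) (proj1 (h1 q0 j jk) (ltn_trans jk kq)).
    have [|lq] := eqVneq l q0; last by rewrite V'o//; exact: h1.
    move=> ->; split=> [_|/= jE]; last by rewrite jE ltnNge (ltnW kq) in jk.
    by have [] := V'z j (proj1 (h1 p0 j jk) jk) (proj1 (h1 q0 j jk) (ltn_trans jk kq)).
  move=> l /andP[kl lq]; have [->//|lq'] := eqVneq l q0.
  have lp : l != p0 by apply/eqP => lpE; rewrite lpE ltnn in kl.
  rewrite V'o// h2// kl/= ltn_neqAle lq andbT.
  by apply/eqP => lqE; case/eqP: lq'; exact: val_inj.
elim: q => // q IHq qm; rewrite ltnS leq_eqVlt => /orP[/eqP kq|kq].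
  apply: (step q.+1 z0 V0 qm); first by rewrite kq.
  split=> //; split=> // l; rewrite ltnS kq => /andP[ql lq].
  by have := leq_trans ql lq; rewrite ltnn.
have [z1 [V1 [iz1 e1 G1 [h1 h2 h3]]]] := IHq (ltnW qm) kq.
by apply: (step q.+1 z1 V1 qm); rewrite ?ltnS ?(ltnW kq).
Qed.

(** Triangularize the single column [c]: only its top entry survives, and the Gram matrix together
    with the sign identifies it as the Euclidean norm of [c]. The condition [1 < m] is the row
    surplus asked for by the triangularization. *)
Lemma iid_linear m (z : T -> 'cV[R]_m) (c : 'I_m -> R) (B : set R) : (1 < m)%N ->
  iid z -> measurable B ->
  P [set w | B (\sum_l c l * z w l 0)] =
  Q ( *%R (Num.sqrt (\sum_l c l ^+ 2)) @^-1` B).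
Proof.
move=> m1 iz mB; pose V : 'M[R]_(m, 1) := \matrix_(l, j) c l.
have [z' [V' [iz' e G h]]] := iid_triangularize V m1 iz.
pose l0 := Ordinal (ltnW m1).
have V'0 l : l != l0 -> V' l 0 = 0.
  by move=> ll0; apply: (proj1 (h l 0)); rewrite lt0n.
have V'ge0 : 0 <= V' l0 0 by exact: (proj2 (h l0 0)).
have <- : V' l0 0 = Num.sqrt (\sum_l c l ^+ 2).
  apply/eqP; rewrite -(@eqrXn2 _ 2)// ?sqrtr_ge0// sqr_sqrtr; last first.
    by apply: sumr_ge0 => l _; exact: sqr_ge0.
  have := congr1 (fun M : 'M[R]_1 => M 0 0) G; rewrite !mxE.
  rewrite (bigD1 l0)//= big1 => [|l ll0]; last by rewrite mxE V'0// mul0r.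
  rewrite addr0 mxE -expr2 => ->; apply/eqP.
  by apply: eq_bigr => l _; rewrite !mxE expr2.
have mVB : measurable ( *%R (V' l0 0) @^-1` B).
  by rewrite -[X in measurable X]setTI; exact: mulrl_measurable.
rewrite -(iid_distribution l0 iz' mVB); congr (P _); apply: eq_set => w /=.
suff -> : \sum_l c l * z w l 0 = V' l0 0 * z' w l0 0 by [].
have := congr1 (fun M : 'M[R]_1 => M 0 0) (e w); rewrite !mxE.
rewrite (bigD1 l0)//= big1 => [|l ll0]; last by rewrite V'0// mulr0.
by rewrite addr0 mxE mulrC => ->; apply: eq_bigr => l _; rewrite !mxE mulrC.
Qed.

End iid.

Lemma mutually_independent_iid (R : realType) d (T : measurableType d)
    (P : probability T R) (Q : probability R R) (r : nat -> {RV P >-> R}) m :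
  mutually_independent r ->
  (forall i (B : set R), measurable B -> distribution P (r i) B = Q B) ->
  iid P Q (fun w => \col_(l < m) r l w).
Proof.
move=> ind dist; split=> [l|B mB].
  by under eq_fun do rewrite mxE; exact: measurable_funP.
pose B' i := if insub i is Some l then B l else setT.
have B'E (l : 'I_m) : B' l = B l by rewrite /B' valK.
have mB' i : measurable (B' i) by rewrite /B'; case: insubP.
have := ind [fset i in iota 0 m]%fset B' mB'.
rewrite (_ : \bigcap_(i in _) _ = [set w | forall l : 'I_m, B l ((\col_(l < m) r l w) l 0)]).
  move=> ->; rewrite (perm_big (iota 0 m)) => [|].
    rewrite -{1}[m]subn0 -/(index_iota 0 m) big_mkord.
    by apply: eq_bigr => l _; rewrite B'E -(dist l).
  by apply: uniq_perm => [||i]; rewrite ?fset_uniq ?iota_uniq// !inE.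
apply/seteqP; split=> w /= h l.
  by rewrite mxE -B'E; apply: h; rewrite /= !inE mem_iota add0n ltn_ord.
rewrite /= !inE mem_iota add0n => lm.
by have := h (Ordinal lm); rewrite mxE -B'E.
Qed.

(** * Averages of Gaussian noise *)

(** At [m = 0] the value is 0, by the convention for the inverse of 0. *)
Definition avg (R : realType) (u : nat -> R) (m : nat) : R := m%:R^-1 * \sum_(i < m) u i.

Section borel_cantelli.
Context {R : realType} d (T : measurableType d) (P : probability T R).

Lemma ae_eventually_not_geometric (F : nat -> set T) (C q : R) : 0 <= C -> 0 <= q < 1 ->
  (forall m, measurable (F m)) -> (forall m, P (F m) <= (C * q ^+ m)%:E)%E ->
  {ae P, forall w, \forall m \near \oo, ~ F m w}.
Proof.
move=> C0 /andP[q0 q1] mF PF.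
have sumF : (\sum_(m <oo) P (F m) < +oo)%E.
  apply: (@le_lt_trans _ _ (C * (1 - q)^-1)%:E); last by rewrite ltry.
  apply: lime_le; first exact: is_cvg_nneseries.
  near=> n; apply: (@le_trans _ _ (\sum_(0 <= i < n) (C * q ^+ i)%:E)%E).
    by apply: lee_sum => i _; exact: PF.
  rewrite sumEFin lee_fin.
  have -> : \sum_(0 <= i < n) C * q ^+ i = C * (1 - q ^+ n) / (1 - q).
    by have /(congr1 (fun f => f n)) := geometric_seriesE C (negbT (lt_eqF q1)).
  rewrite -mulrA.
  by rewrite ler_wpM2l// ler_piMl ?invr_ge0 ?subr_ge0 ?(ltW q1)// gerBl exprn_ge0.
exists (lim_sup_set F); split.
- by apply: bigcap_measurable => // n _; apply: bigcup_measurable => k _; exact: mF.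
- exact: lim_sup_set_cvg0.
move=> w /= nF n _; apply: contrapT => hF; apply: nF; exists n => // m /= nm Fm.
by apply: hF; exists m.
Unshelve. all: by end_near.
Qed.

Lemma probability_bigsetU (I : Type) (s : seq I) (F : I -> set T) :
  (forall i, measurable (F i)) ->
  (P (\big[setU/set0]_(i <- s) F i) <= \sum_(i <- s) P (F i))%E.
Proof.
move=> mF; elim: s => [|i s IH]; first by rewrite !big_nil measure0.
rewrite !big_cons (le_trans (measureU2 _ _ _))//; last exact: leeD2l.
by apply: bigsetU_measurable => j _; exact: mF.
Qed.

End borel_cantelli.

Section gauss_noise.
Context {R : realType} d (T : measurableType d) (P : probability T R).
Variables (s : R) (r : nat -> {RV P >-> R}).
Hypothesis s0 : 0 <= s.
Hypothesis r_indep : mutually_independent r.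
Hypothesis r_law : forall i (B : set R), measurable B ->
  distribution P (r i) B = gauss_law s B.

Lemma noise_iid m : iid P (gauss_law s) (fun w => \col_(l < m) r l w).
Proof. exact: mutually_independent_iid. Qed.

Lemma measurable_noise_sum (c : nat -> R) m :
  measurable_fun setT (fun w => \sum_(i < m) c i * r i w).
Proof.
by apply: measurable_sum => i; apply: measurable_funM => //; exact: measurable_funP.
Qed.

Lemma noise_tail (c : nat -> R) m (t : R) : 0 <= t ->
  (P [set w | t * (s * Num.sqrt (\sum_(i < m) c i ^+ 2)) < `|\sum_(i < m) c i * r i w| ]%R <=
    (Num.sqrt 2 * expR (- (t ^+ 2 / 4)))%:E)%E.
Proof.
(* Two zero coefficients are appended, because [iid_linear] asks for at least two coordinates. *)
move=> t0; pose c' i := if (i < m)%N then c i else 0.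
have c'E (F : nat -> R -> R) : (forall i, F i 0 = 0) ->
    \sum_(i < m.+2) F i (c' i) = \sum_(i < m) F i (c i).
  move=> F0; rewrite !big_ord_recr/= /c' ltnn ltnNge leqnSn/= !F0 !addr0.
  by apply: eq_bigr => i _; rewrite ltn_ord.
have mA : measurable [set x : R | t * (s * Num.sqrt (\sum_(i < m) c i ^+ 2)) < `|x|]%R.
  exact: measurable_norm_gt.
have := iid_linear (@gauss_law_rotation R s) (fun i => c' i) _ (noise_iid m.+2) mA.
rewrite (c'E (fun _ x => x ^+ 2)) => [|i]; last by rewrite expr0n.
move=> /(_ isT); rewrite gauss_law_scale => PE.
rewrite (_ : mkset _ = [set w | [set x : R | t * (s * Num.sqrt (\sum_(i < m) c i ^+ 2)) < `|x|]%R
    (\sum_(l < m.+2) c' l * (\col_(l < m.+2) r l w) l 0)]); last first.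
  apply: eq_set => w /=.
  suff -> : \sum_(l < m.+2) c' l * (\col_(l < m.+2) r l w) l 0 = \sum_(i < m) c i * r i w by [].
  rewrite -(c'E (fun i x => x * r i w)) => [|i]; last by rewrite mul0r.
  by apply: eq_bigr => i _; rewrite mxE.
rewrite PE [s * _]mulrC; apply: gauss_law_tail => //.
by rewrite mulr_ge0// sqrtr_ge0.
Qed.

Lemma noise_tail_bounded (c : nat -> R) (K eta : R) m : 0 <= eta -> 0 <= K ->
  (forall i, (i < m)%N -> `|c i| <= K) ->
  (P [set w | eta * m%:R < `|\sum_(i < m) c i * r i w| ]%R <=
    (Num.sqrt 2 * expR (- (eta ^+ 2 / (4 * (s * K + 1) ^+ 2))) ^+ m)%:E)%E.
Proof.
(* The [+ 1] keeps the scale positive when [s * K = 0]. A deviation [eta * m] is then at least eta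
   sqrt m / a standard deviations of the sum. *)
move=> eta0 K0 cK; set a := s * K + 1.
have a0 : 0 < a by rewrite ltr_wpDl// mulr_ge0.
have t0 : 0 <= eta * Num.sqrt m%:R / a by rewrite divr_ge0 ?(ltW a0)// mulr_ge0 ?sqrtr_ge0.
have := noise_tail c m t0.
have -> : - ((eta * Num.sqrt m%:R / a) ^+ 2 / 4) = - (eta ^+ 2 / (4 * a ^+ 2)) * m%:R.
  rewrite !exprMn sqr_sqrtr// exprVn; field.
  by rewrite gt_eqF.
rewrite expRM_natr; apply: le_trans; apply: le_measure; rewrite ?inE.
- rewrite -[X in measurable X]setTI.
  exact: (measurable_noise_sum c m _ (measurable_norm_gt (eta * m%:R))).
- rewrite -[X in measurable X]setTI.
  exact: (measurable_noise_sum c m _ (measurable_norm_gt _)).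
move=> w /=; apply: le_lt_trans.
have c2 : Num.sqrt (\sum_(i < m) c i ^+ 2) <= K * Num.sqrt m%:R.
  rewrite -(ler_sqr) ?nnegrE ?mulr_ge0 ?sqrtr_ge0// exprMn !sqr_sqrtr//; last first.
    by apply: sumr_ge0 => i _; exact: sqr_ge0.
  have -> : K ^+ 2 * m%:R = \sum_(i < m) K ^+ 2 by rewrite sumr_const card_ord mulr_natr.
  apply: ler_sum => i _.
  by rewrite -[leLHS]real_normK ?num_real// ler_sqr ?nnegrE// cK.
have -> : eta * m%:R = eta * Num.sqrt m%:R / a * (a * Num.sqrt m%:R).
  rewrite [RHS](_ : _ = eta * Num.sqrt m%:R ^+ 2); first by rewrite sqr_sqrtr.
  by field; rewrite gt_eqF.
rewrite ler_wpM2l// (le_trans (ler_wpM2l s0 c2))// mulrA ler_wpM2r ?sqrtr_ge0//.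
by rewrite lerDl.
Qed.

Lemma ae_avg_cvg0 (c : nat -> R) (K : R) : (forall i, `|c i| <= K) ->
  {ae P, forall w, avg (fun i => c i * r i w) @ \oo --> (0 : R)}.
Proof.
move=> cK; have K0 : 0 <= K by rewrite (le_trans _ (cK 0%N)).
suff H k : {ae P, forall w, \forall m \near \oo,
    ~ ([set w | k.+1%:R^-1 * m%:R < `|\sum_(i < m) c i * r i w| ]%R w)}.
  have := ae_foralln H; apply: filterS => w Hw.
  apply/cvgrPdist_le => /= e e0.
  have [k ke] : exists k, k.+1%:R^-1 < e.
    by have [k _ /(_ k (leqnn k)) ke] := near_infty_natSinv_lt (PosNum e0); exists k.
  near=> m; rewrite sub0r normrN /avg normrM ger0_norm ?invr_ge0//.
  have m0 : (0 < m)%N by near: m; exists 1%N.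
  rewrite ler_pdivrMl ?ltr0n// mulrC; apply: (@le_trans _ _ (k.+1%:R^-1 * m%:R)); last first.
    by rewrite ler_wpM2r// ltW.
  by rewrite leNgt; apply/negP; near: m; exact: Hw.
pose q : R := expR (- (k.+1%:R^-1 ^+ 2 / (4 * (s * K + 1) ^+ 2))).
apply: (@ae_eventually_not_geometric _ _ _ P _ (Num.sqrt 2) q).
- exact: sqrtr_ge0.
- rewrite expR_ge0/= /q -expR0 ltr_expR oppr_lt0 divr_gt0 ?exprn_gt0 ?invr_gt0//.
  by rewrite mulr_gt0// exprn_gt0// ltr_wpDl// mulr_ge0.
- move=> m; rewrite -[X in measurable X]setTI.
  exact: (measurable_noise_sum c m _ (measurable_norm_gt _)).
- by move=> m; apply: noise_tail_bounded => // i _.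
Unshelve. all: by end_near.
Qed.

(* |r_0| + ... + |r_(m-1)| is one of the 2^m signed sums, each of which has a
   Gaussian tail. *)
Lemma ae_avg_norm_bounded :
  exists K : R, {ae P, forall w, \forall m \near \oo, avg (fun i => `|r i w|) m <= K}.
Proof.
(* With this [K] the exponent in [noise_tail_bounded] is 4 per term, and 2 exp(-4) < 1 keeps the
   union over the 2^m sign patterns geometric. *)
pose K : R := 4 * (s + 1); exists K.
have s1 : 0 < s + 1 by rewrite ltr_wpDl.
pose q : R := 2 * expR (- 4).
have q01 : 0 <= q < 1.
  rewrite /q mulr_ge0 ?expR_ge0//= expRN; have : 1 + 4 <= expR (4 : R) by exact: expR_ge1Dx.
  by move=> e4; rewrite ltr_pdivrMr ?expR_gt0// mul1r (lt_le_trans _ e4)//; lra.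
have := @ae_eventually_not_geometric _ _ _ P
  (fun m => [set w | K * m%:R < \sum_(i < m) `|r i w|]%R) (Num.sqrt 2) q (sqrtr_ge0 _) q01.
have mS m : measurable [set w | K * m%:R < \sum_(i < m) `|r i w|]%R.
  have mf : measurable_fun setT (fun w => \sum_(i < m) `|r i w|).
    by apply: measurable_sum => i; apply: measurableT_comp => //; exact: measurable_funP.
  rewrite (_ : mkset _ = (fun w => \sum_(i < m) `|r i w|) @^-1` `]K * m%:R, +oo[%classic).
    by rewrite -[X in measurable X]setTI; exact: mf.
  by apply/seteqP; split=> w /=; rewrite in_itv/= andbT.
move=> /(_ mS) H; apply: filterS (H _) => [w|m].
  apply: filterS2 (nbhs_infty_gt 0) => m m0 /negP; rewrite -leNgt => h.
  by rewrite /avg ler_pdivrMl ?ltr0n// mulrC.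
pose sg (f : {ffun 'I_m -> bool}) (i : nat) : R :=
  if insub i is Some l then (-1) ^+ f l else 0.
have sg1 f i : `|sg f i| <= 1.
  by rewrite /sg; case: insubP => [l _ _|_]; rewrite ?normr0// normrX normrN1 expr1n.
pose F f := [set w | K * m%:R < `|\sum_(i < m) sg f i * r i w| ]%R.
have mF f : measurable (F f).
  rewrite -[X in measurable X]setTI.
  exact: (measurable_noise_sum (sg f) m _ (measurable_norm_gt _)).
apply: (@le_trans _ _ (P (\big[setU/set0]_(f : {ffun 'I_m -> bool}) F f))).
  apply: le_measure; rewrite ?inE//; first by apply: bigsetU_measurable.
  move=> w /= h; pose f : {ffun 'I_m -> bool} := [ffun i : 'I_m => r i w < 0].
  rewrite (bigD1 f)//=; left; rewrite /F/=; apply: (lt_le_trans h).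
  rewrite (_ : \sum_(i < m) `|r i w| = \sum_(i < m) sg f i * r i w) ?ler_norm//.
  apply: eq_bigr => i _; rewrite /sg valK ffunE; case: ltP => ri.
    by rewrite expr1 mulN1r ltr0_norm.
  by rewrite expr0 mul1r ger0_norm.
apply: (le_trans (probability_bigsetU _ _ mF)).
apply: (@le_trans _ _ (\sum_(f : {ffun 'I_m -> bool}) (Num.sqrt 2 * expR (- 4) ^+ m)%:E)%E).
  apply: lee_sum => f _.
  have := @noise_tail_bounded (sg f) 1 K m _ ler01 (fun i _ => sg1 f i).
  rewrite mulr1 (_ : K ^+ 2 / (4 * (s + 1) ^+ 2) = 4); first by apply; rewrite mulr_ge0 ?ltW.
  by rewrite /K; field; rewrite gt_eqF.
rewrite sumEFin sumr_const card_ffun card_bool card_ord lee_fin.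
by rewrite -[leLHS]mulr_natr natrX /q exprMn mulrAC -mulrA.
Qed.

End gauss_noise.

(** * Averages over the sensors *)

Section borel_row_vectors.
Context {R : realType} {n : nat}.

Lemma rV_norm_lt (x : 'rV[R]_n) (e : R) : 0 < e ->
  (`|x| < e) <-> (forall j, `|x 0 j| < e).
Proof.
move=> e0; have := mx_norm_ball R 1 n.
move=> /(congr1 (fun b => b 0 e x)); rewrite /ball_/= sub0r normrN => <-.
split=> [[_ h] j|h]; first by have := h 0 j; rewrite /ball/= mxE sub0r normrN.
by split=> // i j; rewrite /ball/= mxE ord1 sub0r normrN.
Qed.

Lemma rV_norm_ge (x : 'rV[R]_n) j : `|x 0 j| <= `|x|.
Proof.
apply/ler_addgt0Pr => e e0; apply/ltW.
have h : 0 < `|x| + e by rewrite ltr_wpDl.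
by apply: (proj1 (rV_norm_lt x h)); rewrite ltrDl.
Qed.

Lemma rV_norm_le (x : 'rV[R]_n) (e : R) : 0 <= e -> (forall j, `|x 0 j| <= e) -> `|x| <= e.
Proof.
move=> e0 h; apply/ler_addgt0Pr => u u0; apply/ltW/rV_norm_lt => [|j].
  by rewrite ltr_wpDl.
by rewrite (le_lt_trans (h j))// ltrDl.
Qed.

Definition rational_box (c : 'rV[rat]_n) (k : nat) : set 'rV[R]_n :=
  [set x | forall j, `|x 0 j - ratr (c 0 j)| < k.+1%:R^-1].

(** The boxes are countably many, so the open sets that generate the Borel sets become countable
    unions of conditions on the coordinates. *)
Lemma open_rational_boxes (U : set 'rV[R]_n) : open U ->
  U = \bigcup_c \bigcup_(k in [set k | rational_box c k `<=` U]) rational_box c k.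
Proof.
move=> oU; apply/seteqP; split=> [x Ux|x [c _ [k kU ckx]]]; last exact: kU.
have /nbhs_ballP[e /= e0 xeU] : nbhs x U by exact: open_nbhs_nbhs.
have [k _ /(_ k (leqnn k)) ke] := near_infty_natSinv_lt (PosNum (divr_gt0 e0 (ltr0n R 2 : 0 < 2))).
have k0 : 0 < k.+1%:R^-1 :> R by rewrite invr_gt0.
have /choice[c cP] : forall j : 'I_n, exists q : rat, `|x 0 j - ratr q| < k.+1%:R^-1.
  move=> j; have /rat_in_itvoo[q] : x 0 j < x 0 j + k.+1%:R^-1 by rewrite ltrDl.
  rewrite in_itv/= => /andP[q1 q2]; exists q.
  by rewrite distrC gtr0_norm ?subr_gt0// ltrBlDl.
exists (\row_j c j) => //; exists k => [y yB|j]; last by rewrite mxE.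
apply: xeU; rewrite mx_norm_ball /ball_/=; apply/rV_norm_lt => // j; rewrite !mxE.
have := yB j; have := cP j; rewrite mxE /= in ke *.
move=> h1 h2; rewrite (_ : x 0 j - y 0 j = (x 0 j - ratr (c j)) - (y 0 j - ratr (c j))); last by ring.
rewrite (le_lt_trans (ler_normB _ _))// (splitr e) ltrD// (lt_trans _ ke)//.
Qed.

Lemma countable_rational_centers : countable [set: 'rV[rat]_n].
Proof. exact: countableP. Qed.

Lemma measurable_fun_borel_rV d (T : measurableType d) (f : T -> 'rV[R]_n) :
  (forall j, measurable_fun setT (fun w => f w 0 j)) ->
  measurable_fun setT (f : T -> borel_rV R n).
Proof.
move=> mf; refine (@measurability _ _ T (borel_rV R n) setT f (@open 'rV[R]_n) erefl _).
move=> _ [U oU <-]; rewrite setTI (open_rational_boxes oU) preimage_bigcup.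
apply: countable_bigcupT_measurable; first exact: countable_rational_centers.
move=> c; rewrite preimage_bigcup; apply: bigcup_measurable => k _.
rewrite (_ : _ @^-1` _ = \bigcap_(j in [set: 'I_n])
    (fun w => f w 0 j - ratr (c 0 j)) @^-1` ball (0 : R) k.+1%:R^-1).
  apply: fin_bigcap_measurable => // j _; rewrite -[X in measurable X]setTI.
  by apply: measurable_funB => //; exact: measurable_ball.
by apply/seteqP; split=> w /= h j; have := h j; rewrite /ball/= sub0r normrN //; apply.
Qed.

Lemma measurable_open_rV (U : set 'rV[R]_n) : open U -> measurable (U : set (borel_rV R n)).
Proof. by move=> oU; exact: sub_sigma_algebra. Qed.

Lemma measurable_continuous_rV (f : 'rV[R]_n -> R) : continuous f ->
  measurable_fun [set: borel_rV R n] (f : borel_rV R n -> R).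
Proof.
move=> cf; apply: (measurability _ (RGenOpens.measurableE R)).
move=> _ [_ [a [b ->] <-]]; rewrite setTI; apply: measurable_open_rV.
by apply: open_comp => [x _|]; [exact: cf|exact: interval_open].
Qed.

Lemma measurable_coord (j : 'I_n) :
  measurable_fun [set: borel_rV R n] ((fun x => x 0 j) : borel_rV R n -> R).
Proof. by apply: measurable_continuous_rV => x; exact: coord_continuous. Qed.

End borel_row_vectors.

Section borel_boxes.
Context {R : realType} {n : nat}.

Definition measurable_boxes : set (set (borel_rV R n)) :=
  [set C | exists2 B : 'I_n -> set R, forall j, measurable (B j) &
     C = [set x : 'rV[R]_n | forall j, B j (x 0 j)]].

Lemma measurable_box (B : 'I_n -> set R) : (forall j, measurable (B j)) ->
  measurable ([set x : 'rV[R]_n | forall j, B j (x 0 j)] : set (borel_rV R n)).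
Proof.
move=> mB; rewrite (_ : mkset _ = \bigcap_(j in [set: 'I_n]) (fun x : borel_rV R n => x 0 j) @^-1` B j).
  apply: fin_bigcap_measurable => // j _; rewrite -[X in measurable X]setTI.
  exact: measurable_coord.
by apply/seteqP; split=> x /= h j; have := h j => //; apply.
Qed.

Lemma borel_rV_boxes : measurable = <<s measurable_boxes >> :> set (set (borel_rV R n)).
Proof.
apply/seteqP; split; last first.
  apply: smallest_sub; first exact: sigma_algebra_measurable.
  by move=> _ [B mB ->]; exact: measurable_box.
apply: smallest_sub; first exact: smallest_sigma_algebra.
move=> U oU; rewrite [X in <<s _ >> X](open_rational_boxes oU).
apply: (@countable_bigcupT_measurable _ (g_sigma_algebraType measurable_boxes)).
  exact: countable_rational_centers.
move=> c; apply: bigcup_measurable => k _; apply: sub_sigma_algebra.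
exists (fun j => ball (ratr (c 0 j) : R) k.+1%:R^-1); first by move=> j; exact: measurable_ball.
by apply: eq_set => x; apply/propext; split=> h j; have := h j; rewrite /ball/= distrC.
Qed.

Lemma measurable_lerv (x : 'rV[R]_n) : measurable ([set y | lerv y x] : set (borel_rV R n)).
Proof.
rewrite (_ : mkset _ = [set y : 'rV[R]_n | forall j, `]-oo, x 0 j]%classic (y 0 j)]).
  exact: (@measurable_box (fun j => `]-oo, x 0 j]%classic)).
apply: eq_set => y; apply/propext; split=> [/forallP h j|h].
  by rewrite /= in_itv/= h.
by apply/forallP => j; have := h j; rewrite /= in_itv.
Qed.

End borel_boxes.

(** Boxes form a generating pi-system, and on boxes the definition of [iid] prescribes the
    probability. *)
Lemma iid_same_law (R : realType) d (T : measurableType d) (P : probability T R)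
    (Q : probability R R) m (z1 z2 : T -> 'cV[R]_m) (A : set (borel_rV R m)) :
  iid P Q z1 -> iid P Q z2 -> measurable A ->
  P [set w | A (z1 w)^T] = P [set w | A (z2 w)^T].
Proof.
move=> [mz1 z1E] [mz2 z2E] mA.
have mf (z : T -> 'cV[R]_m) : (forall l, measurable_fun setT (fun w => z w l 0)) ->
    measurable_fun setT ((fun w => (z w)^T) : T -> borel_rV R m).
  by move=> mz; apply: measurable_fun_borel_rV => j; under eq_fun do rewrite mxE; exact: mz.
pose m1 := measure_function_pushforward__canonical__measure_function_Measure P (mf _ mz1).
pose m2 := measure_function_pushforward__canonical__measure_function_Measure P (mf _ mz2).
rewrite -[LHS]/(m1 A) -[RHS]/(m2 A).
apply: (measure_unique measurable_boxes (fun=> setT)) => //.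
- exact: borel_rV_boxes.
- move=> _ _ [B1 mB1 ->] [B2 mB2 ->]; exists (fun j => B1 j `&` B2 j).
    by move=> j; exact: measurableI.
  apply/seteqP; split=> x /=; first by move=> [h1 h2] j.
  by move=> h; split=> j; case: (h j).
- by move=> _; exists (fun=> setT) => //; apply/seteqP; split.
- by apply/seteqP; split=> // x _; exists 0%N.
- move=> _ [B mB ->].
  rewrite -[LHS]/(P [set w | forall j, B j ((z1 w)^T 0 j)]).
  rewrite -[RHS]/(P [set w | forall j, B j ((z2 w)^T 0 j)]).
  have tr (z : T -> 'cV[R]_m) : [set w | forall j, B j ((z w)^T 0 j)] = [set w | forall j, B j (z w j 0)].
    by apply: eq_set => w; apply/propext; split=> h j; have := h j; rewrite mxE.
  by rewrite !tr z1E// z2E.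
- by move=> k; rewrite -[m1 _]/(P setT) probability_setT ltry.
Qed.

(** * Atoms of the marginals and continuity of distribution functions *)

Section non_atoms.
Context {R : realType} {n : nat} (mu : probability (borel_rV R n) R).

Definition non_atom (j : 'I_n) (t : R) : Prop := mu [set y : 'rV[R]_n | y 0 j = t] = 0%E.

Lemma measurable_coord_set (j : 'I_n) (B : set R) : measurable B ->
  measurable ([set y : 'rV[R]_n | B (y 0 j)] : set (borel_rV R n)).
Proof. by move=> mB; rewrite -[X in measurable X]setTI; exact: measurable_coord. Qed.

(* By Fubini, the Lebesgue integral over t of mu {y | y_j = t} vanishes. *)
Lemma non_atom_dense (j : 'I_n) (u v : R) : u < v -> exists2 t, non_atom j t & u < t < v.
Proof.
move=> uv; apply: contrapT => hN.
pose E : set (borel_rV R n * measurableTypeR R) := [set z | (z.1 : 'rV[R]_n) 0 j = z.2].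
have mE : measurable E.
  have mf : measurable_fun setT (fun z : borel_rV R n * measurableTypeR R => (z.1 : 'rV[R]_n) 0 j - z.2).
    apply: measurable_funB; last exact: measurable_snd.
    exact: (measurableT_comp (measurable_coord j) measurable_fst).
  rewrite (_ : E = (fun z => (z.1 : 'rV[R]_n) 0 j - z.2) @^-1` [set 0]).
    by rewrite -[X in measurable X]setTI; exact: mf.
  by apply/seteqP; split=> z /=; [move=> ->; rewrite subrr|move/subr0_eq].
have E0 : (mu \x lebesgue_measure)%E E = 0%E.
  rewrite /product_measure1 (eq_integral (cst 0%E)) ?integral0// => y _ /=.
  rewrite (_ : xsection E y = [set (y : 'rV[R]_n) 0 j]) ?lebesgue_measure_set1//.
  by apply/seteqP; split=> t; rewrite /xsection/= inE.
have : (mu \x^ lebesgue_measure)%E E = 0%E.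
  rewrite -E0; apply/esym; apply: product_measure_unique => // A B mA mB.
  exact: product_measure2E.
rewrite /product_measure2 => I0.
have mf := measurable_fun_ysection mu mE.
have [N [mN N0 subN]] : ae_eq lebesgue_measure setT (mu \o ysection E) (cst 0%E).
  apply/ae_eq_integral_abs => //; rewrite -[RHS]I0.
  by apply: eq_integral => t _; rewrite gee0_abs.
(* If every [t] of the interval were an atom, the interval would lie in the null set [N], against
   its positive length. *)
have : (lebesgue_measure `]u, v[%classic <= lebesgue_measure N)%E.
  apply: le_measure; rewrite ?inE// => t /=; rewrite in_itv/= => tuv.
  apply: subN => /= /(_ Logic.I) t0; apply: hN; exists t => //.
  rewrite /non_atom -[RHS]t0; congr (mu _).
  by apply/seteqP; split=> y; rewrite /ysection/= inE.
rewrite N0 lebesgue_measure_itv/= lte_fin uv -EFinB lee_fin.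
by apply/negP; rewrite -ltNge subr_gt0.
Qed.

Lemma bigcap_ball_set1 (z c : R) : (forall k, `|z - c| <= k.+1%:R^-1) -> z = c.
Proof.
move=> h; apply/eqP; rewrite -subr_eq0 -normr_le0; apply/ler_addgt0Pr => e e0.
have [k _ /(_ k (leqnn k)) /= ke] := near_infty_natSinv_lt (PosNum e0).
by rewrite add0r (le_trans (h k))// ltW.
Qed.

(** Two arguments within 1/(k+1) of [x] have values that differ by at most the mass of [S k], the
    union of the slabs of that half-width around the coordinate hyperplanes through [x]. The slabs
    shrink to a null set. *)
Lemma cdf_rV_continuous (x : 'rV[R]_n) : (forall j, non_atom j (x 0 j)) ->
  {for x, continuous (cdf_rV mu)}.
Proof.
move=> xna; pose S k : set (borel_rV R n) :=
  \bigcup_(j in [set: 'I_n]) [set y : 'rV[R]_n | `|y 0 j - x 0 j| <= k.+1%:R^-1].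
have mSj k j : measurable ([set y : 'rV[R]_n | `|y 0 j - x 0 j| <= k.+1%:R^-1] : set (borel_rV R n)).
  have := @measurable_coord_set j `[x 0 j - k.+1%:R^-1, x 0 j + k.+1%:R^-1]%classic (measurable_itv _).
  congr measurable.
  apply: eq_set => y; rewrite /= in_itv/=; apply/propext.
  by rewrite ler_distl.
have mS k : measurable (S k) by apply: fin_bigcup_measurable.
have S0 : mu (\bigcap_k S k) = 0%E.
  apply/eqP; rewrite -measure_le0.
  apply: (@le_trans _ _ (mu (\big[setU/set0]_(j : 'I_n) [set y : 'rV[R]_n | y 0 j = x 0 j]))).
    apply: le_measure; rewrite ?inE.
    - by apply: bigcapT_measurable.
    - by apply: bigsetU_measurable => j _; apply: (@measurable_coord_set j [set x 0 j]).
    move=> y Sy; apply: contrapT => hN.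
    have /choice[k kP] : forall j : 'I_n, exists k, k.+1%:R^-1 < `|y 0 j - x 0 j|.
      move=> j; apply: contrapT => hk; apply: hN; rewrite (bigD1 j)//=; left.
      apply: bigcap_ball_set1 => k; rewrite leNgt; apply/negP => ?; apply: hk; by exists k.
    have [j _ /=] := Sy (\max_j k j)%N Logic.I; apply/negP; rewrite -ltNge.
    apply: le_lt_trans (kP j); rewrite lef_pV2 ?posrE// ler_nat ltnS.
    exact: leq_bigmax.
  rewrite (le_trans (probability_bigsetU _ _ _))// => [j|].
    exact: (@measurable_coord_set j [set x 0 j]).
  by rewrite big1// => j _; exact: xna.
have Scvg : mu \o S @ \oo --> mu (\bigcap_k S k).
  apply: nonincreasing_cvg_mu => //.
  - by rewrite (le_lt_trans (probability_le1 _ _)) ?ltry.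
  - by apply: bigcapT_measurable.
  - move=> k l kl; apply/subsetPset => y [j _ /= h]; exists j => //=.
    by rewrite (le_trans h)// lef_pV2 ?posrE// ler_nat ltnS.
have fS : (fun k => fine (mu (S k))) @ \oo --> (0 : R).
  by move: Scvg; rewrite S0 => /(@fine_cvg _ _ _ _ _ 0); exact.
apply/(@cvgrPdist_lt _ _ _ _ (nbhs_filter x)) => /= e e0.
have [k _ /(_ k (leqnn k))/=] := (cvgrPdist_lt _ _).1 fS e e0.
rewrite sub0r normrN => /(le_lt_trans (ler_norm _)) Sk.
have le0 : 0 < k.+1%:R^-1 :> R by rewrite invr_gt0.
apply: filterS (nbhsx_ballx x _ le0) => y.
rewrite mx_norm_ball /ball_/= => /rV_norm_lt -/(_ le0) xy.
have finS : mu (S k) \is a fin_num by rewrite fin_num_measure.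
(* A point below [u] but not below [v] has a coordinate between those of [v] and [u], hence lies in
   a slab. *)
have ub (u v : 'rV[R]_n) : (forall j, `|x 0 j - u 0 j| <= k.+1%:R^-1) ->
    (forall j, `|x 0 j - v 0 j| <= k.+1%:R^-1) ->
    cdf_rV mu u <= cdf_rV mu v + fine (mu (S k)).
  move=> xu xv; rewrite -lee_fin EFinD /cdf_rV !fineK ?fin_num_measure//; try exact: measurable_lerv.
  apply: le_trans (measureU2 _ _ _); rewrite ?(mS k)//; try exact: measurable_lerv.
  apply: le_measure; rewrite ?inE.
  - exact: measurable_lerv.
  - by apply: measurableU; [exact: measurable_lerv|exact: mS].
  move=> z /= /forallP zu; have [zv|zv] := boolP (lerv z v); [by left|right].
  move: zv; rewrite /lerv negb_forall => /existsP[j]; rewrite -ltNge => vz; exists j => //=.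
  have := xu j; have := xv j; have := zu j; rewrite !ler_distl.
  move: vz; move: (z 0 j : R) (u 0 j) (v 0 j) (x 0 j) (k.+1%:R^-1 : R) => a b c d f.
  by move=> vz zu1 /andP[h1 h2] /andP[h3 h4]; apply/andP; split; lra.
have xx j : `|x 0 j - x 0 j| <= k.+1%:R^-1 by rewrite subrr normr0 ltW.
have xy' j : `|x 0 j - y 0 j| <= k.+1%:R^-1 by have := xy j; rewrite !mxE => /ltW.
rewrite ltr_distl; have := ub x y xx xy'; have := ub y x xy' xx.
by move=> h1 h2; apply/andP; split; lra.
Qed.

End non_atoms.

Lemma cvg_sumr (R : realType) (I : Type) (r : seq I) (u : I -> nat -> R) (l : I -> R) :
  (forall i, u i m @[m --> \oo] --> l i) ->
  \sum_(i <- r) u i m @[m --> \oo] --> \sum_(i <- r) l i.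
Proof.
move=> ul; elim: r => [|i r IH].
  by rewrite big_nil; under eq_fun do rewrite big_nil; exact: cvg_cst.
by rewrite big_cons; under eq_fun do rewrite big_cons; exact: cvgD.
Qed.

(** * Cell frequencies and the averages that they control *)

Section weak_convergence.
Context {R : realType} {n : nat} (mu : probability (borel_rV R n) R).
Variable a : nat -> 'rV[R]_n.
Hypothesis a_mu : cvg_cdf (sample_cdf a) (cdf_rV mu).

Definition freq (C : pred 'rV[R]_n) (m : nat) : R := avg (fun i => (C (a i))%:R) m.

Definition regular_cell (C : pred 'rV[R]_n) : Prop :=
  measurable ([set y | C y] : set (borel_rV R n)) /\
  freq C m @[m --> \oo] --> fine (mu [set y | C y]).

Lemma regular_cell_eq (C D : pred 'rV[R]_n) : C =1 D -> regular_cell C -> regular_cell D.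
Proof. by move=> /funext ->. Qed.

Lemma regular_orthant (x : 'rV[R]_n) : (forall j, non_atom mu j (x 0 j)) ->
  regular_cell (fun y => lerv y x).
Proof.
move=> xna; split; first exact: measurable_lerv.
rewrite -[X in _ --> X]/(cdf_rV mu x).
suff -> : freq (fun y => lerv y x) = sample_cdf a ^~ x by exact: a_mu (cdf_rV_continuous xna).
apply/funext => m; rewrite /freq /avg /sample_cdf mulrC; congr (_ * _).
rewrite -natr_sum -sum1_card [in RHS]big_mkcond/=; congr (_%:R).
Qed.

Lemma regular_cellD (C D : pred 'rV[R]_n) : (forall y, D y -> C y) ->
  regular_cell C -> regular_cell D -> regular_cell (fun y => C y && ~~ D y).
Proof.
move=> DC [mC fC] [mD fD].
have E : [set y | C y && ~~ D y] = [set y | C y] `\` [set y | D y] :> set 'rV[R]_n.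
  by apply/seteqP; split=> y /=; [move=> /andP[? /negP ?]|move=> [? /negP ?]; apply/andP].
split; first by rewrite E; exact: measurableD.
have -> : fine (mu [set y | C y && ~~ D y]) = fine (mu [set y | C y]) - fine (mu [set y | D y]).
  rewrite E measureD ?(le_lt_trans (probability_le1 _ _)) ?ltry// setIidr.
    by rewrite fineB// fin_num_measure.
  by move=> y; exact: DC.
suff -> : freq (fun y => C y && ~~ D y) = freq C \- freq D by exact: cvgB.
apply/funext => m; rewrite /freq /avg/= -mulrBr -sumrB; congr (_ * _).
apply: eq_bigr => i _; have := DC (a i).
by case: (D (a i)) => [->|_]; rewrite ?subrr// andbT subr0.
Qed.

(** Interpolates between an orthant ([k = 0]) and a half-open box ([k = n]): the lower bound acts on
    the first [k] coordinates. Raising [k] by one is a single difference of nested cells, which is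
    inclusion-exclusion in inductive form. *)
Definition half_open_box (s t : 'rV[R]_n) (k : nat) : pred 'rV[R]_n :=
  fun y => [forall j : 'I_n, ((j < k)%N ==> (s 0 j < y 0 j)) && (y 0 j <= t 0 j)].

Lemma regular_half_open_box (s t : 'rV[R]_n) (k : nat) : (k <= n)%N ->
  (forall j, s 0 j <= t 0 j) -> (forall j, non_atom mu j (s 0 j)) ->
  (forall j, non_atom mu j (t 0 j)) -> regular_cell (half_open_box s t k).
Proof.
elim: k t => [|k IH] t kn st sna tna.
  by apply: regular_cell_eq (regular_orthant tna).
pose k0 := Ordinal kn.
pose t' : 'rV[R]_n := \row_j if j == k0 then s 0 j else t 0 j.
have := @regular_cellD (half_open_box s t k) (half_open_box s t' k).
move=> /(_ _ (IH t (ltnW kn) st sna tna)) H.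
apply: regular_cell_eq (H _ (IH t' (ltnW kn) _ sna _)).
- move=> y; apply/andP/forallP => [[/forallP h1 h2] j|h].
    have /andP[h3 h4] := h1 j; rewrite h4 andbT; apply/implyP; rewrite ltnS leq_eqVlt.
    move=> /orP[/eqP jk|jk]; last by move/implyP: h3; apply.
    have -> : j = k0 by exact: val_inj.
    rewrite ltNge; apply: contra h2 => sk; apply/forallP => i; rewrite mxE.
    by have /andP[-> h] := h1 i; case: eqP => [->|].
  split.
    apply/forallP => j; have /andP[/implyP h1 ->] := h j; rewrite andbT.
    by apply/implyP => jk; apply: h1; rewrite ltnS ltnW.
  apply/negP => /forallP /(_ k0) /andP[_]; rewrite mxE eqxx leNgt.
  by have /andP[/implyP -> //] := h k0.
- move=> y /forallP h; apply/forallP => j; have /andP[-> /=] := h j.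
  by rewrite mxE; case: eqP => // -> /le_trans; apply.
- by move=> j; rewrite mxE; case: eqP => // ->.
- by move=> j; rewrite mxE; case: eqP => // ->.
Qed.

(* The grid points avoid the atoms of the marginals of mu, so that the
   frequency of every cell converges. *)
Lemma regular_grid (K delta : R) : 0 < delta ->
  exists (N : nat) (C : {ffun 'I_n -> 'I_N} -> pred 'rV[R]_n),
    [/\ forall f, regular_cell (C f),
        forall f y z, C f y -> C f z -> `|y - z| < delta &
        forall y : 'rV[R]_n, `|y| <= K -> \sum_f (C f y)%:R = 1 :> R].
Proof.
(* Grid point k is taken in the k-th interval of length [e] counted from -K - e. Consecutive points
   are then less than 2e apart, point 0 lies below -K, and [N] is such that point N lies above K. *)
move=> delta0; pose e := delta / 3.
have e0 : 0 < e by rewrite divr_gt0.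
have /choice[g gP] : forall jk : 'I_n * nat, exists t, non_atom mu jk.1 t /\
    - K - e + e * jk.2%:R < t < - K - e + e * jk.2.+1%:R.
  move=> [j k]/=.
  have [|t ? ?] := @non_atom_dense _ _ mu j (- K - e + e * k%:R) (- K - e + e * k.+1%:R); last by exists t.
  by rewrite ltrD2l ltr_pM2l// ltr_nat.
have gna j k : non_atom mu j (g (j, k)) by have [] := gP (j, k).
have gb j k : - K - e + e * k%:R < g (j, k) < - K - e + e * k.+1%:R by have [] := gP (j, k).
have glt j k : g (j, k) < g (j, k.+1).
  by have /andP[_ h1] := gb j k; have /andP[h2 _] := gb j k.+1; exact: lt_trans h2.
have [N NP] : exists N, 2 * K + e < e * N%:R.
  have [N _ /(_ N (leqnn N))/= h] := nbhs_infty_gtr ((2 * K + e) / e).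
  by exists N; rewrite [ltRHS]mulrC -ltr_pdivrMr.
exists N, (fun f : {ffun 'I_n -> 'I_N} => half_open_box (\row_j g (j, f j : nat)) (\row_j g (j, (f j).+1)) n).
split.
- move=> f; apply: regular_half_open_box => // j; rewrite !mxE//.
  exact: ltW.
- move=> f y z /forallP fy /forallP fz; apply/rV_norm_lt => // j; rewrite !mxE.
  have := fy j; have := fz j; rewrite !mxE ltn_ord/=.
  have /andP[h1 _] := gb j (f j); have /andP[_ h2] := gb j (f j).+1.
  move=> /andP[z1 z2] /andP[y1 y2].
  have w : g (j, (f j).+1) - g (j, f j : nat) < delta.
    apply: (@lt_trans _ _ ((- K - e + e * (f j).+2%:R) - (- K - e + e * (f j)%:R))).
      exact: ltrB.
    by rewrite !mulrS /e; lra.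
  by rewrite ltr_norml; apply/andP; split; lra.
(* The indicator of the k-th grid interval, as a difference of thresholds: the sum over all cells
   factors over the coordinates, and each factor telescopes to 1. *)
move=> y yK; pose I j k : R := (g (j, k) < y 0 j)%R%:R - (g (j, k.+1) < y 0 j)%R%:R.
transitivity (\sum_(f : {ffun 'I_n -> 'I_N}) \prod_j I j (f j)).
  apply: eq_bigr => f _; rewrite /half_open_box.
  have II j k : I j k = ((g (j, k) < y 0 j) && (y 0 j <= g (j, k.+1)))%R%:R.
    rewrite /I; have := glt j k; case: (ltP (g (j, k.+1))) => h1 h2.
      by rewrite (lt_trans h2 h1) subrr.
    by rewrite subr0; case: ltP.
  case: forallP => [h|/forallP].
    rewrite big1// => j _; rewrite II; have := h j; rewrite !mxE ltn_ord/=.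
    by move=> ->.
  rewrite negb_forall => /existsP[j]; rewrite !mxE ltn_ord/= => /negbTE h.
  by rewrite (bigD1 j)//= II h mul0r.
rewrite -(bigA_distr_bigA (fun j (k : 'I_N) => I j k))/= big1// => j _.
rewrite -(big_mkord xpredT (I j)).
rewrite (@telescope_sumr_eq _ 0 N (fun k => - (g (j, k) < y 0 j)%R%:R))//; last first.
  by move=> k _; rewrite /I opprK addrC.
have := rV_norm_ge y j => /le_trans/(_ yK); rewrite ler_norml => /andP[y1 y2].
have -> : g (j, 0%N) < y 0 j.
  by have /andP[_ h] := gb j 0%N; rewrite mulr1 in h; lra.
have -> : (g (j, N) < y 0 j) = false.
  by apply/negbTE; rewrite -leNgt; have /andP[h _] := gb j N; lra.
by rewrite oppr0 add0r opprK.
Qed.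

Lemma avg_le (u v : nat -> R) m : (forall i, u i <= v i) -> avg u m <= avg v m.
Proof. by move=> uv; rewrite /avg ler_wpM2l ?invr_ge0//; apply: ler_sum => i _; exact: uv. Qed.

Lemma avg_dist (u v : nat -> R) (e : R) m : 0 <= e -> (forall i, `|u i - v i| <= e) ->
  `|avg u m - avg v m| <= e.
Proof.
move=> e0 uv; rewrite /avg -mulrBr -sumrB normrM ger0_norm ?invr_ge0//.
case: m => [|m]; first by rewrite invr0 mul0r.
rewrite ler_pdivrMl ?ltr0n// (le_trans (ler_norm_sum _ _ _))//.
apply: (@le_trans _ _ (\sum_(i < m.+1) e)); first by apply: ler_sum => i _; exact: uv.
by rewrite sumr_const card_ord mulr_natl.
Qed.

Lemma cvgn_of_close (u : nat -> R) :
  (forall e : R, 0 < e -> exists2 v : nat -> R, cvgn v & forall m, `|u m - v m| <= e) -> cvgn u.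
Proof.
move=> h; apply/cauchy_cvgP; apply: cauchy_exP => e e0.
have e2 : 0 < e / 2 by rewrite divr_gt0.
have [v cv uv] := h _ e2; exists (limn v).
have [N _ hN] := (cvgrPdist_lt _ _).1 cv _ e2; exists N => // m /= /hN vm.
rewrite /ball/= (_ : limn v - u m = (limn v - v m) - (u m - v m)); last by ring.
by rewrite (le_lt_trans (ler_normB _ _))// (splitr e) ltr_leD// uv.
Qed.

Hypothesis a_bounded : exists K : R, forall i, `|a i| <= K.

Lemma cvgn_avg (s : nat -> R) :
  (forall e : R, 0 < e -> exists2 del : R, 0 < del &
     forall i k, `|a i - a k| < del -> `|s i - s k| <= e) -> cvgn (avg s).
Proof.
move=> us; have [K aK] := a_bounded; apply: cvgn_of_close => e e0.
have [del del0 sdel] := us e e0.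
have [N [C [rC dC pC]]] := regular_grid K del0.
have /choice[v vP] : forall f, exists t, forall i, C f (a i) -> `|s i - t| <= e.
  move=> f; have [[k Cfk]|h] := pselect (exists k, C f (a k)).
    by exists (s k) => i Cfi; apply: sdel; exact: dC Cfi Cfk.
  by exists 0 => i Cfi; case: h; exists i.
exists (avg (fun i => \sum_f v f * (C f (a i))%:R)).
  have -> : avg (fun i => \sum_f v f * (C f (a i))%:R) = (fun m => \sum_f v f * freq (C f) m).
    apply/funext => m; rewrite /freq /avg exchange_big/= mulr_sumr.
    by apply: eq_bigr => f _; rewrite -mulr_sumr mulrCA.
  suff h : \sum_f v f * freq (C f) m @[m --> \oo] --> \sum_f v f * fine (mu [set y | C f y]).
    exact: cvgP h.
  apply: cvg_sumr => f; apply: cvgM; first exact: cvg_cst.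
  by have [] := rC f.
move=> m; apply: avg_dist (ltW e0) _ => i.
have {1}-> : s i = \sum_f s i * (C f (a i))%:R by rewrite -mulr_sumr pC ?mulr1.
rewrite -sumrB.
apply: (le_trans (ler_norm_sum _ _ _)).
apply: (@le_trans _ _ (\sum_f e * (C f (a i))%:R)); last by rewrite -mulr_sumr pC ?mulr1.
apply: ler_sum => f _; rewrite -mulrBl normrM (ger0_norm (ler0n R _)).
by have := vP f i; case: (C f (a i)) => [h|_]; rewrite ?mulr0// !mulr1 h.
Qed.

Lemma measurable_dotrv (v : 'rV[R]_n) :
  measurable_fun [set: borel_rV R n] (dotrv v : borel_rV R n -> R).
Proof.
apply: measurable_sum => j; apply: measurable_funM => //.
exact: measurable_coord.
Qed.

Lemma dotrv_lipschitz (v y z : 'rV[R]_n) :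
  `|dotrv v y - dotrv v z| <= (\sum_j `|v 0 j|) * `|y - z|.
Proof.
rewrite /dotrv -sumrB mulr_suml (le_trans (ler_norm_sum _ _ _))//.
apply: ler_sum => j _; rewrite -mulrBr normrM ler_wpM2l//.
by have := rV_norm_ge (y - z) j; rewrite !mxE.
Qed.

(** Chebyshev cell by cell: if a small cell contains a point where the affine function [g] has size
    at least c, then [g] has size at least c/2 at all sensors of the cell, so its frequency, whose
    limit is its mass, tends to 0. Finitely many such cells cover the part of the ball of radius K
    where |g| is at least c. *)
Lemma avg_sqr_affine_cvg0 (v : 'rV[R]_n) (t : R) :
  avg (fun i => (dotrv v (a i) - t) ^+ 2) m @[m --> \oo] --> (0 : R) ->
  mu [set y | dotrv v y = t] = 1%E.
Proof.
move=> h0; pose g (y : 'rV[R]_n) := dotrv v y - t.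
pose L : R := \sum_j `|v 0 j| + 1.
have L0 : 0 < L by rewrite ltr_wpDl// sumr_ge0.
have gL y z : `|g y - g z| <= L * `|y - z|.
  rewrite /g (_ : _ - _ = dotrv v y - dotrv v z); last by ring.
  by rewrite (le_trans (dotrv_lipschitz v y z))// ler_wpM2r// lerDl.
pose S (K c : R) : set (borel_rV R n) := [set y : 'rV[R]_n | `|y| <= K /\ c <= `|g y|].
have mS K c : measurable (S K c).
  apply: measurableI.
    rewrite -[X in measurable X]setTI.
    have := @measurable_continuous_rV R n (fun y => `|y|) (@norm_continuous _ _) measurableT _ (measurable_itv `]-oo, K]).
    by congr measurable; congr (_ `&` _); apply/seteqP; split=> y /=; rewrite in_itv.
  have mg : measurable_fun [set: borel_rV R n] (fun y : borel_rV R n => `|g y|).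
    by apply: measurableT_comp => //; apply: measurable_funB => //; exact: measurable_dotrv.
  have := mg measurableT _ (measurable_itv `[c, +oo[); rewrite setTI.
  by congr measurable; apply/seteqP; split=> y /=; rewrite in_itv/= andbT.
have S0 (K c : R) : 0 < c -> mu (S K c) = 0%E.
  move=> c0; have [N [C [rC dC pC]]] := regular_grid K (divr_gt0 c0 (mulr_gt0 (ltr0n R 2) L0)).
  pose bad f := `[< exists2 y, C f y & c <= `|g y| >].
  have bad0 f : bad f -> mu [set y | C f y] = 0%E.
    move=> /asboolP[y0 Cy0 gy0]; have [mC fC] := rC f.
    rewrite -[LHS]fineK ?fin_num_measure//; congr EFin.
    apply/eqP; rewrite eq_le fine_ge0// andbT.
    have h1 : avg (fun i => (c / 2) ^- 2 * (g (a i)) ^+ 2) m @[m --> \oo] --> (0 : R).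
      have -> : avg (fun i => (c / 2) ^- 2 * (g (a i)) ^+ 2) =
          (fun m => (c / 2) ^- 2 * avg (fun i => (g (a i)) ^+ 2) m).
        by apply/funext => m; rewrite /avg -mulr_sumr mulrCA.
      rewrite -[X in _ --> X](mulr0 ((c / 2) ^- 2)); apply: cvgM; first exact: cvg_cst.
      exact: h0.
    apply: (ler_cvg_to fC h1); apply: nearW => m; apply: avg_le => i.
    case: (boolP (C f (a i))) => [Ci|_]; last by rewrite mulr_ge0 ?sqr_ge0// invr_ge0 sqr_ge0.
    rewrite mulrC ler_pdivlMr ?exprn_gt0 ?divr_gt0// mul1r -[leRHS]real_normK ?num_real//.
    rewrite ler_sqr ?nnegrE//; last by rewrite divr_ge0// ltW.
    have := gL y0 (a i); have := dC f y0 (a i) Cy0 Ci; rewrite -(ltr_pM2l L0).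
    rewrite (_ : L * (c / (2 * L)) = c / 2); last by field; rewrite gt_eqF.
    move=> h2 h3; have := lerB_dist (g y0) (g (a i)); lra.
  apply/eqP; rewrite -measure_le0.
  apply: (@le_trans _ _ (mu (\big[setU/set0]_f (if bad f then [set y | C f y] else set0)))).
    apply: le_measure; rewrite ?inE//.
      by apply: bigsetU_measurable => f _; case: ifP => // _; have [] := rC f.
    move=> y [yK gy]; have [f Cf] : exists f, C f y.
      apply: contrapT => hN; have := pC y yK; rewrite big1; first by move/eqP; rewrite eq_sym oner_eq0.
      by move=> f _; case: (boolP (C f y)) => // Cf; case: hN; exists f.
    rewrite (bigD1 f)//=; left; rewrite (_ : bad f)//.
    by apply/asboolP; exists y.
  rewrite (le_trans (probability_bigsetU _ _ _))// => [f|].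
    by case: ifP => // _; have [] := rC f.
  by rewrite big1// => f _; case: ifP => [/bad0//|_]; exact: measure0.
have mE : measurable ([set y | dotrv v y = t] : set (borel_rV R n)).
  rewrite (_ : mkset _ = dotrv v @^-1` [set t])//.
  by rewrite -[X in measurable X]setTI; exact: measurable_dotrv.
rewrite -[X in mu X]setCK probability_setC; last exact: measurableC.
suff -> : mu (~` [set y | dotrv v y = t]) = 0%E by rewrite sube0.
apply/eqP; rewrite -measure_le0.
(* The complement of the hyperplane is covered by these countably many null sets. *)
have N0 : mu (\bigcup_k S k%:R k.+1%:R^-1) = 0%E.
  apply/negligibleP; first by apply: bigcupT_measurable.
  by apply: negligible_bigcup => k; apply/negligibleP => //; apply: S0; rewrite invr_gt0.
rewrite -N0; apply: le_measure; rewrite ?inE.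
- exact: measurableC.
- by apply: bigcupT_measurable.
move=> y /= /eqP; rewrite -subr_eq0 -normr_gt0 -/(g y) => gy.
have [k1 _ /(_ k1 (leqnn k1))/= h1] := nbhs_infty_gtr `|y|.
have [k2 _ h2] := near_infty_natSinv_lt (PosNum gy).
exists (maxn k1 k2) => //; split.
  by rewrite (le_trans (ltW h1))// ler_nat leq_maxl.
by apply: ltW; have := h2 (maxn k1 k2) (leq_maxr _ _).
Qed.

End weak_convergence.

(** * Consistency *)

Section euclidean_norm.
Context {R : realType} {n : nat}.
Implicit Types x y u h : 'rV[R]_n.

Lemma dotrvC x y : dotrv x y = dotrv y x.
Proof. by apply: eq_bigr => j _; rewrite mulrC. Qed.

Lemma dotrvDr u x y : dotrv u (x + y) = dotrv u x + dotrv u y.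
Proof. by rewrite -big_split; apply: eq_bigr => j _; rewrite mxE mulrDr. Qed.

Lemma dotrvZr u c x : dotrv u (c *: x) = c * dotrv u x.
Proof. by rewrite mulr_sumr; apply: eq_bigr => j _; rewrite mxE mulrCA. Qed.

Lemma dotrvNr u x : dotrv u (- x) = - dotrv u x.
Proof. by rewrite -scaleN1r dotrvZr mulN1r. Qed.

Lemma dotrvBr u x y : dotrv u (x - y) = dotrv u x - dotrv u y.
Proof. by rewrite dotrvDr dotrvNr. Qed.

Lemma dotrvDl u x y : dotrv (x + y) u = dotrv x u + dotrv y u.
Proof. by rewrite dotrvC dotrvDr !(dotrvC u). Qed.

Lemma dotrvZl u c x : dotrv (c *: x) u = c * dotrv x u.
Proof. by rewrite dotrvC dotrvZr dotrvC. Qed.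

Lemma dotrvBl u x y : dotrv (x - y) u = dotrv x u - dotrv y u.
Proof. by rewrite dotrvC dotrvBr !(dotrvC u). Qed.

Lemma dotrv_ge0 x : 0 <= dotrv x x.
Proof. by apply: sumr_ge0 => j _; rewrite -expr2 sqr_ge0. Qed.

Lemma enorm_sqr x : enorm x ^+ 2 = dotrv x x.
Proof.
rewrite sqr_sqrtr; first by apply: eq_bigr => j _; rewrite expr2.
by apply: sumr_ge0 => j _; rewrite sqr_ge0.
Qed.

Lemma enorm_ge0 x : 0 <= enorm x.
Proof. exact: sqrtr_ge0. Qed.

Lemma enormN x : enorm (- x) = enorm x.
Proof. by congr Num.sqrt; apply: eq_bigr => j _; rewrite mxE sqrrN. Qed.

Lemma enormB x y : enorm (x - y) = enorm (y - x).
Proof. by rewrite -enormN opprB. Qed.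

Lemma enorm0 : enorm (0 : 'rV[R]_n) = 0.
Proof. by rewrite /enorm big1 ?sqrtr0// => j _; rewrite mxE expr0n. Qed.

Lemma enormZ c x : enorm (c *: x) = `|c| * enorm x.
Proof.
apply/eqP; rewrite -(@eqrXn2 _ 2)// ?mulr_ge0 ?enorm_ge0//.
by rewrite exprMn !enorm_sqr dotrvZl dotrvZr mulrA -expr2 real_normK ?num_real.
Qed.

Lemma cauchy_schwarz x y : `|dotrv x y| <= enorm x * enorm y.
Proof.
rewrite -ler_sqr ?nnegrE ?mulr_ge0 ?enorm_ge0// real_normK ?num_real// exprMn !enorm_sqr.
have [y0|y0] := eqVneq (dotrv y y) 0.
  have yj j : y 0 j = 0.
    apply/eqP; rewrite -sqrf_eq0; move/eqP: y0.
    rewrite psumr_eq0 => [/allP/(_ j)|i _]; last by rewrite -expr2 sqr_ge0.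
    by rewrite mem_index_enum expr2 => /(_ isT).
  by rewrite y0 mulr0 /dotrv big1 ?expr0n// => j _; rewrite yj mulr0.
have ygt0 : 0 < dotrv y y by rewrite lt_def y0 dotrv_ge0.
have := dotrv_ge0 (dotrv y y *: x - dotrv x y *: y).
rewrite dotrvBl !dotrvBr !dotrvZl !dotrvZr (dotrvC y x).
set p := dotrv x x; set q := dotrv y y; set s := dotrv x y.
rewrite (_ : _ - _ = q * (p * q - s ^+ 2)); last by ring.
by rewrite pmulr_rge0// subr_ge0.
Qed.

Lemma ler_enormD x y : enorm (x + y) <= enorm x + enorm y.
Proof.
rewrite -ler_sqr ?nnegrE ?addr_ge0 ?enorm_ge0// enorm_sqr dotrvDl !dotrvDr (dotrvC y x) sqrrD !enorm_sqr.
have := le_trans (ler_norm _) (cauchy_schwarz x y); lra.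
Qed.

Lemma ler_dist_enorm x y : `|enorm x - enorm y| <= enorm (x - y).
Proof.
have h u v : enorm u <= enorm (u - v) + enorm v.
  by rewrite -{1}(subrK v u) ler_enormD.
have := h x y; have := h y x; rewrite (enormB y x) ler_norml => h1 h2.
by apply/andP; split; lra.
Qed.

Lemma coord_le_enorm x j : `|x 0 j| <= enorm x.
Proof.
rewrite -sqrtr_sqr; apply: ler_wsqrtr; rewrite (bigD1 j)//= lerDl.
by apply: sumr_ge0 => i _; exact: sqr_ge0.
Qed.

Lemma norm_le_enorm x : `|x| <= enorm x.
Proof. by apply: rV_norm_le => [|j]; [exact: enorm_ge0|exact: coord_le_enorm]. Qed.

Lemma enorm_le_norm x : enorm x <= n%:R * `|x|.
Proof.
rewrite -ler_sqr ?nnegrE ?mulr_ge0 ?enorm_ge0// exprMn enorm_sqr.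
apply: (@le_trans _ _ (\sum_(j < n) `|x| ^+ 2)).
  apply: ler_sum => j _; rewrite -expr2 -[leLHS]real_normK ?num_real//.
  by rewrite ler_sqr ?nnegrE// rV_norm_ge.
rewrite sumr_const card_ord -[leLHS]mulr_natl ler_wpM2r ?sqr_ge0//.
by case: n => [|k]; rewrite ?expr0n// -natrX ler_nat expnS leq_pmulr ?expn_gt0.
Qed.

Lemma enorm_eq0 x : enorm x = 0 -> x = 0.
Proof.
move=> x0; apply/rowP => j; rewrite mxE; apply/eqP.
by rewrite -normr_le0 -x0 coord_le_enorm.
Qed.

(* d = |b + h| - |b| satisfies 2 |b| d = 2 b.h + |h|^2 - d^2, which is solved for d
   by iterating once from d = b.h / |b|. *)
Lemma range_expansion b h (e := dotrv b h / enorm b) : 0 < enorm b ->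
  [/\ `|e| <= enorm h, `|enorm (b + h) - enorm b| <= enorm h,
      `|enorm (b + h) - enorm b - e| <= enorm h ^+ 2 / (2 * enorm b) &
      `|enorm (b + h) - enorm b - (e + (enorm h ^+ 2 - e ^+ 2) / (2 * enorm b))|
        <= enorm h ^+ 3 / (2 * enorm b ^+ 2)].
Proof.
move=> b0; set d := enorm (b + h) - enorm b; have bn0 : enorm b != 0 by rewrite gt_eqF.
have h0 := enorm_ge0 h.
have eh : `|e| <= enorm h.
  rewrite normrM normfV (gtr0_norm b0) ler_pdivrMr// mulrC; exact: cauchy_schwarz.
have dh : `|d| <= enorm h by rewrite (le_trans (ler_dist_enorm _ _))// [b + h]addrC addrK.
have dE : d - e = (enorm h ^+ 2 - d ^+ 2) / (2 * enorm b).
  have := enorm_sqr (b + h); rewrite dotrvDl !dotrvDr (dotrvC h b) -!enorm_sqr => E.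
  have E2 : (d + enorm b) ^+ 2 = enorm b ^+ 2 + 2 * (e * enorm b) + enorm h ^+ 2.
    by rewrite /d subrK E /e divfK//; ring.
  have -> : e = ((d + enorm b) ^+ 2 - enorm b ^+ 2 - enorm h ^+ 2) / (2 * enorm b).
    by rewrite E2; field.
  by field.
have sqh (u : R) : `|u| <= enorm h -> u ^+ 2 <= enorm h ^+ 2.
  by move=> uh; rewrite -[leLHS]real_normK ?num_real// ler_sqr ?nnegrE.
have b20 : 0 < 2 * enorm b by rewrite mulr_gt0.
have deh : `|d - e| <= enorm h ^+ 2 / (2 * enorm b).
  rewrite dE ger0_norm; last by rewrite divr_ge0 ?(ltW b20)// subr_ge0 sqh.
  by rewrite ler_wpM2r ?invr_ge0 ?(ltW b20)// gerBl sqr_ge0.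
split=> //.
(* The error of the second-order formula is (e^2 - d^2) / (2 |b|), which the first-order bound on d
   - e makes cubic. *)
rewrite (_ : d - _ = - ((d - e) * (d + e) / (2 * enorm b))); last first.
  rewrite opprD addrA [in LHS]dE; field.
  by rewrite bn0.
rewrite normrN normrM normfV (gtr0_norm b20) ler_pdivrMr// normrM.
apply: (@le_trans _ _ (enorm h ^+ 2 / (2 * enorm b) * (2 * enorm h))).
  by apply: ler_pM => //; rewrite (le_trans (ler_normD _ _))// mulr_natl mulr2n lerD.
by rewrite le_eqVlt; apply/orP; left; apply/eqP; field.
Qed.

End euclidean_norm.

Section avg_lemmas.
Context {R : realType}.
Implicit Types u v : nat -> R.

Lemma eq_avg u v : u =1 v -> avg u =1 avg v.
Proof. by move=> uv m; congr (_ * _); apply: eq_bigr. Qed.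

Lemma avgD u v m : avg (fun i => u i + v i) m = avg u m + avg v m.
Proof. by rewrite /avg -mulrDr -big_split. Qed.

Lemma avgN u m : avg (fun i => - u i) m = - avg u m.
Proof. by rewrite /avg sumrN mulrN. Qed.

Lemma avgB u v m : avg (fun i => u i - v i) m = avg u m - avg v m.
Proof. by rewrite avgD avgN. Qed.

Lemma avgZ (c : R) u m : avg (fun i => c * u i) m = c * avg u m.
Proof. by rewrite /avg -mulr_sumr mulrCA. Qed.

Lemma avg_sum (I : Type) (r : seq I) (u : I -> nat -> R) m :
  avg (fun i => \sum_(j <- r) u j i) m = \sum_(j <- r) avg (u j) m.
Proof. by rewrite /avg exchange_big mulr_sumr. Qed.

Lemma avg_cst (c : R) m : (0 < m)%N -> avg (fun=> c) m = c.
Proof.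
move=> m0; rewrite /avg sumr_const card_ord -[c *+ m]mulr_natl mulKf//.
by rewrite pnatr_eq0 -lt0n.
Qed.

Lemma avg_ge0 u m : (forall i, 0 <= u i) -> 0 <= avg u m.
Proof. by move=> u0; rewrite mulr_ge0 ?invr_ge0// sumr_ge0. Qed.

Lemma avg_mul_bound (c : R) u v m : (forall i, `|u i| <= c) ->
  `|avg (fun i => u i * v i) m| <= c * avg (fun i => `|v i|) m.
Proof.
move=> uc; rewrite /avg normrM ger0_norm ?invr_ge0// mulrCA ler_wpM2l ?invr_ge0//.
rewrite mulr_sumr (le_trans (ler_norm_sum _ _ _))//.
by apply: ler_sum => i _; rewrite normrM ler_wpM2r.
Qed.

End avg_lemmas.

(** * Convergence of the minimizers for a fixed noise sequence *)

Section consistency.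
Context {R : realType} {n : nat}.
Variables (a : nat -> 'rV[R]_n) (xo : 'rV[R]_n).

Definition range_diff (x : 'rV[R]_n) (i : nat) : R := range_fun a i x - range_fun a i xo.

Lemma range_diff_lipschitz x y i : `|range_diff x i - range_diff y i| <= enorm (x - y).
Proof.
rewrite /range_diff /range_fun (_ : _ - _ = enorm (a i - x) - enorm (a i - y)); last by ring.
rewrite (le_trans (ler_dist_enorm _ _))// enormB.
by rewrite opprB addrC addrA subrK.
Qed.

Lemma range_diff0 i : range_diff xo i = 0.
Proof. exact: subrr. Qed.

Lemma range_diff_bound x i : `|range_diff x i| <= enorm (x - xo).
Proof. by have := range_diff_lipschitz x xo i; rewrite range_diff0 subr0. Qed.

Lemma rational_approximation (x : 'rV[R]_n) (e : R) : 0 < e ->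
  exists q : 'rV[rat]_n, enorm (x - map_mx ratr q) < e.
Proof.
(* Division by n + 1 pays for the passage from the sup norm to the Euclidean norm and is valid for n
   = 0 too. *)
move=> e0; pose e' := e / n.+1%:R.
have e'0 : 0 < e' by rewrite divr_gt0.
have /choice[c cP] : forall j : 'I_n, exists q : rat, `|x 0 j - ratr q| <= e'.
  move=> j; have /rat_in_itvoo[q] : x 0 j < x 0 j + e' by rewrite ltrDl.
  rewrite in_itv/= => /andP[q1 q2]; exists q.
  by rewrite distrC gtr0_norm ?subr_gt0// lerBlDl ltW.
exists (\row_j c j); rewrite (le_lt_trans (enorm_le_norm _))//.
apply: (@le_lt_trans _ _ (n%:R * e')).
  by rewrite ler_wpM2l//; apply: rV_norm_le => [|j]; [exact: ltW|rewrite !mxE].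
by rewrite /e' mulrA ltr_pdivrMr// mulrC ltr_pM2l// ltr_nat.
Qed.

Variable r : nat -> R.
Hypothesis r_bounded : exists K : R, \forall m \near \oo, avg (fun i => `|r i|) m <= K.

Lemma r_bound : exists2 K : R, 0 < K & \forall m \near \oo, avg (fun i => `|r i|) m <= K.
Proof.
have [K hK] := r_bounded; exists (`|K| + 1); first by rewrite ltr_wpDl.
by apply: filterS hK => m /le_trans; apply; rewrite (le_trans (ler_norm K))// lerDl.
Qed.

(** Replacing [x] by a rational point costs at most their distance times the average of |r_i|, which
    is eventually bounded. *)
Lemma noise_avg_everywhere :
  (forall q : 'rV[rat]_n, avg (fun i => range_diff (map_mx ratr q) i * r i) m @[m --> \oo] --> (0 : R)) ->
  forall x, avg (fun i => range_diff x i * r i) m @[m --> \oo] --> (0 : R).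
Proof.
move=> hq x; have [K K0 hK] := r_bound; apply/cvgrPdist_le => e e0.
have [q xq] := rational_approximation x (divr_gt0 e0 (mulr_gt0 (ltr0n R 2) K0)).
have e2 : 0 < e / 2 by rewrite divr_gt0.
have hq2 : \forall m \near \oo, `|0 - avg (fun i => range_diff (map_mx ratr q) i * r i) m| <= e / 2.
  exact: (cvgrPdist_le _ _).1 (hq q) _ e2.
near=> m; rewrite sub0r normrN.
rewrite -[avg _ _](subrK (avg (fun i => range_diff (map_mx ratr q) i * r i) m)) -avgB.
rewrite (le_trans (ler_normD _ _))// (splitr e) lerD//.
  rewrite (eq_avg (fun i => esym (mulrBl (r i) _ _))).
  apply: (le_trans (avg_mul_bound _ _ (fun i => range_diff_lipschitz x (map_mx ratr q) i))).
  apply: (@le_trans _ _ (e / (2 * K) * K)); last by rewrite invfM mulrA divfK ?gt_eqF.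
  apply: ler_pM => //; [exact: enorm_ge0|exact: avg_ge0|exact: ltW|by near: m].
by rewrite -normrN -sub0r; near: m.
Unshelve. all: by end_near.
Qed.

Hypothesis noise0 : forall x, avg (fun i => range_diff x i * r i) m @[m --> \oo] --> (0 : R).
Hypothesis a_bounded : exists K : R, forall i, range_fun a i xo <= K.
Hypothesis localizable : forall x, x != xo ->
  exists2 D : R, 0 < D & avg (fun i => range_diff x i ^+ 2) m @[m --> \oo] --> D.

(* the least squares cost at x, minus that at xo, divided by m *)
Definition excess (m : nat) (x : 'rV[R]_n) : R :=
  avg (fun i => range_diff x i ^+ 2) m - 2 * avg (fun i => range_diff x i * r i) m.

Lemma ls_cost_excess m (x : 'rV[R]_n) (d : nat -> R) :
  (forall i, d i = enorm (a i - xo) + r i) ->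
  ls_cost a d m x = ls_cost a d m xo + m%:R * excess m x.
Proof.
move=> dE; case: m => [|m]; first by rewrite /ls_cost !big_ord0 mul0r addr0.
rewrite /excess mulrBr [2 * _]mulrC [m.+1%:R * (_ * 2)]mulrA /avg !mulrA divff ?pnatr_eq0// !mul1r.
rewrite mulr_suml -sumrB -big_split/=; apply: eq_bigr => i _.
by rewrite dE /range_diff /range_fun; ring.
Qed.

(** At distance t from [xo] every range difference is at least t - 2 K1, whereas the noise term is
    at most 2 t K. Since (t - 2 K1)^2 - 2 t K = t (t - (4 K1 + 2 K)) + 4 K1^2, the radius 4 K1 + 2 K
    does. *)
Lemma excess_far : exists L : R, \forall m \near \oo, forall x, L < enorm (x - xo) -> 0 < excess m x.
Proof.
have [K K0 hK] := r_bound; have [K1 aK] := a_bounded.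
have K10 : 0 <= K1 by rewrite (le_trans _ (aK 0%N))// enorm_ge0.
exists (4 * K1 + 2 * K); near=> m => x; set t := enorm (x - xo) => tL.
have m0 : (0 < m)%N by near: m; exact: nbhs_infty_gt.
have t0 : 0 < t by rewrite (le_lt_trans _ tL)//; lra.
have h1 : (t - 2 * K1) ^+ 2 <= avg (fun i => range_diff x i ^+ 2) m.
  rewrite -(@avg_cst _ ((t - 2 * K1) ^+ 2) m m0); apply: avg_le => i.
  have di : t - 2 * K1 <= range_diff x i.
    have := ler_enormD (x - a i) (a i - xo); rewrite addrA subrK (enormB x (a i)).
    have := aK i; rewrite /range_diff /range_fun -/t; lra.
  have t1 : 0 <= t - 2 * K1 by lra.
  by rewrite ler_sqr ?nnegrE// (le_trans t1).
have h2 : `|avg (fun i => range_diff x i * r i) m| <= t * K.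
  apply: (le_trans (avg_mul_bound _ _ (fun i => range_diff_bound x i))).
  by rewrite ler_wpM2l ?(ltW t0)//; near: m.
have h3 := le_trans (ler_norm _) h2.
rewrite subr_gt0; apply: (lt_le_trans _ h1).
apply: (@le_lt_trans _ _ (2 * (t * K))); first by rewrite ler_wpM2l.
rewrite -subr_gt0 (_ : _ - _ = t * (t - (4 * K1 + 2 * K)) + 4 * K1 ^+ 2); last by ring.
by rewrite ltr_wpDr ?mulr_gt0 ?subr_gt0// mulr_ge0 ?sqr_ge0.
Unshelve. all: by end_near.
Qed.

(** Joint nearness in [y] and [m] is the form consumed by the covering argument over a compact set.
    A move by [eta] changes the excess by at most [eta * S]; with the deviations of the two averages
    at [x], at most half of the limit D is lost. *)
Lemma excess_near (x : 'rV[R]_n) : x != xo ->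
  \forall y \near x & m \near \oo, 0 < excess m y.
Proof.
move=> xxo; have [D D0 hD] := localizable xxo; have [K K0 hK] := r_bound.
pose t := enorm (x - xo); have t0 : 0 <= t by exact: enorm_ge0.
pose S := 2 * t + 1 + 2 * K; have S0 : 0 < S by rewrite /S; lra.
pose eta := Num.min 1 (D / (8 * S)).
have eta0 : 0 < eta by rewrite lt_min ltr01 divr_gt0// mulr_gt0.
have eta1 : eta <= 1 by rewrite ge_min lexx.
have etaS : eta * S <= D / 8.
  have : eta <= D / (8 * S) by rewrite ge_min lexx orbT.
  by rewrite -(ler_pM2r S0) => /le_trans; apply; rewrite invfM mulrA divfK// gt_eqF.
have D4 : 0 < D / 8 by rewrite divr_gt0.
have near_y : \forall y \near x, enorm (y - x) <= eta.
  have e0 : 0 < eta / n.+1%:R by rewrite divr_gt0.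
  apply: filterS (nbhsx_ballx x _ e0) => y; rewrite mx_norm_ball /ball_/= => /ltW xy.
  rewrite enormB (le_trans (enorm_le_norm _))//.
  apply: (@le_trans _ _ (n.+1%:R * (eta / n.+1%:R))); last by rewrite mulrCA divff ?mulr1// pnatr_eq0.
  by apply: ler_pM => //; rewrite ler_nat.
have near_m : \forall m \near \oo, [/\ avg (fun i => `|r i|) m <= K,
    D - D / 8 < avg (fun i => range_diff x i ^+ 2) m &
    avg (fun i => range_diff x i * r i) m < D / 8].
  have h1 : \forall m \near \oo, `|D - avg (fun i => range_diff x i ^+ 2) m| < D / 8.
    exact: (cvgrPdist_lt _ _).1 hD _ D4.
  have h2 : \forall m \near \oo, `|0 - avg (fun i => range_diff x i * r i) m| < D / 8.
    exact: (cvgrPdist_lt _ _).1 (@noise0 x) _ D4.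
  apply: filterS3 hK h1 h2 => m -> h1 h2; split=> //.
    by move: h1; rewrite ltr_distl => /andP[]; lra.
  by move: h2; rewrite sub0r normrN; exact: le_lt_trans (ler_norm _).
exists ([set y | enorm (y - x) <= eta], [set m | [/\ avg (fun i => `|r i|) m <= K,
    D - D / 8 < avg (fun i => range_diff x i ^+ 2) m &
    avg (fun i => range_diff x i * r i) m < D / 8]]); first by split.
move=> [y m] /= [yx [h1 h2 h3]].
have dyx i : `|range_diff y i - range_diff x i| <= eta.
  exact: le_trans (range_diff_lipschitz y x i) yx.
have g1 : `|avg (fun i => range_diff y i * r i) m - avg (fun i => range_diff x i * r i) m| <= eta * K.
  rewrite -avgB (eq_avg (fun i => esym (mulrBl (r i) _ _))).
  by rewrite (le_trans (avg_mul_bound _ _ dyx))// ler_wpM2l// ltW.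
have g2 : `|avg (fun i => range_diff y i ^+ 2) m - avg (fun i => range_diff x i ^+ 2) m| <= eta * (2 * t + 1).
  apply: avg_dist; first by rewrite mulr_ge0 ?(ltW eta0)//; lra.
  move=> i; rewrite subr_sqr normrM; apply: ler_pM => //.
  have := range_diff_bound x i; rewrite -/t => h4.
  rewrite (_ : _ + _ = (range_diff y i - range_diff x i) + 2 * range_diff x i); last by ring.
  rewrite (le_trans (ler_normD _ _))// normrM ger0_norm//; have := dyx i; lra.
move: g1 g2; rewrite /excess !ler_distl => /andP[_ g1] /andP[g2 _].
move: etaS; rewrite /S (_ : eta * _ = eta * (2 * t + 1) + 2 * (eta * K)); last by ring.
move=> etaS; lra.
Qed.

(** A minimizer has nonpositive excess. The excess is eventually positive on the compact annulus
    [Ann], by a finite cover, and beyond it, by growth, which leaves only the ball of radius [e]. *)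
Lemma ls_consistency (d : nat -> R) (xh : nat -> 'rV[R]_n) :
  (forall i, d i = enorm (a i - xo) + r i) ->
  (forall m y, ls_cost a d m (xh m) <= ls_cost a d m y) ->
  xh @ \oo --> xo.
Proof.
move=> dE xhmin; have [L hL] := excess_far.
apply/cvgrPdist_lt => /= e e0.
pose Ann := [set y : 'rV[R]_n | e <= `|y - xo| /\ `|y - xo| <= L].
have cAnn : compact Ann.
  apply: bounded_closed_compact.
    exists (L + `|xo|); split; first exact: num_real.
    move=> M LM y [_ yL] /=; rewrite -(subrK xo y) (le_trans (ler_normD _ _))// ltW//.
    by rewrite (le_lt_trans _ LM)// lerD2r.
  have cf : continuous (fun y : 'rV[R]_n => `|y - xo|).
    move=> y; apply: (@continuous_comp _ _ _ (fun z : 'rV[R]_n => z - xo) (fun z => `|z|)).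
      exact: (@cvgB _ _ _ (nbhs y) (nbhs_filter y) id (cst xo) _ _ cvg_id (cvg_cst _)).
    exact: norm_continuous.
  apply: closedI.
    exact: (closed_comp (fun y _ => cf y) (@closed_ge R e)).
  exact: (closed_comp (fun y _ => cf y) (@closed_le R L)).
have near_Ann : \forall m \near \oo, forall y, Ann y -> 0 < excess m y.
  apply: (iffLR (compact_near_coveringP Ann) cAnn nat \oo (fun m y => 0 < excess m y)) => y [ey _].
  apply: excess_near; apply/eqP => yxo; move: ey; rewrite yxo subrr normr0 leNgt e0.
  by [].
near=> m; rewrite distrC ltNge; apply/negP => exm.
have m0 : (0 < m)%N by near: m; exact: nbhs_infty_gt.
have : 0 < excess m (xh m).
  have [xL|xL] := leP (`|xh m - xo|) L.
    by have : forall y, Ann y -> 0 < excess m y; [near: m; exact: near_Ann|apply].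
  have : forall x, L < enorm (x - xo) -> 0 < excess m x by near: m; exact: hL.
  by apply; rewrite (lt_le_trans xL)// norm_le_enorm.
have := xhmin m xo; rewrite (ls_cost_excess m (xh m) dE) gerDl.
by rewrite pmulr_rle0 ?ltr0n// leNgt => /negP.
Unshelve. all: by end_near.
Qed.

End consistency.

(** * Expansion of the least squares cost *)

Section quadratic_forms.
Context {R : realType} {n : nat}.
Implicit Types (u v h : 'rV[R]_n) (M : 'M[R]_n).

Definition qform M u v : R := (u *m M *m v^T) 0 0.

Lemma dotrv_mx u v : dotrv u v = (u *m v^T) 0 0.
Proof. by rewrite mxE; apply: eq_bigr => j _; rewrite mxE. Qed.

Lemma qform_dotrv M u v : qform M u v = dotrv (u *m M) v.
Proof. by rewrite dotrv_mx. Qed.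

Lemma qformE M u v : qform M u v = \sum_j \sum_k u 0 j * v 0 k * M j k.
Proof.
rewrite /qform mxE exchange_big/=; apply: eq_bigr => k _.
by rewrite !mxE mulr_suml; apply: eq_bigr => j _; rewrite mulrAC.
Qed.

Lemma qformDl M u u' v : qform M (u + u') v = qform M u v + qform M u' v.
Proof. by rewrite /qform !mulmxDl mxE. Qed.

Lemma qformDr M u v v' : qform M u (v + v') = qform M u v + qform M u v'.
Proof. by rewrite /qform linearD /= mulmxDr mxE. Qed.

Lemma qformNl M u v : qform M (- u) v = - qform M u v.
Proof. by rewrite /qform !mulNmx mxE. Qed.

Lemma qformNr M u v : qform M u (- v) = - qform M u v.
Proof. by rewrite /qform linearN /= mulmxN mxE. Qed.

Lemma qform_sym M u v : M^T = M -> qform M u v = qform M v u.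
Proof.
move=> MT; transitivity ((u *m M *m v^T)^T 0 0); first by rewrite mxE.
by rewrite !trmx_mul trmxK MT mulmxA.
Qed.

Lemma sum_coord_bound h (c : 'I_n -> 'I_n -> R) (e : R) : 0 <= e ->
  (forall j k, `|c j k| <= e) ->
  `|\sum_j \sum_k h 0 j * h 0 k * c j k| <= (n%:R ^+ 2 * e) * enorm h ^+ 2.
Proof.
move=> e0 ce; rewrite (le_trans (ler_norm_sum _ _ _))//.
apply: (@le_trans _ _ (\sum_(j < n) \sum_(k < n) e * enorm h ^+ 2)).
  apply: ler_sum => j _; rewrite (le_trans (ler_norm_sum _ _ _))//.
  apply: ler_sum => k _; rewrite normrM mulrC; apply: ler_pM => //.
  by rewrite normrM expr2; apply: ler_pM => //; exact: coord_le_enorm.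
rewrite !sumr_const card_ord -mulrnA -[leLHS]mulr_natl natrM.
by rewrite expr2 !mulrA.
Qed.

End quadratic_forms.

Section asymptotic_linearity.
Context {R : realType} {n : nat}.
Variables (a : nat -> 'rV[R]_n) (xo : 'rV[R]_n).
Variable rho : R.
Hypothesis rho0 : 0 < rho.
Hypothesis a_far : forall i, rho <= enorm (xo - a i).

Definition direction (i : nat) : 'rV[R]_n := (enorm (xo - a i))^-1 *: (xo - a i).

Let l i := enorm (xo - a i).

Let l0 i : 0 < l i.
Proof. exact: lt_le_trans (a_far i). Qed.

Lemma enorm_direction i : enorm (direction i) = 1.
Proof. by rewrite /direction enormZ ger0_norm ?invr_ge0 ?enorm_ge0// mulVf// gt_eqF//; exact: l0. Qed.

Lemma direction_bound i j : `|direction i 0 j| <= 1.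
Proof. by rewrite -(enorm_direction i) coord_le_enorm. Qed.

Let e h i := dotrv (direction i) h.

Let eE h i : e h i = dotrv (xo - a i) h / l i.
Proof. by rewrite /e /direction dotrvZl mulrC. Qed.

Let eh h i : `|e h i| <= enorm h.
Proof. by rewrite (le_trans (cauchy_schwarz _ _))// enorm_direction mul1r. Qed.

Lemma range_diff_expansion h i :
  `|range_diff a xo (xo + h) i - dotrv (direction i) h| <= enorm h ^+ 2 / (2 * rho) /\
  `|range_diff a xo (xo + h) i - (dotrv (direction i) h +
     (enorm h ^+ 2 - dotrv (direction i) h ^+ 2) / (2 * enorm (xo - a i)))|
     <= enorm h ^+ 3 / (2 * rho ^+ 2).
Proof.
have li : 0 < enorm (xo - a i) := l0 i.
have [_ _ h1 h2] := range_expansion h li.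
rewrite /range_diff /range_fun (enormB (a i) (xo + h)) (enormB (a i) xo).
rewrite (_ : xo + h - a i = xo - a i + h); last by rewrite addrAC.
rewrite -/(e h i) eE; split.
  apply: (le_trans h1); rewrite ler_wpM2l ?exprn_ge0 ?enorm_ge0//.
  by rewrite lef_pV2 ?posrE ?mulr_gt0// ler_pM2l.
apply: (le_trans h2); rewrite ler_wpM2l ?exprn_ge0 ?enorm_ge0//.
rewrite lef_pV2 ?posrE ?mulr_gt0 ?exprn_gt0//.
by rewrite ler_pM2l// ler_sqr ?nnegrE ?enorm_ge0// ltW.
Qed.

(** The gradient of the range at [xo] is the unit vector [direction i]; the error bound of first
    order in [range_diff_expansion] yields the limit of the difference quotients. *)
Lemma range_partialE (j : 'I_n) i : range_partial a j xo i = direction i 0 j.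
Proof.
rewrite /range_partial /derive; apply: cvg_lim => //.
have n1 : enorm (delta_mx 0 j : 'rV[R]_n) = 1.
  rewrite /enorm (bigD1 j)//= big1 => [|k kj]; rewrite mxE eqxx/=.
    by rewrite eqxx expr1n addr0 sqrtr1.
  by rewrite (negbTE kj) expr0n.
have dj : dotrv (direction i) (delta_mx 0 j) = direction i 0 j.
  rewrite /dotrv (bigD1 j)//= big1 => [|k kj]; rewrite [delta_mx _ _ _ _]mxE eqxx/=.
    by rewrite eqxx mulr1 addr0.
  by rewrite (negbTE kj) mulr0.
apply/cvgrPdist_le => /= eps eps0.
have d0 : 0 < eps * (2 * rho) by rewrite !mulr_gt0.
near=> t.
have t0 : t != 0 by near: t; exact: nbhs_dnbhs_neq.
have tn : 0 < `|t| by rewrite normr_gt0.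
have := (range_diff_expansion (t *: delta_mx 0 j) i).1.
rewrite dotrvZr dj enormZ n1 mulr1 /range_diff /range_fun => h.
rewrite (addrC (t *: _)) -(ler_pM2l tn) -normrM mulrBr /GRing.scale/= mulVKf//.
rewrite distrC (le_trans h)// expr2 -mulrA ler_pM2l// ler_pdivrMr ?mulr_gt0// ltW//.
near: t; apply: dnbhs0_lt; exact: d0.
Unshelve. all: by end_near.
Qed.

Lemma direction_sqr_sum h i : dotrv (direction i) h ^+ 2 =
  \sum_j \sum_k h 0 j * h 0 k * (direction i 0 j * direction i 0 k).
Proof.
rewrite expr2 /dotrv mulr_suml; apply: eq_bigr => j _.
by rewrite mulr_sumr; apply: eq_bigr => k _; ring.
Qed.

Variables (r : nat -> R) (M : 'M[R]_n) (lam : R).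
Hypothesis r_bounded : exists K : R, \forall m \near \oo, avg (fun i => `|r i|) m <= K.
Hypothesis hM : forall j k,
  avg (fun i => direction i 0 j * direction i 0 k) m @[m --> \oo] --> M j k.
Hypothesis lam0 : 0 < lam.
Hypothesis M_pos : forall v, lam * enorm v ^+ 2 <= qform M v v.
Hypothesis noise1 : forall j, avg (fun i => direction i 0 j * r i) m @[m --> \oo] --> (0 : R).
Hypothesis noise2 : avg (fun i => (enorm (xo - a i))^-1 * r i) m @[m --> \oo] --> (0 : R).
Hypothesis noise3 : forall j k, avg (fun i => direction i 0 j * direction i 0 k *
  (enorm (xo - a i))^-1 * r i) m @[m --> \oo] --> (0 : R).

Definition noise_row (m : nat) : 'rV[R]_n := \row_j avg (fun i => direction i 0 j * r i) m.

Lemma near_forall2 (I J : finType) (u : I -> J -> nat -> R) (c : I -> J -> R) (eps : R) : 0 < eps ->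
  (forall j k, u j k m @[m --> \oo] --> c j k) ->
  \forall m \near \oo, forall j k, `|u j k m - c j k| <= eps.
Proof.
move=> eps0 uc; apply: filter_forall => j; apply: filter_forall => k.
under eq_near do rewrite distrC.
exact: (cvgrPdist_le _ _).1 (@uc j k) _ eps0.
Qed.

(** For the squares the first-order formula for D_i suffices. In the noise term it would leave an
    error bounded only by a fixed multiple of |h|^2, so D_i is taken to second order: the quadratic
    part meets the noise through [noise2] and [noise3], and the cubic remainder times the mean of
    |r_i| is small for small [h]. *)
Lemma excess_expansion (eps : R) : 0 < eps -> exists2 del : R, 0 < del &
  \forall m \near \oo, forall h, enorm h <= del ->
    `|excess a xo r m (xo + h) - (qform M h h - 2 * dotrv (noise_row m) h)|
      <= eps * enorm h ^+ 2.
Proof.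
move=> eps0; have [K K0 hK] := r_bound r_bounded.
(* [c1] collects the errors of size [e1 * N ^+ 2] and [c2] those of size [N ^+ 3]; [e1] and the
   radius are chosen so that each kind uses half of [eps]. *)
pose c1 : R := 2 * n%:R ^+ 2 + 1; pose c2 : R := rho^-1 + K / rho ^+ 2.
have c10 : 0 < c1 by rewrite ltr_wpDl// mulr_ge0 ?exprn_ge0.
have c20 : 0 < c2 by rewrite addr_gt0 ?divr_gt0 ?invr_gt0 ?exprn_gt0.
pose e1 := eps / (2 * c1); have e10 : 0 < e1 by rewrite divr_gt0 ?mulr_gt0.
have e1E : c1 * e1 = eps / 2 by rewrite /e1; field; rewrite gt_eqF.
exists (eps / (2 * c2)); first by rewrite divr_gt0 ?mulr_gt0.
have H1 := near_forall2 e10 hM.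
have H2 : \forall m \near \oo, `|avg (fun i => (enorm (xo - a i))^-1 * r i) m| <= e1.
  by have := (cvgrPdist_le _ _).1 (@noise2) _ e10; under eq_near do rewrite sub0r normrN; apply.
have H3 := near_forall2 e10 noise3.
near=> m => h hdel; set N := enorm h; have N0 : 0 <= N by exact: enorm_ge0.
pose D i := range_diff a xo (xo + h) i.
have sumE (u : nat -> R) :
    avg (fun i => dotrv (direction i) h ^+ 2 * u i) m =
    \sum_j \sum_k h 0 j * h 0 k * avg (fun i => direction i 0 j * direction i 0 k * u i) m.
  under (eq_avg) => i do rewrite direction_sqr_sum mulr_suml.
  rewrite avg_sum; apply: eq_bigr => j _.
  under (eq_avg) => i do rewrite mulr_suml.
  rewrite avg_sum; apply: eq_bigr => k _.
  under (eq_avg) => i do rewrite -mulrA.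
  by rewrite avgZ.
have A1 : `|avg (fun i => D i ^+ 2) m - avg (fun i => dotrv (direction i) h ^+ 2) m| <= N ^+ 3 / rho.
  apply: avg_dist => [|i]; first by rewrite divr_ge0 ?exprn_ge0// ltW.
  have [h1 _] := range_diff_expansion h i; rewrite subr_sqr normrM.
  have -> : N ^+ 3 / rho = N ^+ 2 / (2 * rho) * (2 * N) by field; rewrite gt_eqF.
  apply: ler_pM => //; rewrite (le_trans (ler_normD _ _))// mulr_natl mulr2n lerD// ?eh//.
  by have := range_diff_bound a xo (xo + h) i; rewrite addrAC subrr add0r.
have A2 : `|avg (fun i => dotrv (direction i) h ^+ 2) m - qform M h h| <= n%:R ^+ 2 * e1 * N ^+ 2.
  have -> : avg (fun i => dotrv (direction i) h ^+ 2) m = avg (fun i => dotrv (direction i) h ^+ 2 * 1) m.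
    by apply: eq_avg => i; rewrite mulr1.
  rewrite sumE qformE -sumrB; under eq_bigr do rewrite -sumrB.
  under eq_bigr do under eq_bigr do rewrite -mulrBr.
  apply: sum_coord_bound; first exact: ltW.
  move=> j k; under eq_avg => i do rewrite mulr1.
  by move: j k; near: m.
have B1 : `|avg (fun i => D i * r i) m - avg (fun i => (dotrv (direction i) h +
     (N ^+ 2 - dotrv (direction i) h ^+ 2) / (2 * enorm (xo - a i))) * r i) m| <= N ^+ 3 / (2 * rho ^+ 2) * K.
  rewrite -avgB (eq_avg (fun i => esym (mulrBl (r i) _ _))).
  apply: (le_trans (avg_mul_bound _ _ (fun i => (range_diff_expansion h i).2))).
  have r20 : 0 <= 2 * rho ^+ 2 by rewrite mulr_ge0 ?sqr_ge0.
  rewrite ler_wpM2l//; first by rewrite divr_ge0 ?exprn_ge0.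
  by near: m.
have B2 : avg (fun i => (dotrv (direction i) h +
     (N ^+ 2 - dotrv (direction i) h ^+ 2) / (2 * enorm (xo - a i))) * r i) m =
    dotrv (noise_row m) h + N ^+ 2 / 2 * avg (fun i => (enorm (xo - a i))^-1 * r i) m
    - 2^-1 * avg (fun i => dotrv (direction i) h ^+ 2 * ((enorm (xo - a i))^-1 * r i)) m.
  have -> : dotrv (noise_row m) h = avg (fun i => dotrv (direction i) h * r i) m.
    under [RHS](eq_avg) => i do rewrite /dotrv mulr_suml.
    rewrite avg_sum; apply: eq_bigr => j _; rewrite mxE mulrC -avgZ.
    by apply: eq_avg => i; ring.
  rewrite -!avgZ -avgD -avgB; apply: eq_avg => i.
  by field; rewrite gt_eqF// l0.
have B3 : `|avg (fun i => dotrv (direction i) h ^+ 2 * ((enorm (xo - a i))^-1 * r i)) m| <= n%:R ^+ 2 * e1 * N ^+ 2.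
  rewrite sumE; apply: sum_coord_bound; first exact: ltW.
  move=> j k; under eq_avg => i do rewrite mulrA.
  rewrite -[avg _ _]subr0; move: j k; near: m; exact: H3.
have B4 : `|N ^+ 2 / 2 * avg (fun i => (enorm (xo - a i))^-1 * r i) m| <= N ^+ 2 / 2 * e1.
  rewrite normrM ger0_norm ?divr_ge0 ?sqr_ge0// ler_wpM2l ?divr_ge0 ?sqr_ge0//.
  by near: m.
rewrite /excess -/D; move: A1 A2 B1 B3 B4; rewrite B2.
have -> : N ^+ 3 / rho = N ^+ 2 * (N * rho^-1) by ring.
have -> : N ^+ 3 / (2 * rho ^+ 2) * K = N ^+ 2 * (N * (K / rho ^+ 2)) / 2 by field; rewrite gt_eqF.
have bnd : N ^+ 2 * (N * rho^-1) + N ^+ 2 * (N * (K / rho ^+ 2)) +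
    (2 * (n%:R ^+ 2 * e1 * N ^+ 2) + N ^+ 2 * e1) <= eps * N ^+ 2.
  rewrite (_ : _ + _ = N ^+ 2 * (N * c2 + c1 * e1)); last by rewrite /c1 /c2; ring.
  have : N * c2 <= eps / 2 by move: hdel; rewrite invfM mulrA ler_pdivlMr.
  by move=> Nc2; rewrite [leRHS]mulrC ler_wpM2l ?sqr_ge0// e1E; lra.
move: bnd.
set t1 := N ^+ 2 * (N * rho^-1); set t2 := N ^+ 2 * (N * (K / rho ^+ 2)).
set t3 := n%:R ^+ 2 * e1 * N ^+ 2; have -> : N ^+ 2 / 2 * e1 = N ^+ 2 * e1 / 2 by ring.
set t4 := N ^+ 2 * e1; set t5 := eps * N ^+ 2.
set x1 := avg (fun i => D i ^+ 2) m; set x2 := avg (fun i => dotrv _ _ ^+ 2) m.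
set x3 := qform M h h; set y1 := avg (fun i => D i * r i) m; set y2 := dotrv _ h.
set y3 := N ^+ 2 / 2 * _; set y4 := avg (fun i => dotrv _ _ ^+ 2 * _) m.
rewrite !ler_norml => bnd /andP[? ?] /andP[? ?] /andP[? ?] /andP[? ?] /andP[? ?].
by apply/andP; split; lra.
Unshelve. all: by end_near.
Qed.

Lemma M_sym : M^T = M.
Proof.
apply/matrixP => j k; rewrite mxE.
suff h : avg (fun i => direction i 0 j * direction i 0 k) m @[m --> \oo] --> M k j.
  exact: (cvg_unique _ h (@hM j k)).
under eq_fun do under eq_avg => i do rewrite mulrC.
exact: hM.
Qed.

Lemma M_unit : M \in unitmx.
Proof.
rewrite -row_free_unit -kermx_eq0; apply/rowV0P => v /sub_kermxP vM.
apply: enorm_eq0; apply/eqP; rewrite -sqrf_eq0.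
have := M_pos v; rewrite /qform vM mul0mx mxE pmulr_rle0//.
by rewrite eq_le sqr_ge0 andbT.
Qed.

Definition newton_step (m : nat) : 'rV[R]_n := noise_row m *m invmx M.

(* Completing the square: h M h^T - 2 w h^T = (h - h0) M (h - h0)^T - h0 M h0^T for
   h0 = w M^-1. *)
Lemma newton_step_square m h :
  qform M h h - 2 * dotrv (noise_row m) h =
  qform M (h - newton_step m) (h - newton_step m) - qform M (newton_step m) (newton_step m).
Proof.
have -> : dotrv (noise_row m) h = qform M (newton_step m) h.
  by rewrite qform_dotrv /newton_step mulmxKV// M_unit.
rewrite !(qformDl, qformDr) !(qformNl, qformNr) (qform_sym h _ M_sym); ring.
Qed.

Lemma newton_step_cvg0 : enorm (newton_step m) @[m --> \oo] --> (0 : R).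
Proof.
pose C : R := \sum_j enorm (row j (invmx M)).
have bound m : enorm (newton_step m) <= \sum_j `|noise_row m 0 j| * enorm (row j (invmx M)).
  rewrite /newton_step mulmx_sum_row.
  elim/big_ind2 : _ => [|x1 x2 y1 y2 h1 h2|j _]; first by rewrite enorm0.
    by rewrite (le_trans (ler_enormD _ _))// lerD.
  by rewrite enormZ.
apply: (@squeeze_cvgr _ _ _ _ (fun=> 0) (fun m => \sum_j `|noise_row m 0 j| * enorm (row j (invmx M)))).
- by apply: nearW => m; rewrite enorm_ge0 bound.
- exact: cvg_cst.
rewrite -[X in _ --> X](_ : \sum_(j < n) 0 * enorm (row j (invmx M)) = 0); last first.
  by rewrite big1// => j _; rewrite mul0r.
apply: cvg_sumr => j; apply: cvgM; last exact: cvg_cst.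
rewrite -(@normr0 _ R); apply: cvg_norm.
by under eq_fun do rewrite mxE; exact: noise1.
Qed.

(** The estimate is compared with the competitor [xo + newton_step m]. With p the distance from the
    error hh to the step and q the length of the step, the completed squares leave lam p^2 <= eps
    (|hh|^2 + q^2). *)
Lemma ls_asymptotically_linear (xh : nat -> 'rV[R]_n) (eta : R) : 0 < eta ->
  xh @ \oo --> xo -> (forall m, excess a xo r m (xh m) <= excess a xo r m (xo + newton_step m)) ->
  \forall m \near \oo, enorm (xh m - xo - newton_step m) <= eta * enorm (newton_step m).
Proof.
move=> eta0 xhxo xhmin.
(* From |hh|^2 <= 2 p^2 + 2 q^2 follows lam p^2 <= eps (2 p^2 + 3 q^2). The bound lam / 4 absorbs
   the p^2 term into half of the left side; the other one turns 6 eps q^2 into lam (eta q)^2. *)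
pose eps := Num.min (lam / 4) (lam * eta ^+ 2 / 6).
have eps0 : 0 < eps by rewrite lt_min !divr_gt0// mulr_gt0// exprn_gt0.
have eps1 : eps <= lam / 4 by rewrite ge_min lexx.
have eps2 : 6 * eps <= lam * eta ^+ 2.
  by rewrite mulrC -ler_pdivlMr// ge_min lexx orbT.
have [del del0 hdel] := excess_expansion eps0.
have h1 : \forall m \near \oo, enorm (newton_step m) <= del.
  have : \forall m \near \oo, `|0 - enorm (newton_step m)| <= del.
    exact: (cvgrPdist_le _ _).1 newton_step_cvg0 _ del0.
  apply: filterS => m.
  by rewrite sub0r normrN ger0_norm ?enorm_ge0.
have h2 : \forall m \near \oo, enorm (xh m - xo) <= del.
  have d1 : 0 < del / n.+1%:R by rewrite divr_gt0.
  have : \forall m \near \oo, `|xo - xh m| <= del / n.+1%:R.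
    exact: (cvgrPdist_le _ _).1 xhxo _ d1.
  apply: filterS => m hm; rewrite enormB (le_trans (enorm_le_norm _))//.
  apply: (@le_trans _ _ (n.+1%:R * (del / n.+1%:R))); last by rewrite mulrCA divff ?mulr1// pnatr_eq0.
  by apply: ler_pM => //; rewrite ler_nat.
apply: filterS3 hdel h1 h2 => m hm h1 h2.
have e1 := hm _ h1; have := hm _ h2; rewrite [xo + _]addrC subrK => e2.
have := xhmin m; move: e1 e2; rewrite !newton_step_square subrr.
set g := newton_step m; set hh := xh m - xo.
have := M_pos (hh - g); set p := enorm (hh - g); set q := enorm g.
have -> : qform M (0 : 'rV[R]_n) 0 = 0 by rewrite /qform !mul0mx mxE.
have hq : enorm hh ^+ 2 <= 2 * p ^+ 2 + 2 * q ^+ 2.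
  have : enorm hh <= p + q by rewrite -[hh](subrK g) ler_enormD.
  have p0 : 0 <= p by exact: enorm_ge0. have q0 : 0 <= q by exact: enorm_ge0.
  rewrite -ler_sqr ?nnegrE ?enorm_ge0 ?addr_ge0// => /le_trans; apply.
  rewrite -subr_ge0 (_ : _ - _ = (p - q) ^+ 2); last by ring.
  exact: sqr_ge0.
rewrite !ler_norml => h3 /andP[h4 h5] /andP[h6 h7] h8.
have h9 : eps * enorm hh ^+ 2 <= eps * (2 * p ^+ 2 + 2 * q ^+ 2) by rewrite ler_wpM2l// ltW.
have h10 : lam * p ^+ 2 <= eps * (2 * p ^+ 2 + 3 * q ^+ 2) by lra.
have h11 : eps * p ^+ 2 <= lam / 4 * p ^+ 2 by rewrite ler_wpM2r ?sqr_ge0.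
have h12 : 6 * eps * q ^+ 2 <= lam * eta ^+ 2 * q ^+ 2 by rewrite ler_wpM2r ?sqr_ge0.
have h13 : lam * p ^+ 2 <= lam * (eta * q) ^+ 2 by rewrite exprMn; lra.
move: h13; rewrite ler_pM2l// ler_sqr ?nnegrE ?enorm_ge0//.
by rewrite mulr_ge0 ?enorm_ge0// ltW.
Qed.

End asymptotic_linearity.

(** * Limit law *)

Section cholesky_limit.
Context {R : realType}.

Lemma cvg_prodr (I : Type) (s : seq I) (u : I -> nat -> R) (l : I -> R) :
  (forall i, u i m @[m --> \oo] --> l i) ->
  \prod_(i <- s) u i m @[m --> \oo] --> \prod_(i <- s) l i.
Proof.
move=> ul; elim: s => [|i s IH].
  by rewrite big_nil; under eq_fun do rewrite big_nil; exact: cvg_cst.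
by rewrite big_cons; under eq_fun do rewrite big_cons; exact: cvgM.
Qed.

Lemma cvg_det n (A : nat -> 'M[R]_n) (B : 'M[R]_n) :
  (forall i j, A m i j @[m --> \oo] --> B i j) -> \det (A m) @[m --> \oo] --> \det B.
Proof.
move=> AB; rewrite /determinant; apply: cvg_sumr => s.
by apply: cvgM; [exact: cvg_cst|exact: cvg_prodr].
Qed.

(** Row i comes from U_ii U_ij, which is a Gram entry minus the contributions of earlier rows, so
    U_ii must stay away from 0. As all diagonal entries are at most 1, U_ii^2 is at least the square
    of their product, which is the determinant of the Gram matrix and tends to det M > 0. *)
Lemma cholesky_limit n (U : nat -> 'M[R]_n) (M : 'M[R]_n) :
  (forall m (i j : 'I_n), (j < i)%N -> U m i j = 0) ->
  (forall m i, 0 <= U m i i <= 1) ->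
  (forall i j, ((U m)^T *m U m) i j @[m --> \oo] --> M i j) ->
  M \in unitmx ->
  exists L : 'M[R]_n, [/\ forall i j, U m i j @[m --> \oo] --> L i j & L^T *m L = M].
Proof.
move=> tri diag gram Mu.
have detE m : \det ((U m)^T *m U m) = (\prod_i U m i i) ^+ 2.
  rewrite det_mulmx det_tr -expr2 -det_tr det_trig.
    by congr (_ ^+ 2); apply: eq_bigr => i _; rewrite mxE.
  by apply/is_trig_mxP => i j ij; rewrite mxE tri.
have detcvg := cvg_det gram.
have det0 : 0 < \det M.
  rewrite lt_def -unitfE -unitmxE Mu/=.
  apply: (ler_cvg_to (cvg_cst 0) detcvg); apply: nearW => m.
  by rewrite detE sqr_ge0.
have diag_bound m i : (\prod_k U m k k) ^+ 2 <= U m i i ^+ 2.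
  rewrite (bigD1 i)//= exprMn ler_piMr ?sqr_ge0// exprn_ile1//.
    by apply: prodr_ge0 => k _; have /andP[] := diag m k.
  by apply: prodr_ile1 => k _; exact: diag.
have cvgU k : forall i : 'I_n, (i < k)%N -> forall j, cvgn (fun m => U m i j).
  elim: k => // k IH i; rewrite ltnS => ik.
  have prodU j : exists l : R, U m i i * U m i j @[m --> \oo] --> l.
    (* Rows above [i] converge by induction; rows below it vanish in column [i]. *)
    pose c (k : 'I_n) m := if k == i then 0 else U m k i * U m k j.
    have /choice[lc hc] : forall k, exists l : R, c k m @[m --> \oo] --> l.
      move=> q; rewrite /c; have [_|qi] := eqVneq q i; first by exists 0; exact: cvg_cst.
      have [qi'|iq] := ltnP q i.
        exists (limn (fun m => U m q i) * limn (fun m => U m q j)).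
        by apply: cvgM; apply: IH; exact: leq_trans ik.
      have iltq : (i < q)%N.
        by rewrite ltn_neqAle iq andbT; apply: contra qi => /eqP/val_inj ->.
      exists 0; under eq_fun do rewrite (tri _ _ _ iltq) mul0r.
      exact: cvg_cst.
    exists (M i j - \sum_k lc k).
    have -> : (fun m => U m i i * U m i j) = (fun m => ((U m)^T *m U m) i j - \sum_k c k m).
      apply/funext => m; rewrite mxE (bigD1 i)//= [X in _ - X](bigD1 i)//= /c eqxx add0r mxE.
      rewrite -addrA; apply/esym/eqP; rewrite -subr_eq0 addrAC subrr add0r subr_eq0; apply/eqP.
      by apply: eq_bigr => q /negbTE ->; rewrite mxE.
    by apply: cvgB; [exact: gram|exact: cvg_sumr].
  have [l hl] := prodU i.
  have l0 : 0 < l.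
    apply: (lt_le_trans det0); apply: (ler_cvg_to detcvg hl); apply: nearW => m.
    by rewrite detE -expr2.
  have Uii : U m i i @[m --> \oo] --> Num.sqrt l.
    have -> : (fun m => U m i i) = (fun m => Num.sqrt (U m i i * U m i i)).
      by apply/funext => m; rewrite -expr2 sqrtr_sqr ger0_norm//; have /andP[] := diag m i.
    exact: (cvg_comp _ _ hl (@sqrt_continuous R l)).
  move=> j; have [l' hl'] := prodU j.
  have sl0 : Num.sqrt l != 0 by rewrite gt_eqF// sqrtr_gt0.
  have : (U m i i * U m i j) * (U m i i)^-1 @[m --> \oo] --> l' * (Num.sqrt l)^-1.
    by apply: cvgM => //; exact: cvgV.
  move=> h; suff h' : U m i j @[m --> \oo] --> l' * (Num.sqrt l)^-1 by exact: cvgP h'.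
  apply: cvg_trans h; apply: near_eq_cvg; near=> m.
  rewrite mulrAC divff ?mul1r//; near: m.
  have : \forall m \near \oo, 0 < U m i i; last by apply: filterS => m /gt_eqF ->.
  have sgt0 : 0 < Num.sqrt l by rewrite sqrtr_gt0.
  have hs : \forall m \near \oo, `|Num.sqrt l - U m i i| < Num.sqrt l.
    exact: (cvgrPdist_lt _ _).1 Uii _ sgt0.
  by apply: filterS hs => m; rewrite ltr_norml => /andP[_]; lra.
exists (\matrix_(i, j) limn (fun m => U m i j)).
have cvgL i j : U m i j @[m --> \oo] --> (\matrix_(i, j) limn (fun m => U m i j)) i j.
  by rewrite mxE; apply: (cvgU n) => //; exact: ltn_ord.
split=> //; apply/matrixP => i j.
have h : ((U m)^T *m U m) i j @[m --> \oo] -->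
    ((\matrix_(i, j) limn (fun m => U m i j))^T *m \matrix_(i, j) limn (fun m => U m i j)) i j.
  rewrite mxE; under eq_fun do rewrite mxE.
  apply: cvg_sumr => k; rewrite mxE; under eq_fun do rewrite mxE.
  by apply: cvgM; exact: cvgL.
exact: (cvg_unique _ h (@gram i j)).
Unshelve. all: by end_near.
Qed.

End cholesky_limit.

(** * Convergence in distribution by coupling *)

Section random_vectors.
Context {R : realType} d (T : measurableType d) (P : probability T R) (n : nat).
Implicit Types Y Z W : T -> 'rV[R]_n.

Definition random_vector Y := forall j, measurable_fun setT (fun w => Y w 0 j).

Lemma random_vector_preimage Y (B : set (borel_rV R n)) : random_vector Y ->
  measurable B -> measurable (Y @^-1` B).
Proof.
by move=> mY mB; rewrite -[X in measurable X]setTI; exact: measurable_fun_borel_rV.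
Qed.

Lemma random_vectorB Y Z : random_vector Y -> random_vector Z ->
  random_vector (fun w => Y w - Z w).
Proof.
move=> mY mZ j; under eq_fun do rewrite !mxE.
exact: measurable_funB.
Qed.

Lemma measurable_rV_norm_gt (c : R) : measurable ([set y | c < `|y|] : set (borel_rV R n)).
Proof.
have := @measurable_continuous_rV R n (fun y => `|y|) (@norm_continuous _ _) measurableT _ (measurable_itv `]c, +oo[).
by congr measurable; rewrite setTI; apply/seteqP; split=> y /=; rewrite in_itv/= andbT.
Qed.

Lemma measurable_norm_gt_rv Y (c : R) : random_vector Y -> measurable [set w | c < `|Y w|].
Proof. by move=> mY; exact: (random_vector_preimage mY (measurable_rV_norm_gt c)). Qed.

Lemma measurable_lerv_rv Y (x : 'rV[R]_n) : random_vector Y -> measurable [set w | lerv (Y w) x].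
Proof. by move=> mY; exact: (random_vector_preimage mY (measurable_lerv x)). Qed.

(** The limit superior of the events is null, so by continuity from above the probabilities of the
    tail unions, which contain the events, tend to 0. *)
Lemma ae_eventually_prob_small (E : nat -> set T) (e : R) : (forall m, measurable (E m)) ->
  {ae P, forall w, \forall m \near \oo, ~ E m w} -> 0 < e ->
  \forall m \near \oo, (P (E m) <= e%:E)%E.
Proof.
move=> mE aeE e0.
have L0 : P (lim_sup_set E) = 0%E.
  apply/negligibleP.
    by apply: bigcapT_measurable => k; apply: bigcup_measurable => j _.
  apply: negligibleS aeE => w Ew /= [N _ hN].
  by have [j /= Nj Ej] := Ew N Logic.I; exact: hN Nj Ej.
have cL : P (\bigcup_(k >= m) E k) @[m --> \oo] --> (0%:E : \bar R).
  have h : P (\bigcup_(k >= m) E k) @[m --> \oo] --> P (lim_sup_set E).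
    apply: lim_sup_set_cvg => //.
    by rewrite (le_lt_trans (probability_le1 _ _)) ?ltry//; apply: bigcup_measurable.
  by rewrite L0 in h.
have cf : fine (P (\bigcup_(k >= m) E k)) @[m --> \oo] --> (0 : R) by exact: fine_cvg.
have : \forall m \near \oo, `|0 - fine (P (\bigcup_(k >= m) E k))| <= e.
  exact: (cvgrPdist_le _ _).1 cf _ e0.
apply: filterS => m; rewrite sub0r normrN => /(le_trans (ler_norm _)).
rewrite -lee_fin fineK ?fin_num_measure//; last by apply: bigcup_measurable.
apply: le_trans; apply: le_measure; rewrite ?inE//; first by apply: bigcup_measurable.
by move=> w Ew; exists m => /=.
Qed.

Lemma prob_lerv_shift Y Z (x : 'rV[R]_n) (e : R) : random_vector Y -> random_vector Z ->
  (P [set w | lerv (Y w) x] <=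
   P [set w | lerv (Z w) (x + const_mx e)] + P [set w | (e < `|Y w - Z w|)%R])%E.
Proof.
move=> mY mZ.
apply: le_trans (measureU2 _ _ _); last 2 first.
- exact: measurable_lerv_rv.
- by apply: measurable_norm_gt_rv; exact: random_vectorB.
apply: le_measure; rewrite ?inE.
- exact: measurable_lerv_rv.
- apply: measurableU; first exact: measurable_lerv_rv.
  by apply: measurable_norm_gt_rv; exact: random_vectorB.
move=> w /= /forallP Yx; case: (ltP e (`|Y w - Z w|)) => YZ; [by right|left].
apply/forallP => j; rewrite !mxE.
have := Yx j; have := le_trans (rV_norm_ge (Y w - Z w) j) YZ; rewrite !mxE ler_norml => /andP[h1 h2].
lra.
Qed.

(** [Z m] and [V m] are related only by their law, so the chain from [Y] to [W] consists of two
    comparisons on the sample space, Y with Z and V with W, joined by an equality of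
    probabilities. *)
Lemma cvg_cdf_coupling (Y Z V : nat -> T -> 'rV[R]_n) (W : T -> 'rV[R]_n)
    (N : probability (borel_rV R n) R) :
  (forall m, random_vector (Y m)) -> (forall m, random_vector (Z m)) ->
  (forall m, random_vector (V m)) -> random_vector W ->
  (forall B, measurable B -> N B = P (W @^-1` B)) ->
  (\forall m \near \oo, forall B : set (borel_rV R n), measurable B -> P (Z m @^-1` B) = P (V m @^-1` B)) ->
  (forall w, V m w @[m --> \oo] --> W w) ->
  (forall eta, 0 < eta -> {ae P, forall w, \forall m \near \oo, `|Y m w - Z m w| <= eta * `|Z m w| }) ->
  cvg_in_distribution P Y N.
Proof.
move=> mY mZ mV mW NW ZV VW YZ x Fx.
have VWsmall (c e : R) : 0 < c -> 0 < e -> \forall m \near \oo, (P [set w | (c < `|V m w - W w|)%R] <= e%:E)%E.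
  move=> c0 e0; apply: ae_eventually_prob_small => // [m|].
    by apply: measurable_norm_gt_rv; exact: random_vectorB.
  apply: aeW => w; have : \forall m \near \oo, `|W w - V m w| <= c.
    exact: (cvgrPdist_le _ _).1 (@VW w) _ c0.
  by apply: filterS => m; rewrite distrC /= => h; apply/negP; rewrite -leNgt.
have mYZ (eta : R) m : measurable [set w | 0 < `|Y m w - Z m w| - eta * `|Z m w|].
  have mf : measurable_fun setT (fun w => `|Y m w - Z m w| - eta * `|Z m w|).
    have mn (X : T -> 'rV[R]_n) : random_vector X -> measurable_fun setT (fun w => `|X w|).
      move=> mX; apply: (measurableT_comp (@measurable_continuous_rV R n (fun y => `|y|) (@norm_continuous _ _))).
      exact: measurable_fun_borel_rV.
    apply: measurable_funB; first by apply: mn; exact: random_vectorB.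
    by apply: measurable_funM => //; exact: mn.
  rewrite (_ : mkset _ = (fun w => `|Y m w - Z m w| - eta * `|Z m w|) @^-1` `]0, +oo[%classic).
    by rewrite -[X in measurable X]setTI; exact: mf.
  by apply/seteqP; split=> w /=; rewrite in_itv/= andbT.
(* The bound on Y - Z is relative to |Z|. Tightness of Z is borrowed from [W] through the common law
   with V: |V m| > k + 1 implies |W| > k or |V m - W| > 1. *)
have YZsmall (c e : R) : 0 < c -> 0 < e -> \forall m \near \oo, (P [set w | (c < `|Y m w - Z m w|)%R] <= e%:E)%E.
  move=> c0 e0; have e3 : 0 < e / 3 by rewrite divr_gt0.
  have Wtight : \forall k \near \oo, (P [set w | (k%:R < `|W w|)%R] <= (e / 3)%:E)%E.
    apply: ae_eventually_prob_small => // [m|]; first exact: measurable_norm_gt_rv.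
    apply: aeW => w; have := nbhs_infty_gtr `|W w|; apply: filterS => k /= h.
    by apply/negP; rewrite -leNgt ltW.
  have [k _ /(_ k (leqnn k))/= Wk] := Wtight.
  pose eta : R := c / k.+1%:R.
  have eta0 : 0 < eta by rewrite divr_gt0.
  have etaE : eta * k.+1%:R = c by rewrite divfK// pnatr_eq0.
  have YZeta : \forall m \near \oo, (P [set w | (0 < `|Y m w - Z m w| - eta * `|Z m w|)%R] <= (e / 3)%:E)%E.
    apply: ae_eventually_prob_small => //.
    apply: filterS (YZ _ eta0) => w; apply: filterS => m h /=.
    by apply/negP; rewrite -leNgt subr_le0.
  apply: filterS3 (ZV) YZeta (VWsmall 1 _ ltr01 e3) => m ZVm h1 h2.
  have mE1 := measurable_norm_gt_rv k%:R mW.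
  have mE2 : measurable [set w | 1 < `|V m w - W w|].
    by apply: measurable_norm_gt_rv; exact: random_vectorB.
  have h3 : (P [set w | (k.+1%:R < `|Z m w|)%R] <= (e / 3)%:E + (e / 3)%:E)%E.
    rewrite -[X in P X]/(Z m @^-1` [set y | (k.+1%:R < `|y|)%R]) ZVm; last exact: measurable_rV_norm_gt.
    apply: (@le_trans _ _ (P [set w | (k%:R < `|W w|)%R] + P [set w | (1 < `|V m w - W w|)%R])%E); last exact: leeD.
    apply: le_trans (measureU2 _ _ _) => //.
    apply: le_measure; rewrite ?inE; [exact: measurable_norm_gt_rv|exact: measurableU|].
    move=> w /= h; case: (ltP k%:R `|W w|) => [|Wk']; [by left|right].
    have := lerB_dist (V m w) (W w); rewrite -natr1 in h *; lra.
  have mE3 := measurable_norm_gt_rv k.+1%:R (mZ m).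
  have mE4 := mYZ eta m.
  apply: (@le_trans _ _ (P [set w | (0 < `|Y m w - Z m w| - eta * `|Z m w|)%R] + P [set w | (k.+1%:R < `|Z m w|)%R])%E).
    apply: le_trans (measureU2 _ _ _) => //.
    apply: le_measure; rewrite ?inE; [|exact: measurableU|].
      by apply: measurable_norm_gt_rv; exact: random_vectorB.
    move=> w /= h; case: (ltP k.+1%:R `|Z m w|) => [|Zk]; [by right|left].
    rewrite subr_gt0 (le_lt_trans _ h)// -etaE ler_wpM2l// ltW//.
  rewrite (_ : e%:E = ((e / 3)%:E + ((e / 3)%:E + (e / 3)%:E))%E); first exact: leeD.
  by rewrite -!EFinD; congr EFin; field.
apply/cvgrPdist_le => e e0; have e4 : 0 < e / 4 by rewrite divr_gt0.
have [c c0 hc] : exists2 c : R, 0 < c & forall y, `|x - y| < c -> `|cdf_rV N x - cdf_rV N y| <= e / 4.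
  have := (@cvgrPdist_le _ _ _ _ (nbhs_filter x) _ _).1 Fx _ e4.
  move=> /nbhs_ballP[c /= c0 hc]; exists c => // y xy.
  by apply: hc; rewrite mx_norm_ball.
(* Each of the two comparisons shifts the argument by c/3, so the total shift stays within the
   radius of continuity. *)
have c3 : 0 < c / 3 by rewrite divr_gt0.
apply: filterS3 ZV (VWsmall _ _ c3 e4) (YZsmall _ _ c3 e4) => m ZVm h1 h2.
have NE y : (cdf_rV N y)%:E = P [set w | lerv (W w) y].
  rewrite /cdf_rV fineK ?fin_num_measure//; try exact: measurable_lerv.
  by rewrite NW//; exact: measurable_lerv.
set F := cdf_rV (fun A => P (Y m @^-1` A)) x.
have FE : F%:E = P [set w | lerv (Y m w) x].
  by rewrite /F /cdf_rV fineK// fin_num_measure//; exact: measurable_lerv_rv.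
have ZVlerv y : P [set w | lerv (Z m w) y] = P [set w | lerv (V m w) y].
  exact: (ZVm _ (measurable_lerv y)).
have h1' : (P [set w | (c / 3 < `|W w - V m w|)%R] <= (e / 4)%:E)%E.
  by under eq_set do rewrite distrC.
have h2' : (P [set w | (c / 3 < `|Z m w - Y m w|)%R] <= (e / 4)%:E)%E.
  by under eq_set do rewrite distrC.
have dx (t : R) : `|t| < c -> `|x - (x + const_mx t)| < c.
  move=> tc; apply/rV_norm_lt => // j; rewrite !mxE opprD addrA subrr add0r normrN.
  exact: tc.
have up : F <= cdf_rV N (x + const_mx (c / 3 + c / 3)) + (e / 4 + e / 4).
  rewrite -lee_fin !EFinD FE NE (le_trans (prob_lerv_shift x (c / 3) (mY m) (mZ m)))//.
  rewrite ZVlerv addeA leeD// (le_trans (prob_lerv_shift _ (c / 3) (mV m) mW))//.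
  rewrite -addrA (_ : const_mx _ + const_mx _ = const_mx (c / 3 + c / 3)) ?leeD//.
  by apply/matrixP => i j; rewrite !mxE.
have lo : cdf_rV N (x + const_mx (- (c / 3 + c / 3))) <= F + (e / 4 + e / 4).
  rewrite -lee_fin !EFinD FE NE (le_trans (prob_lerv_shift _ (c / 3) mW (mV m)))//.
  rewrite -ZVlerv addeA leeD// (le_trans (prob_lerv_shift _ (c / 3) (mZ m) (mY m)))//.
  rewrite leeD// -!addrA (_ : const_mx _ + _ = 0) ?addr0//.
  by apply/matrixP => i j; rewrite !mxE; ring.
have cc : `|c / 3 + c / 3| < c by rewrite ger0_norm; lra.
have := hc _ (dx _ cc); have := hc _ (dx (- (c / 3 + c / 3)) _); rewrite normrN => /(_ cc).
rewrite !ler_norml => /andP[? ?] /andP[? ?]; apply/andP; split; lra.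
Qed.

End random_vectors.

Section hyperplanes.
Context {R : realType} {n : nat}.
Implicit Types (u v x y p : 'rV[R]_n).

Lemma affine_subspace_hyperplane v (t : R) : v != 0 ->
  affine_subspace n.-1 [set y | dotrv v y = t].
Proof.
move=> v0; have vv : dotrv v v != 0.
  by rewrite -enorm_sqr sqrf_eq0; apply: contra v0 => /eqP/enorm_eq0 ->.
exists ((t / dotrv v v) *: v), (kermx v^T); split.
  rewrite mxrank_ker mxrank_tr; have -> : \rank v = 1%N by rewrite rank_rV v0.
  by rewrite subn1.
apply/seteqP; split=> y /=.
  move=> vy; apply/sub_kermxP/rowP => j; rewrite ord1 [RHS]mxE -dotrv_mx.
  by rewrite dotrvC dotrvBr dotrvZr vy divfK// subrr.
move=> /sub_kermxP/rowP/(_ 0); rewrite -dotrv_mx [X in _ = X -> _]mxE dotrvC dotrvBr dotrvZr divfK//.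
by move/subr0_eq.
Qed.

End hyperplanes.

(** * Limits of sensor averages and positivity of the Gram matrix *)

Section sensors.
Context {R : realType} {n : nat} (mu : probability (borel_rV R n) R).
Variables (a : nat -> 'rV[R]_n) (xo : 'rV[R]_n) (rho K : R).
Hypothesis a_mu : cvg_cdf (sample_cdf a) (cdf_rV mu).
Hypothesis rho0 : 0 < rho.
Hypothesis a_far : forall i, rho <= enorm (xo - a i).
Hypothesis a_bd : forall i, `|a i| <= K.

Lemma cvgn_avg_lipschitz (s : nat -> R) (C : R) :
  (forall i k, `|s i - s k| <= C * enorm (a i - a k)) -> cvgn (avg s).
Proof.
move=> sC; pose C' : R := `|C| + 1; have C'0 : 0 < C' by rewrite ltr_wpDl.
apply: (cvgn_avg a_mu); first by exists K.
move=> e e0; exists (e / (C' * n.+1%:R)); first by rewrite divr_gt0// mulr_gt0.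
move=> i k ik; apply: (le_trans (sC i k)).
have e2 : enorm (a i - a k) <= n.+1%:R * (e / (C' * n.+1%:R)).
  rewrite (le_trans (enorm_le_norm _))//; apply: ler_pM => //; first by rewrite ler_nat.
  exact: ltW.
apply: (@le_trans _ _ (C' * (n.+1%:R * (e / (C' * n.+1%:R))))); last first.
  rewrite le_eqVlt; apply/orP; left; apply/eqP.
  by rewrite mulrA mulrCA divff ?mulr1// gt_eqF// mulr_gt0.
apply: (@le_trans _ _ (C' * enorm (a i - a k))).
  by rewrite ler_wpM2r ?enorm_ge0// (le_trans (ler_norm C))// lerDl.
by rewrite ler_pM2l.
Qed.

(** With l_i the distance and u_i the direction from [a i] to [xo], u_i - u_k = (a_k - a_i + (l_k -
    l_i) u_k) / l_i. Both summands are bounded by |a_i - a_k|, and l_i is at least [rho]. *)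
Lemma direction_lipschitz i k (j : 'I_n) :
  `|direction a xo i 0 j - direction a xo k 0 j| <= 2 / rho * enorm (a i - a k).
Proof.
have li : 0 < enorm (xo - a i) by exact: lt_le_trans (a_far i).
have lk : 0 < enorm (xo - a k) by exact: lt_le_trans (a_far k).
apply: (@le_trans _ _ (2 * enorm (a i - a k) / enorm (xo - a i))); last first.
  rewrite [leRHS]mulrAC ler_wpM2l ?mulr_ge0 ?enorm_ge0//.
  by rewrite lef_pV2 ?posrE.
have -> : direction a xo i 0 j - direction a xo k 0 j =
    (enorm (xo - a i))^-1 * ((a k - a i) 0 j + (enorm (xo - a k) - enorm (xo - a i)) * direction a xo k 0 j).
  by rewrite !mxE; field; rewrite !gt_eqF.
rewrite normrM gtr0_norm ?invr_gt0// mulrC ler_wpM2r ?invr_ge0 ?(ltW li)//.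
rewrite (le_trans (ler_normD _ _))// mulr_natl mulr2n lerD//.
  by rewrite enormB coord_le_enorm.
rewrite normrM -[leRHS]mulr1; apply: ler_pM => //; last exact: (direction_bound rho0 a_far).
rewrite (le_trans (ler_dist_enorm _ _))// (_ : _ - _ = a i - a k)//.
by rewrite opprB addrC addrA subrK.
Qed.

Definition gram : 'M[R]_n := \matrix_(j, k) limn (avg (fun i => direction a xo i 0 j * direction a xo i 0 k)).

Lemma cvg_gram j k : avg (fun i => direction a xo i 0 j * direction a xo i 0 k) m @[m --> \oo] --> gram j k.
Proof.
rewrite mxE; apply: (@cvgn_avg_lipschitz _ (4 / rho)) => i q.
rewrite (_ : _ - _ = (direction a xo i 0 j - direction a xo q 0 j) * direction a xo i 0 k +
  (direction a xo i 0 k - direction a xo q 0 k) * direction a xo q 0 j); last by ring.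
have h1 := direction_lipschitz i q j; have h2 := direction_lipschitz i q k.
have d1 := direction_bound rho0 a_far i k; have d2 := direction_bound rho0 a_far q j.
rewrite (le_trans (ler_normD _ _))// !normrM.
have -> : 4 / rho * enorm (a i - a q) = 2 / rho * enorm (a i - a q) * 1 + 2 / rho * enorm (a i - a q) * 1 by ring.
by apply: lerD; apply: ler_pM.
Qed.

Lemma cvg_range_diff_sqr x : avg (fun i => range_diff a xo x i ^+ 2) m @[m --> \oo] -->
  limn (avg (fun i => range_diff a xo x i ^+ 2)).
Proof.
apply: (@cvgn_avg_lipschitz _ (4 * enorm (x - xo))) => i k.
rewrite subr_sqr normrM mulrAC.
have -> : 4 * enorm (a i - a k) * enorm (x - xo) = (2 * enorm (a i - a k)) * (2 * enorm (x - xo)) by ring.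
apply: ler_pM => //.
  rewrite /range_diff /range_fun.
  rewrite (_ : _ - _ = (enorm (a i - x) - enorm (a k - x)) - (enorm (a i - xo) - enorm (a k - xo))); last by ring.
  rewrite (le_trans (ler_normB _ _))// mulr_natl mulr2n.
  have h y : `|enorm (a i - y) - enorm (a k - y)| <= enorm (a i - a k).
    rewrite (le_trans (ler_dist_enorm _ _))// (_ : _ - _ = a i - a k)//.
    by rewrite opprB addrA subrK.
  by rewrite lerD.
by rewrite (le_trans (ler_normD _ _))// mulr_natl mulr2n lerD// range_diff_bound.
Qed.

Lemma cvg0_avg_dominated (u v : nat -> R) (C : R) : (forall i, 0 <= u i <= C * v i) ->
  avg v m @[m --> \oo] --> (0 : R) -> avg u m @[m --> \oo] --> (0 : R).
Proof.
move=> uv v0; apply: (@squeeze_cvgr _ _ _ _ (fun=> 0) (fun m => C * avg v m)).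
- apply: nearW => m; rewrite -avgZ avg_ge0/= => [|i]; last by have /andP[] := uv i.
  by apply: avg_le => i; have /andP[] := uv i.
- exact: cvg_cst.
- by rewrite -[X in _ --> X](mulr0 C); apply: cvgM; [exact: cvg_cst|exact: v0].
Qed.

Let K0 : 0 <= K.
Proof. exact: le_trans (a_bd 0%N). Qed.

Lemma range_bound x i : enorm (a i - x) <= n%:R * (K + `|x|).
Proof.
rewrite (le_trans (enorm_le_norm _))// ler_wpM2l//.
by rewrite (le_trans (ler_normB _ _))// lerD2r.
Qed.

Hypothesis no_hyperplane : forall v, v != 0 -> mu [set y | dotrv v y = dotrv v xo] <> 1%E.

Lemma qform_gram v : avg (fun i => dotrv (direction a xo i) v ^+ 2) m @[m --> \oo] --> qform gram v v.
Proof.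
have -> : avg (fun i => dotrv (direction a xo i) v ^+ 2) = (fun m =>
    \sum_j \sum_k v 0 j * v 0 k * avg (fun i => direction a xo i 0 j * direction a xo i 0 k) m).
  apply/funext => m; under (eq_avg) => i do rewrite direction_sqr_sum.
  rewrite avg_sum; apply: eq_bigr => j _; rewrite avg_sum; apply: eq_bigr => k _.
  by rewrite avgZ.
rewrite qformE; apply: cvg_sumr => j; apply: cvg_sumr => k.
by apply: cvgM; [exact: cvg_cst|exact: cvg_gram].
Qed.

Lemma gram_ge0 v : 0 <= qform gram v v.
Proof.
apply: (ler_cvg_to (cvg_cst 0) (@qform_gram v)); apply: nearW => m.
by apply: avg_ge0 => i; exact: sqr_ge0.
Qed.

(** Otherwise the averages of the squares of u_i . v tend to 0. Multiplication by the bounded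
    distances turns u_i . v into v . a_i - v . xo up to sign, so [mu] would be carried by a
    hyperplane through [xo]. *)
Lemma gram_gt0 v : v != 0 -> 0 < qform gram v v.
Proof.
move=> v0; rewrite lt_def gram_ge0 andbT; apply/eqP => q0; apply: (no_hyperplane v0).
refine (avg_sqr_affine_cvg0 a_mu _).
pose C := n%:R * (K + `|xo|).
apply: (@cvg0_avg_dominated _ (fun i => dotrv (direction a xo i) v ^+ 2) (C ^+ 2)).
  move=> i; rewrite sqr_ge0/=.
  have li : 0 < enorm (xo - a i) by exact: lt_le_trans (a_far i).
  have -> : dotrv v (a i) - dotrv v xo = - (enorm (xo - a i) * dotrv (direction a xo i) v).
    by rewrite /direction dotrvZl mulVKf ?gt_eqF// (dotrvC _ v) dotrvBr opprB.
  rewrite sqrrN exprMn ler_wpM2r ?sqr_ge0// ler_sqr ?nnegrE ?enorm_ge0//.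
    by rewrite enormB range_bound.
  by rewrite mulr_ge0// addr_ge0.
by rewrite -q0; exact: qform_gram.
Qed.

Lemma gram_sym : gram^T = gram.
Proof.
apply/matrixP => j k; rewrite !mxE; congr (limn _); apply/funext.
by apply: eq_avg => i; rewrite mulrC.
Qed.

Lemma gram_unit : gram \in unitmx.
Proof.
rewrite -row_free_unit -kermx_eq0; apply/rowV0P => v /sub_kermxP vM.
apply: contrapT => /eqP v0; have := gram_gt0 v0.
by rewrite /qform vM mul0mx mxE ltxx.
Qed.

Lemma qformZl M c u v : qform M (c *: u) v = c * qform (M : 'M[R]_n) u v.
Proof. by rewrite /qform -!scalemxAl mxE. Qed.

Lemma qformZr M c u v : qform M u (c *: v) = c * qform (M : 'M[R]_n) u v.
Proof. by rewrite /qform linearZ /= -!scalemxAr mxE. Qed.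

Lemma qform_cauchy_schwarz u v : qform gram u v ^+ 2 <= qform gram u u * qform gram v v.
Proof.
have [->|v0] := eqVneq v 0.
  by rewrite /qform trmx0 !mulmx0 mxE expr0n mulr0.
have qv := gram_gt0 v0.
have := gram_ge0 (qform gram v v *: u - qform gram u v *: v).
rewrite !(qformDl, qformDr) !(qformNl, qformNr) !(qformZl, qformZr) (qform_sym v u gram_sym).
set p := qform gram u u; set q := qform gram v v; set s := qform gram u v.
rewrite (_ : _ + _ = q * (p * q - s ^+ 2)); last by ring.
by rewrite pmulr_rge0// subr_ge0.
Qed.

Lemma enorm_mulmx v (A : 'M[R]_n) : enorm (v *m A) <= enorm v * \sum_j enorm (row j A).
Proof.
rewrite mulmx_sum_row mulr_sumr.
elim/big_ind2 : _ => [|x1 x2 y1 y2 h1 h2|j _]; first by rewrite enorm0.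
  by rewrite (le_trans (ler_enormD _ _))// lerD.
by rewrite enormZ ler_wpM2r ?enorm_ge0// coord_le_enorm.
Qed.

(* By Cauchy-Schwarz, |v|^4 = qform (v M^-1) v ^ 2 <= qform (v M^-1) (v M^-1) qform v v. *)
Lemma gram_coercive : exists2 lam : R, 0 < lam & forall v, lam * enorm v ^+ 2 <= qform gram v v.
Proof.
pose C : R := \sum_j enorm (row j (invmx gram)) + 1.
have C0 : 0 < C by rewrite ltr_wpDl// sumr_ge0// => j _; exact: enorm_ge0.
exists C^-1; first by rewrite invr_gt0.
move=> v; have [->|v0] := eqVneq v 0; first by rewrite enorm0 expr0n mulr0 /qform !mul0mx mxE.
have nv : 0 < enorm v.
  by rewrite lt_def enorm_ge0 andbT; apply: contra v0 => /eqP/enorm_eq0 ->.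
have vM : v *m invmx gram *m gram = v by rewrite mulmxKV// gram_unit.
have := qform_cauchy_schwarz (v *m invmx gram) v.
rewrite ![qform _ (v *m invmx gram) _]qform_dotrv vM -enorm_sqr => h.
have h1 : dotrv v (v *m invmx gram) <= C * enorm v ^+ 2.
  rewrite (le_trans (ler_norm _))// (le_trans (cauchy_schwarz _ _))//.
  have := enorm_mulmx v (invmx gram) => h1.
  rewrite (_ : C * enorm v ^+ 2 = enorm v * (enorm v * C)); last by ring.
  rewrite ler_wpM2l ?enorm_ge0// (le_trans h1)// ler_wpM2l ?enorm_ge0//.
  by rewrite lerDl.
have := le_trans h (ler_wpM2r (gram_ge0 v) h1).
rewrite expr2 -(mulrA C) (mulrCA C) ler_pM2l ?exprn_gt0//.
by rewrite -ler_pdivrMl// => h2.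
Qed.

(* |y - x|^2 - |y - xo|^2 is an affine function of y. *)
Lemma localizable_of_no_hyperplane x : x != xo ->
  (forall t, mu [set y | dotrv (x - xo) y = t] <> 1%E) ->
  0 < limn (avg (fun i => range_diff a xo x i ^+ 2)).
Proof.
move=> xxo nh; have hl := @cvg_range_diff_sqr x.
rewrite lt_def; apply/andP; split; last first.
  apply: (ler_cvg_to (cvg_cst 0) hl); apply: nearW => m.
  by apply: avg_ge0 => i; exact: sqr_ge0.
(* The level of the perpendicular bisector of [x] and [xo]. The affine function that vanishes there
   equals, at [a i], minus the range difference times the mean of the two ranges. *)
apply/eqP => l0; apply: (nh ((dotrv x x - dotrv xo xo) / 2)).
refine (avg_sqr_affine_cvg0 a_mu _).
pose C := n%:R * (K + `|x|) + n%:R * (K + `|xo|).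
apply: (@cvg0_avg_dominated _ (fun i => range_diff a xo x i ^+ 2) ((C / 2) ^+ 2)).
  move=> i; rewrite sqr_ge0/=.
  have -> : dotrv (x - xo) (a i) - (dotrv x x - dotrv xo xo) / 2 =
      - (range_diff a xo x i * ((enorm (a i - x) + enorm (a i - xo)) / 2)).
    rewrite /range_diff /range_fun mulrA -subr_sqr !enorm_sqr !dotrvBl !dotrvBr.
    by rewrite (dotrvC (a i) x) (dotrvC (a i) xo); field.
  rewrite sqrrN exprMn mulrC ler_wpM2r ?sqr_ge0// ler_sqr ?nnegrE; last 2 first.
  - by rewrite divr_ge0// addr_ge0 ?enorm_ge0.
  - by rewrite divr_ge0// addr_ge0// mulr_ge0// addr_ge0.
  by rewrite ler_wpM2r// lerD// range_bound.
by rewrite -l0.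
Qed.

End sensors.

(** * Law of linear images of the noise *)

Section noise_law.
Context {R : realType} d (T : measurableType d) (P : probability T R) (n : nat).
Variables (s : R) (r : nat -> {RV P >-> R}).
Hypothesis r_indep : mutually_independent r.
Hypothesis r_law : forall i (B : set R), measurable B ->
  distribution P (r i) B = gauss_law s B.

Definition noise (w : T) : 'cV[R]_n := \col_(l < n) r l w.

Lemma random_vector_noise_mulmx k (A : 'M[R]_(n, k)) :
  random_vector (fun w => (noise w)^T *m A).
Proof.
move=> j; under eq_fun do rewrite mxE.
apply: measurable_sum => l; apply: measurable_funM => //.
by under eq_fun do rewrite !mxE; exact: measurable_funP.
Qed.

Lemma mulmx_measurable m k (A : 'M[R]_(m, k)) (B : set (borel_rV R k)) : measurable B ->
  measurable ((fun y => y *m A) @^-1` B : set (borel_rV R m)).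
Proof.
move=> mB; rewrite -[X in measurable X]setTI.
apply: (measurable_fun_borel_rV (f := fun y : borel_rV R m => (y : 'rV[R]_m) *m A)) => // j.
under eq_fun do rewrite mxE.
by apply: measurable_sum => l; apply: measurable_funM => //; exact: measurable_coord.
Qed.

(** Triangularization leaves nonzero at most the first n rows, so only n coordinates of the rotated
    noise count. They are again i.i.d. and are replaced, in law, by the first n noise variables, the
    same for every [m]. *)
Lemma noise_linear_law m (G : 'M[R]_(m, n)) : (n < m)%N ->
  exists U : 'M[R]_n, [/\ forall i j : 'I_n, (j < i)%N -> U i j = 0, forall i, 0 <= U i i,
    U^T *m U = G^T *m G &
    forall B : set (borel_rV R n), measurable B ->
      P [set w | B ((\col_(l < m) r l w)^T *m G)] = P [set w | B ((noise w)^T *m U)]].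
Proof.
move=> nm.
have [z [V [iz zV VG tri]]] := iid_triangularize (@gauss_law_rotation R s) G nm
  (mutually_independent_iid m r_indep r_law).
pose f (i : 'I_n) : 'I_m := widen_ord (ltnW nm) i.
have finj : injective f by move=> i j /(congr1 val) /= /val_inj.
pose U := \matrix_(i < n, j < n) V (f i) j.
have sumf (u : 'I_m -> R) : (forall l : 'I_m, (n <= l)%N -> u l = 0) -> \sum_l u l = \sum_i u (f i).
  move=> u0; pose F l := if insub l is Some l' then u l' else 0.
  transitivity (\sum_(i < n) F i).
    rewrite (big_ord_widen m F (ltnW nm)) (bigID (fun l : 'I_m => (l < n)%N))/=.
    rewrite [X in _ + X]big1 ?addr0 => [|l]; last by rewrite -leqNgt; exact: u0.
    by apply: eq_bigr => l _; rewrite /F valK.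
  by apply: eq_bigr => i _; rewrite /F -[nat_of_ord i]/(val (f i)) valK.
have V0 (l : 'I_m) j : (n <= l)%N -> V l j = 0.
  by move=> nl; apply: (tri l j).1; rewrite (leq_trans _ nl).
have UU : U^T *m U = G^T *m G.
  rewrite -VG; apply/matrixP => i j; rewrite !mxE sumf => [|l nl].
    by apply: eq_bigr => l _; rewrite !mxE.
  by rewrite !mxE V0// mul0r.
exists U; split=> //.
- by move=> i j ji; rewrite mxE; exact: (tri (f i) j).1.
- by move=> i; rewrite mxE; exact: (tri (f i) i).2.
move=> B mB; under eq_set do rewrite -zV.
pose z0 w : 'cV[R]_n := \col_i z w (f i) 0.
have iz0 : iid P (gauss_law s) z0 by exact: iid_sub.
have zE w : (z w)^T *m V = (z0 w)^T *m U.
  apply/rowP => j; rewrite !mxE sumf => [|l nl]; last by rewrite V0// mulr0.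
  by apply: eq_bigr => l _; rewrite !mxE.
under eq_set do rewrite zE.
exact: (iid_same_law iz0 (mutually_independent_iid n r_indep r_law) (mulmx_measurable U mB)).
Qed.

(** A linear functional u of the vector is the combination of the noise variables with coefficients
    C u^T, of variance s^2 |C u^T|^2. *)
Lemma noise_linear_normal (C : 'M[R]_n) (N : set 'rV[R]_n -> \bar R) : (1 < n)%N -> 0 <= s ->
  (forall B : set (borel_rV R n), measurable B -> N B = P [set w | B ((noise w)^T *m C)]) ->
  is_normal_rV N 0 (s ^+ 2 *: (C^T *m C)).
Proof.
move=> n1 s0 NE u B mB.
have -> : dotrv u 0 = 0 by rewrite dotrv_mx trmx0 mulmx0 mxE.
pose c l := (C *m u^T) l 0.
have -> : (u *m (s ^+ 2 *: (C^T *m C)) *m u^T) 0 0 = (Num.sqrt (\sum_l c l ^+ 2) * s) ^+ 2.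
  rewrite exprMn sqr_sqrtr ?sumr_ge0// => [|l _]; last exact: sqr_ge0.
  rewrite -scalemxAr -scalemxAl mxE mulrC; congr (_ * _).
  rewrite -(mulmxA u) -(mulmxA C^T) mulmxA -[u *m C^T]trmxK trmx_mul trmxK mxE.
  by apply: eq_bigr => l _; rewrite mxE expr2.
rewrite normal_law_gauss ?mulr_ge0 ?sqrtr_ge0// -gauss_law_scale.
rewrite -(iid_linear (@gauss_law_rotation R s) c n1 (mutually_independent_iid n r_indep r_law) mB).
rewrite NE; last by rewrite -[X in measurable X]setTI; exact: measurable_dotrv.
congr (P _); apply: eq_set => w /=; congr (B _).
rewrite dotrv_mx trmx_mul trmxK mulmxA -[u *m C^T]trmxK trmx_mul trmxK mxE.
by apply: eq_bigr => l _; rewrite [(_^T) 0 l]mxE.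
Qed.

End noise_law.

Section range_noise.
Context {R : realType} {n : nat} d (T : measurableType d) (P : probability T R).
Variables (a : nat -> 'rV[R]_n) (xo : 'rV[R]_n) (rho : R).
Hypothesis rho0 : 0 < rho.
Hypothesis a_far : forall i, rho <= enorm (xo - a i).
Variables (s : R) (r : nat -> {RV P >-> R}).
Hypothesis s0 : 0 <= s.
Hypothesis r_indep : mutually_independent r.
Hypothesis r_law : forall i (B : set R), measurable B ->
  distribution P (r i) B = gauss_law s B.

(** What the deterministic part asks of a noise sequence: bounded mean size, and vanishing averages
    against the range differences, for consistency, and against the first and second order
    coefficients of the expansion at [xo]. *)
Definition averaged_out (e : nat -> R) : Prop :=
  [/\ exists K : R, \forall m \near \oo, avg (fun i => `|e i|) m <= K,
      forall x, avg (fun i => range_diff a xo x i * e i) m @[m --> \oo] --> (0 : R),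
      forall j, avg (fun i => direction a xo i 0 j * e i) m @[m --> \oo] --> (0 : R),
      avg (fun i => (enorm (xo - a i))^-1 * e i) m @[m --> \oo] --> (0 : R) &
      forall j k, avg (fun i => direction a xo i 0 j * direction a xo i 0 k *
        (enorm (xo - a i))^-1 * e i) m @[m --> \oo] --> (0 : R)].

Lemma ae_averaged_out : {ae P, forall w, averaged_out (fun i => r i w)}.
Proof.
have [K hK] := ae_avg_norm_bounded s0 r_indep r_law.
have inv_bound i : `|(enorm (xo - a i))^-1| <= rho^-1.
  have li : 0 < enorm (xo - a i) by exact: lt_le_trans (a_far i).
  by rewrite gtr0_norm ?invr_gt0// lef_pV2 ?posrE.
have h1 : {ae P, forall w, forall q : 'rV[rat]_n,
    avg (fun i => range_diff a xo (map_mx ratr q) i * r i w) m @[m --> \oo] --> (0 : R)}.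
  (* [ae_foralln] intersects over natural numbers, so the rational points are enumerated by their
     codes. *)
  have h (k : nat) : {ae P, forall w, forall q : 'rV[rat]_n, @choice.unpickle 'rV[rat]_n k = Some q ->
      avg (fun i => range_diff a xo (map_mx ratr q) i * r i w) m @[m --> \oo] --> (0 : R)}.
    case: (choice.unpickle k) => [q|]; last exact: aeW.
    have := ae_avg_cvg0 s0 r_indep r_law (range_diff_bound a xo (map_mx ratr q)).
    by apply: filterS => w hw _ [<-].
  by have := ae_foralln h; apply: filterS => w hw q; apply: (hw (choice.pickle q)); rewrite choice.pickleK.
have h2 : {ae P, forall w, forall j, avg (fun i => direction a xo i 0 j * r i w) m @[m --> \oo] --> (0 : R)}.
  apply: filter_forall => j.
  exact: (ae_avg_cvg0 s0 r_indep r_law (fun i => direction_bound rho0 a_far i j)).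
have h3 := ae_avg_cvg0 s0 r_indep r_law inv_bound.
have h4 : {ae P, forall w, forall j k, avg (fun i => direction a xo i 0 j * direction a xo i 0 k *
    (enorm (xo - a i))^-1 * r i w) m @[m --> \oo] --> (0 : R)}.
  apply: filter_forall => j; apply: filter_forall => k.
  suff h i : `|direction a xo i 0 j * direction a xo i 0 k * (enorm (xo - a i))^-1| <= 1 * 1 * rho^-1.
    exact: (ae_avg_cvg0 s0 r_indep r_law h).
  rewrite !normrM; apply: ler_pM => //; apply: ler_pM => //; exact: (direction_bound rho0 a_far).
apply: filterS3 hK h1 (filterI h2 (filterI h3 h4)) => w hK' h1' [h2' [h3' h4']].
have Kw : exists K : R, \forall m \near \oo, avg (fun i => `|r i w|) m <= K by exists K.
split=> //; exact: noise_avg_everywhere.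
Qed.

Variable M : 'M[R]_n.
Hypothesis hM : forall j k,
  avg (fun i => direction a xo i 0 j * direction a xo i 0 k) m @[m --> \oo] --> M j k.

(** sqrt m times the noise average is r^T G, where the rows of G are u_l / sqrt m. The Gram matrix
    of G is the average of u_l^T u_l and tends to [M]. *)
Lemma noise_row_limit_law : M \in unitmx -> exists (U : nat -> 'M[R]_n) (L : 'M[R]_n),
  [/\ \forall m \near \oo, forall B : set (borel_rV R n), measurable B ->
        P [set w | B (Num.sqrt m%:R *: noise_row a xo (fun i => r i w) m)] =
        P [set w | B ((noise n r w)^T *m U m)],
      forall i j, U m i j @[m --> \oo] --> L i j & L^T *m L = M].
Proof.
move=> Mu; pose G m := \matrix_(l < m, j < n) ((Num.sqrt m%:R)^-1 * direction a xo l 0 j).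
have GG m : (G m)^T *m G m = \matrix_(j, k) avg (fun i => direction a xo i 0 j * direction a xo i 0 k) m.
  apply/matrixP => j k; rewrite !mxE /avg mulr_sumr; apply: eq_bigr => l _; rewrite !mxE.
  rewrite mulrACA -invfM -expr2 sqr_sqrtr//.
(* For [m <= n] the zero matrix is a filler that keeps the shape conditions of [cholesky_limit] true
   for all [m]. *)
have /choice[U hU] : forall m, exists U : 'M[R]_n, (m <= n)%N /\ U = 0 \/ (n < m)%N /\
    [/\ forall i j : 'I_n, (j < i)%N -> U i j = 0, forall i, 0 <= U i i,
    U^T *m U = (G m)^T *m G m &
    forall B : set (borel_rV R n), measurable B ->
      P [set w | B ((\col_(l < m) r l w)^T *m G m)] = P [set w | B ((noise n r w)^T *m U)]].
  move=> m; have [mn|nm] := leqP m n; first by exists 0; left.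
  by have [U hU] := noise_linear_law r_indep r_law (G m) nm; exists U; right.
have UU m : (n < m)%N -> (U m)^T *m U m = (G m)^T *m G m.
  by move=> nm; case: (hU m) => [[]|[_ []]//]; rewrite leqNgt nm.
have [] := @cholesky_limit _ _ U M.
- by move=> m i j ji; case: (hU m) => [[_ ->]|[_ [h _ _ _]]]; [rewrite mxE|exact: h].
(* U_ii^2 is at most the i-th diagonal Gram entry, an average of squared coordinates of unit
   vectors. *)
- move=> m i; case: (hU m) => [[_ ->]|[nm [_ h UG _]]]; first by rewrite mxE lexx ler01.
  rewrite h/= -(@ler_pXn2r _ 2)// ?nnegrE// expr1n.
  have : ((U m)^T *m U m) i i <= 1.
    rewrite UG GG mxE -(@avg_cst _ 1 m) ?(leq_ltn_trans _ nm)//; apply: avg_le => l.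
    rewrite -expr2 -[leLHS]real_normK ?num_real// exprn_ile1//.
    exact: (direction_bound rho0 a_far).
  apply: le_trans; rewrite mxE (bigD1 i)//= mxE expr2 lerDl; apply: sumr_ge0 => l _.
  by rewrite mxE -expr2 sqr_ge0.
- move=> i j; apply: cvg_trans (@hM i j); apply: near_eq_cvg.
  have := nbhs_infty_gt n; apply: filterS => m nm.
  by rewrite UU// GG mxE.
- by [].
move=> L [UL LM]; exists U, L; split=> //.
have := nbhs_infty_gt n; apply: filterS => m nm B mB.
case: (hU m) => [[]|[_ [_ _ _ <-//]]]; first by rewrite leqNgt nm.
have m0 : (0 < m)%N by exact: leq_ltn_trans nm.
have sm : Num.sqrt m%:R * m%:R^-1 = (Num.sqrt m%:R)^-1 :> R.
  by rewrite -[X in _ * X^-1](@sqr_sqrtr R)// expr2 invfM mulrA divff ?mul1r// gt_eqF// sqrtr_gt0 ltr0n.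
congr (P _); apply: eq_set => w; congr (B _); apply/rowP => j; rewrite !mxE /avg mulrA sm mulr_sumr.
by apply: eq_bigr => l _; rewrite !mxE; ring.
Qed.

End range_noise.

(** * Consequences of the assumptions *)

Section assumptions.
Context {R : realType} {n : nat}.

(** A ball around [xo] lies in [X], which contains no sensor. The lower bound keeps directions and
    inverse ranges under control. *)
Lemma interior_far (X : set 'rV[R]_n) (xo : 'rV[R]_n) (a : nat -> 'rV[R]_n) :
  interior X xo -> (forall i, ~ X (a i)) ->
  exists2 rho : R, 0 < rho & forall i, rho <= enorm (xo - a i).
Proof.
move=> /nbhs_ballP[rho /= rho0 ballX] aX; exists rho => // i.
rewrite leNgt; apply/negP => lt_rho; apply: (aX i); apply: ballX.
by rewrite mx_norm_ball; exact: le_lt_trans (norm_le_enorm _) lt_rho.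
Qed.

Lemma bounded_set_norm (A : set 'rV[R]_n) (a : nat -> 'rV[R]_n) :
  bounded_set A -> (forall i, A (a i)) -> exists K : R, forall i, `|a i| <= K.
Proof.
move=> [K [_ hK]] Aa; exists (K + 1) => i; apply: (hK (K + 1)) => //.
by rewrite ltrDl.
Qed.

Lemma tail_mean_avg (p q : nat -> R) : tail_mean p q = avg (fun i => p i * q i).
Proof. by []. Qed.

Lemma tail_norm_sqr (p : nat -> R) (l : R) : avg (fun i => p i ^+ 2) m @[m --> \oo] --> l ->
  tail_norm p ^+ 2 = l.
Proof.
move=> pl; rewrite /tail_norm /tail_product tail_mean_avg.
have -> : (fun i => p i * p i) = (fun i => p i ^+ 2) by apply/funext => i; rewrite expr2.
have -> := cvg_lim _ pl => //; rewrite sqr_sqrtr//.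
apply: (ler_cvg_to (cvg_cst 0) pl); apply: nearW => m.
by apply: avg_ge0 => i; exact: sqr_ge0.
Qed.

Lemma ls_cost_excess_le (a : nat -> 'rV[R]_n) (xo : 'rV[R]_n) (e d : nat -> R) m (x y : 'rV[R]_n) :
  (forall i, d i = enorm (a i - xo) + e i) ->
  ls_cost a d m x <= ls_cost a d m y -> excess a xo e m x <= excess a xo e m y.
Proof.
move=> dE; rewrite (ls_cost_excess _ x dE) (ls_cost_excess _ y dE) lerD2l.
(* For [m = 0] both excesses are 0 by the convention for averages. *)
case: m => [|m]; last by rewrite ler_pM2l.
by rewrite /excess /avg invr0 !mul0r.
Qed.

Lemma cvg_rV (u : nat -> 'rV[R]_n) (l : 'rV[R]_n) :
  (forall j, u m 0 j @[m --> \oo] --> l 0 j) -> u @ \oo --> l.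
Proof.
move=> ul; apply/cvgrPdist_lt => e e0.
have : \forall m \near \oo, forall j, `|l 0 j - u m 0 j| < e.
  by apply: filter_forall => j; exact: (cvgrPdist_lt _ _).1 (ul j) _ e0.
by apply: filterS => m h; apply/rV_norm_lt => // j; rewrite !mxE.
Qed.

End assumptions.

Section random_vector_law.
Context {R : realType} d (T : measurableType d) (P : probability T R) (n : nat).

Lemma random_vector_law (W : T -> 'rV[R]_n) : random_vector W ->
  exists N : probability (borel_rV R n) R,
    forall B, measurable B -> N B = P (W @^-1` B).
Proof.
move=> mW; have mW' : measurable_fun setT (W : T -> borel_rV R n) by exact: measurable_fun_borel_rV.
pose W' : {mfun T >-> borel_rV R n} := HB.pack (W : T -> borel_rV R n) (isMeasurableFun.Build _ _ _ _ _ mW').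
by exists (distribution P W').
Qed.

End random_vector_law.
Theorem theorem1 (R : realType) (n : nat) (hn : n = 2%N \/ n = 3%N)
    (dT : measure_display) (T : measurableType dT) (P : probability T R)
    (* sensors, object position, noise, measurements *)
    (a : nat -> 'rV[R]_n) (xo : 'rV[R]_n)
    (sigma : R) (r : nat -> {RV P >-> R}) (d : nat -> T -> R)
    (hd : forall i w, d i w = enorm (a i - xo) + r i w)
    (* (A1) *)
    (A1_indep : mutually_independent r)
    (A1_normal : forall i (B : set R), measurable B ->
       distribution P (r i) B = normal_law 0 (sigma ^+ 2) B)
    (* (A2) *)
    (X A : set 'rV[R]_n)
    (A2_compact : compact X) (A2_interior : interior X xo)
    (A2_bounded : bounded_set A) (A2_sensors : forall i, A (a i))
    (A2_outside : forall i, ~ X (a i))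
    (* (A3) *)
    (mu : probability (borel_rV R n) R)
    (A3 : cvg_cdf (sample_cdf a) (cdf_rV mu))
    (* ((A4) and (A5)) or (A6) *)
    (A456 :
      ((forall x : 'rV[R]_n, x != xo ->
          tail_norm (fun i => range_fun a i xo - range_fun a i xo) ^+ 2 <
          tail_norm (fun i => range_fun a i x - range_fun a i xo) ^+ 2) /\
       ~ (exists S : set 'rV[R]_n,
            [/\ affine_subspace n.-1 S, S xo & mu S = 1%E]))
      \/
      ~ (exists S : set 'rV[R]_n, affine_subspace n.-1 S /\ mu S = 1%E))
    (* least squares estimates *)
    (xhat : nat -> {RV P >-> borel_rV R n})
    (hxhat : forall m w (y : 'rV[R]_n),
       ls_cost a (d ^~ w) m (xhat m w) <= ls_cost a (d ^~ w) m y) :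
  {ae P, forall w, (fun m => xhat m w : 'rV[R]_n) @ \oo --> xo} /\
  [/\ forall j k : 'I_n,
        tail_product_exists (range_partial a j xo) (range_partial a k xo),
      range_mx a xo \in unitmx &
      exists N : probability (borel_rV R n) R,
        is_normal_rV N 0 (sigma ^+ 2 *: invmx (range_mx a xo)) /\
        cvg_in_distribution P
          (fun m w => Num.sqrt m%:R *: ((xhat m w : 'rV[R]_n) - xo)) N].
Proof.
have n1 : (1 < n)%N by case: hn => ->.
(* [sigma] enters through its square and may be negative, while [gauss_law] is used with a
   nonnegative scale. *)
pose s := `|sigma|; have s0 : 0 <= s by exact: normr_ge0.
have sE : sigma ^+ 2 = s ^+ 2 by rewrite real_normK ?num_real.
have r_law i (B : set R) : measurable B -> distribution P (r i) B = gauss_law s B.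
  by move=> mB; rewrite A1_normal// sE normal_law_gauss.
have [rho rho0 a_far] := interior_far A2_interior A2_outside.
have [K a_bd] := bounded_set_norm A2_bounded A2_sensors.
(* Both alternatives exclude hyperplanes through [xo]: (A5) directly, (A6) a fortiori. *)
have no_hyperplane v : v != 0 -> mu [set y | dotrv v y = dotrv v xo] <> 1%E.
  move=> v0 mu1; have af := affine_subspace_hyperplane (dotrv v xo) v0.
  by case: A456 => [[_]|]; apply; exists [set y | dotrv v y = dotrv v xo].
have localizable x : x != xo ->
    exists2 D : R, 0 < D & avg (fun i => range_diff a xo x i ^+ 2) m @[m --> \oo] --> D.
  move=> xxo; exists (limn (avg (fun i => range_diff a xo x i ^+ 2))); last first.
    exact: (cvg_range_diff_sqr A3 a_bd).
  case: A456 => [[A4 _]|A6]; last first.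
    apply: (localizable_of_no_hyperplane A3 a_bd xxo) => t mu1; apply: A6.
    exists [set y | dotrv (x - xo) y = t]; split=> //.
    by apply: affine_subspace_hyperplane; rewrite subr_eq0.
  (* The value at [xo] is a square, hence nonnegative, so the strict inequality of (A4) makes the
     limit at [x] positive. *)
  have lim := tail_norm_sqr (@cvg_range_diff_sqr _ _ _ _ xo _ A3 a_bd x).
  have := A4 x xxo; rewrite [ltRHS]lim; apply: le_lt_trans; exact: sqr_ge0.
have Mcvg := @cvg_gram _ _ _ _ xo _ _ A3 rho0 a_far a_bd.
have Mu := gram_unit A3 rho0 a_far a_bd no_hyperplane.
have [lam lam0 Mlam] := gram_coercive A3 rho0 a_far a_bd no_hyperplane.
have tmE j k : tail_mean (range_partial a j xo) (range_partial a k xo) =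
    avg (fun i => direction a xo i 0 j * direction a xo i 0 k).
  apply/funext => m; rewrite tail_mean_avg; apply: eq_avg => i.
  by rewrite !(range_partialE rho0 a_far).
have range_mxE : range_mx a xo = gram a xo.
  by apply/matrixP => j k; rewrite !mxE /tail_product tmE.
have averaged := ae_averaged_out rho0 a_far s0 A1_indep r_law.
have ranges_bd : exists K' : R, forall i, range_fun a i xo <= K'.
  by exists (n%:R * (K + `|xo|)) => i; exact: (range_bound a_bd).
have consistent w : averaged_out a xo (fun i => r i w) ->
    (fun m => xhat m w : 'rV[R]_n) @ \oo --> xo.
  move=> [rb noise0 _ _ _].
  exact: (ls_consistency rb noise0 ranges_bd localizable (fun i => hd i w) (fun m => hxhat m w)).
split; first exact: filterS averaged.
rewrite range_mxE; split=> //.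
  by move=> j k; rewrite /tail_product_exists tmE; apply: cvgP (@Mcvg j k).
pose step m w := newton_step a xo (fun i => r i w) (gram a xo) m.
have linear w eta : 0 < eta -> averaged_out a xo (fun i => r i w) ->
    \forall m \near \oo, enorm ((xhat m w : 'rV[R]_n) - xo - step m w) <= eta * enorm (step m w).
  move=> eta0 aw; have xw := consistent w aw; case: aw => rb _ noise1 noise2 noise3.
  apply: (ls_asymptotically_linear rho0 a_far rb Mcvg lam0 Mlam noise1 noise2 noise3 eta0 xw) => m.
  exact: (ls_cost_excess_le (fun i => hd i w) (hxhat m w _)).
have [U [L [lawU UL LM]]] := noise_row_limit_law rho0 a_far A1_indep r_law Mcvg Mu.
(* As L^T L is the Gram matrix M, C^T C = M^-1, which gives the image of the noise under [C] the
   covariance claimed. *)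
pose C := L *m invmx (gram a xo).
have mW := @random_vector_noise_mulmx _ _ _ P n r n C.
have [N NE] := random_vector_law P mW.
exists N; split.
  have -> : invmx (gram a xo) = C^T *m C.
    rewrite /C trmx_mul -mulmxA (mulmxA L^T) LM mulmxV// mulmx1 trmx_inv.
    by rewrite gram_sym.
  by rewrite sE; exact: (noise_linear_normal A1_indep r_law n1 s0 NE).
(* Y is the scaled error, Z the scaled Newton step, V the image of the first n noise variables under
   U_m M^-1, and W its pointwise limit. *)
apply: (@cvg_cdf_coupling _ _ _ _ _ _ (fun m w => Num.sqrt m%:R *: step m w)
  (fun m w => (noise n r w)^T *m (U m *m invmx (gram a xo))) _ _ _ _ _ mW NE).
- move=> m j; under eq_fun do rewrite !mxE.
  apply: measurable_funM => //; apply: measurable_funB => //.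
  exact: (measurableT_comp (measurable_coord j) (measurable_funP (xhat m))).
- move=> m j; under eq_fun do rewrite mxE.
  apply: measurable_funM => //; under eq_fun do rewrite mxE.
  apply: measurable_sum => k; apply: measurable_funM => //; under eq_fun do rewrite mxE.
  by apply: measurable_funM => //; exact: (@measurable_noise_sum _ _ _ P r (fun i => direction a xo i 0 k) m).
- by move=> m; exact: random_vector_noise_mulmx.
- apply: filterS lawU => m hm B mB.
  have := hm _ (mulmx_measurable (invmx (gram a xo)) mB).
  rewrite /preimage/=; under eq_set do rewrite -scalemxAl.
  move=> h; transitivity (P [set w | B ((noise n r w)^T *m U m *m invmx (gram a xo))]); first exact: h.
  by congr (P _); apply: eq_set => w; rewrite mulmxA.
- move=> w; apply: cvg_rV => j; rewrite mxE; under eq_fun do rewrite mxE.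
  apply: cvg_sumr => k; apply: cvgM; first exact: cvg_cst.
  rewrite mxE; under eq_fun do rewrite mxE.
  by apply: cvg_sumr => l; apply: cvgM; [exact: UL|exact: cvg_cst].
(* The factor n + 1 pays for returning from the Euclidean norm of the step to its sup norm. *)
- move=> eta eta0; have e' : 0 < eta / n.+1%:R by rewrite divr_gt0.
  apply: filterS averaged => w /(linear _ _ e'); apply: filterS => m h.
  rewrite -scalerBr !normrZ mulrCA ler_wpM2l// (le_trans (norm_le_enorm _))// (le_trans h)//.
  rewrite mulrAC ler_pdivrMr// -mulrA ler_wpM2l ?(ltW eta0)//.
  rewrite (le_trans (enorm_le_norm _))// mulrC ler_wpM2l// ler_nat//.
Qed.
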